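(* Viscous shocks of the isentropic compressible Navier--Stokes equations have no unstable real spectra, for any shock strength. That is: for every $\gamma\ge 1$ and every $0<v_+<1$, with $a$, the normalized profile $\hat v$, and $h$ as in the context, no real number $\lambda>0$ belongs to the spectrum of the linearized system $$\lambda v+v'-u'=0,\qquad \lambda u+u'-\left(\frac{h(\hat v)}{\hat v^{\gamma+1}}\,v\right)'=\left(\frac{u'}{\hat v}\right)'.$$
   Context: The underlying equations are $v_t-u_x=0$, $u_t+p(v)_x=(u_x/v)_x$, with $p(v)=a_0v^{-\gamma}$, $a_0>0$, $\gamma\ge 1$. A viscous shock is a traveling wave $(\hat v,\hat u)(x-st)$ with asymptotically constant end-states $(v_\pm,u_\pm)$. After passing to the moving frame and rescaling $(x,t,v,u)\to(-\varepsilon s x,\varepsilon s^2t,v/\varepsilon,-u/(\varepsilon s))$, with $\varepsilon$ chosen so that $0<v_+<v_-=1$, the system becomes $v_t+v_x-u_x=0$, $u_t+u_x+(av^{-\gamma})_x=(u_x/v)_x$, and viscous shocks become stationary solutions $(\hat v,\hat u)$ of it, where $$a=v_+^\gamma\,\frac{1-v_+}{1-v_+^\gamma},\qquad \hat v'=\hat v\big(\hat v-1+a(\hat v^{-\gamma}-1)\big),\qquad \hat v(-\infty)=1,\quad \hat v(+\infty)=v_+,$$ and $\hat u-\hat v$ is constant. The profile $\hat v$ is unique up to translation and strictly decreasing. Define $$h(\hat v)=-\hat v^{\gamma+1}+a(\gamma-1)+(a+1)\hat v^\gamma .$$ The system in the claim is the eigenvalue problem for the linearization of the rescaled equations about $(\hat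 v,\hat u)$. Its spectrum is the spectrum of the operator $$L(v,u)=\Big(u'-v',\; -u'+\big(h(\hat v)\hat v^{-\gamma-1}v\big)'+(u'/\hat v)'\Big)$$ on $L^2(\mathbb R;\mathbb C)^2$ with domain $H^1(\mathbb R)\times H^2(\mathbb R)$. Unstable spectrum means spectrum in $\{\operatorname{Re}\lambda\ge 0\}\setminus\{0\}$ ($\lambda=0$ is always an eigenvalue, by translation invariance). *)

(* Defs.v *)
From HB Require Import structures.
From mathcomp Require Import all_boot all_order all_algebra.
From mathcomp Require Import complex.
From mathcomp Require Import all_classical all_reals all_analysis.

Set Implicit Arguments.
Unset Strict Implicit.
Unset Printing Implicit Defensive.

Import Order.TTheory GRing.Theory Num.Theory.
Import numFieldNormedType.Exports.

Local Open Scope classical_set_scope.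
Local Open Scope ring_scope.
Local Open Scope complex_scope.

Section Profile.
Context {R : realType}.
Implicit Types (gamma vp v : R) (vhat : R -> R).

Definition shock_a gamma vp : R :=
  vp `^ gamma * ((1 - vp) / (1 - vp `^ gamma)).

Definition shock_h gamma vp v : R :=
  - (v `^ (gamma + 1)) + shock_a gamma vp * (gamma - 1)
  + (shock_a gamma vp + 1) * v `^ gamma.

(* The specific volume of a profile is positive: its ODE involves
   vhat ^ (- gamma), whereas [powR] takes junk values off ]0, +oo[. *)
Definition shock_profile gamma vp vhat : Prop :=
  [/\ forall x, 0 < vhat x,
      forall x : R, is_derive x (1 : R) vhat
        (vhat x * (vhat x - 1 + shock_a gamma vp * (vhat x `^ (- gamma) - 1))),
      vhat x @[x --> -oo] --> (1 : R)
    & vhat x @[x --> +oo] --> vp].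

End Profile.

Section Sobolev.
Context {R : realType}.
Local Notation mu := (@lebesgue_measure R).
Implicit Types (f g phi : R -> R) (u v : R -> R[i]).

Definition test_function phi : Prop :=
  (forall (n : nat) (x : R), derivable (derive1n n phi) x 1) /\
  compact (closure [set x | phi x != 0]).

Definition is_weak_deriv f g : Prop :=
  [/\ locally_integrable [set: R] f, locally_integrable [set: R] g
    & forall phi, test_function phi ->
        \int[mu]_x (f x * derive1 phi x) = - \int[mu]_x (g x * phi x)].

Definition reF u : R -> R := fun x => complex.Re (u x).
Definition imF u : R -> R := fun x => complex.Im (u x).

(* Elements of L^2(R; C) are represented by functions, and equality in L^2 by
   equality almost everywhere. *)
Definition L2C u : Prop :=
  reF u \in Lfun mu 2%:E /\ imF u \in Lfun mu 2%:E.

Definition is_weak_derivC u v : Prop :=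
  is_weak_deriv (reF u) (reF v) /\ is_weak_deriv (imF u) (imF v).

(* The weak derivative, unique almost everywhere when there is one; the
   function 0 when there is none. *)
Definition wderiv u : R -> R[i] :=
  xget (fun=> 0) [set v | is_weak_derivC u v].

(* H^k(R; C), by iterating weak derivatives *)
Fixpoint Hsob (k : nat) u : Prop :=
  L2C u /\
  if k is k'.+1 then exists2 v, is_weak_derivC u v & Hsob k' v else True.

Definition L2norm u : R :=
  fine (Lnorm mu 2%:E (fun x => (Normc.normc (u x))%:E)).

End Sobolev.

Section Spectrum.
Context {R : realType}.
Local Notation mu := (@lebesgue_measure R).
Local Notation state := ((R -> R[i]) * (R -> R[i]))%type.
Implicit Types (U W F : state) (A : state -> state) (D : set state).

Definition L2pair U : Prop := L2C U.1 /\ L2C U.2.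

Definition L2pair_norm U : R := Num.sqrt (L2norm U.1 ^+ 2 + L2norm U.2 ^+ 2).

Definition eq_L2pair U W : Prop :=
  {ae mu, forall x, U.1 x = W.1 x} /\ {ae mu, forall x, U.2 x = W.2 x}.

Definition shifted A (lambda : R[i]) U : state :=
  (fun x => lambda * U.1 x - (A U).1 x, fun x => lambda * U.2 x - (A U).2 x).

(* Resolvent set of the operator A on L^2(R; C)^2 with domain D: lambda - A is
   a bijection from D to L^2(R; C)^2 with bounded inverse. *)
Definition resolvent_set A D : set R[i] := [set lambda |
  [/\ forall U W, D U -> D W ->
        eq_L2pair (shifted A lambda U) (shifted A lambda W) -> eq_L2pair U W,
      forall F, L2pair F ->
        exists2 U, D U & eq_L2pair (shifted A lambda U) F
    & exists C : R, forall U, D U ->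
        L2pair_norm U <= C * L2pair_norm (shifted A lambda U)]].

Definition spectrum A D : set R[i] := ~` resolvent_set A D.

End Spectrum.

Section LinearizedNavierStokes.
Context {R : realType}.
Local Notation state := ((R -> R[i]) * (R -> R[i]))%type.

Definition ns_domain : set state := [set U | Hsob 1 U.1 /\ Hsob 2 U.2].

Definition ns_operator (gamma vp : R) (vhat : R -> R) (U : state) : state :=
  let v := U.1 in
  let u := U.2 in
  let pressure x :=
    (shock_h gamma vp (vhat x) / vhat x `^ (gamma + 1))%:C * v x in
  let viscosity x := wderiv u x / (vhat x)%:C in
  (fun x => wderiv u x - wderiv v x,
   fun x => - wderiv u x + wderiv pressure x + wderiv viscosity x).

End LinearizedNavierStokes.

(* Main.v *)
(* Put [c = vhat], [H = h c / c ^ (gamma + 1)] and [w = u' / c + H v - u]. For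
   data [(f, g)] the resolvent equation becomes the first-order system
     [w' = lambda u - g],  [u' = c (w + u - H v)],  [v' = u' - lambda v + f].
   Along the profile, [c] decreases and takes its values in [[vp, 1]], whence
   [q = (1 / c)' >= 0] and [(H - q)' >= 0].

   Uniqueness: for a solution in L^2 with [f = g = 0], set [S = (u - v) / lambda]
   and [Y = w / lambda], so that [S' = v]. Some quadratic form [E] in [Y, S, S']
   has derivative
     [E' = - (2 lambda + (H' - q' + lambda q) / 2) S ^ 2 - S' ^ 2 / c <= 0].
   As [E] is monotone and integrable it vanishes, hence so does the solution.

   Existence, with a bound in L^2, is obtained by duality: a similar energy
   identity bounds compactly supported C^1 triples by their image under the
   adjoint system, and the Riesz representation theorem applies. As [lambda] is
   real, the real and imaginary parts of the equations decouple. *)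

Require Import Defs.
From mathcomp Require Import all_boot all_order all_algebra.
From mathcomp Require Import complex ring lra.
From mathcomp Require Import all_classical all_reals all_analysis.
From mathcomp Require Import measurable_realfun.

Set Implicit Arguments.
Unset Strict Implicit.
Unset Printing Implicit Defensive.

Import Order.TTheory GRing.Theory Num.Theory.
Import numFieldNormedType.Exports.
Local Open Scope classical_set_scope.
Local Open Scope ring_scope.
Local Open Scope complex_scope.

(** * Smooth functions on the line *)

Section PointwiseDerivatives.
Context {R : realType}.
Implicit Types (f g : R -> R) (x df dg : R).

(** The sign of [(H - q)'] has a structural origin: linearizing the viscous term about the profile
    contributes [(1 / c)' = q] to [H], and the rest, [H - q = a gamma c ^ (- gamma - 1)], is minus
    the derivative of the pressure, a decreasing function of the decreasing [c]. In [E] the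
    indefinite products are cancelled exactly by a choice of weights instead of being estimated, so
    no restriction on the shock strength arises.

    Both equations are in divergence form; this is why primitives of [u] and [v] are available
    algebraically, in L^2. For an adjoint triple [(al, be, ka)] the combination [s = c (be + ka)]
    takes the part of [S], with the same positive coefficients in the energy.

    Point and essential spectrum are not separated: the adjoint estimate gives a solution and its
    bound at once, and uniqueness transfers the bound to the whole domain.

    Weak derivatives are tested against smooth functions, whereas the coefficients are only recorded
    as C^1; the calculus below therefore extends testing to C^1 functions before it multiplies by
    coefficients. *)

Lemma is_derive1_ext f x df dg :
  is_derive x (1 : R) f df -> df = dg -> is_derive x (1 : R) f dg.
Proof. by move=> h <-. Qed.

Lemma is_derive1_cst x (a : R) : is_derive x (1 : R) (fun=> a) 0.
Proof. exact: is_derive_cst. Qed.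

Lemma is_derive1_id x : is_derive x (1 : R) (fun t : R => t) 1.
Proof. exact: is_derive_id. Qed.

Lemma is_derive1D f g x df dg :
  is_derive x (1 : R) f df -> is_derive x (1 : R) g dg ->
  is_derive x (1 : R) (fun t : R => f t + g t) (df + dg).
Proof. by move=> h1 h2; exact: is_deriveD. Qed.

Lemma is_derive1B f g x df dg :
  is_derive x (1 : R) f df -> is_derive x (1 : R) g dg ->
  is_derive x (1 : R) (fun t : R => f t - g t) (df - dg).
Proof. by move=> h1 h2; exact: is_deriveB. Qed.

Lemma is_derive1N f x df :
  is_derive x (1 : R) f df -> is_derive x (1 : R) (fun t : R => - f t) (- df).
Proof. by move=> h; exact: is_deriveN. Qed.

Lemma is_derive1M f g x df dg :
  is_derive x (1 : R) f df -> is_derive x (1 : R) g dg ->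
  is_derive x (1 : R) (fun t : R => f t * g t) (f x * dg + g x * df).
Proof. by move=> h1 h2; exact: is_deriveM. Qed.

Lemma is_derive1Z f x df (a : R) :
  is_derive x (1 : R) f df -> is_derive x (1 : R) (fun t : R => a * f t) (a * df).
Proof. by move=> h; exact: is_deriveZ. Qed.

Lemma is_derive1X f x df n :
  is_derive x (1 : R) f df ->
  is_derive x (1 : R) (fun t : R => f t ^+ n) (n%:R * f x ^+ n.-1 * df).
Proof.
move=> h; elim: n => [|n IH].
  by rewrite !mul0r; exact: is_derive1_cst.
have -> : (fun t : R => f t ^+ n.+1) = (fun t : R => f t * f t ^+ n).
  by apply/funext => t; rewrite exprS.
apply: is_derive1_ext (is_derive1M h IH) _.
case: n {IH} => [|n]; first by rewrite !mul0r mulr0 add0r !expr0 !mul1r.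
by rewrite /= !exprS -!natr1; ring.
Qed.

Lemma is_derive1V f x df :
  is_derive x (1 : R) f df -> f x != 0 ->
  is_derive x (1 : R) (fun t : R => (f t)^-1) (- df / f x ^+ 2).
Proof.
move=> h fx0; apply: is_derive1_ext (is_deriveV fx0 h) _.
by rewrite /GRing.scale /= mulrC mulNr mulrN.
Qed.

Lemma is_derive1_compf f g x df dg :
  is_derive x (1 : R) f df -> is_derive (f x) (1 : R) g dg ->
  is_derive x (1 : R) (fun t : R => g (f t)) (dg * df).
Proof. by move=> h1 h2; exact: is_derive1_comp. Qed.

Lemma is_derive1_affine (p q x : R) :
  is_derive x (1 : R) (fun t : R => p + q * t) q.
Proof.
apply: is_derive1_ext (is_derive1D (is_derive1_cst x p)
  (is_derive1Z q (is_derive1_id x))) _.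
by rewrite add0r mulr1.
Qed.

Lemma is_derive_derive1 f x :
  derivable f x 1 -> is_derive x (1 : R) f (derive1 f x).
Proof. by move=> fx; rewrite derive1E; apply/derivableP. Qed.

Lemma is_derive_fun f (h : R -> R) :
  (forall x : R, is_derive x (1 : R) f (h x)) -> derive1 f = h.
Proof. by move=> fdf; apply/funext => x; rewrite derive1E derive_val. Qed.

End PointwiseDerivatives.

Section Smooth.
Context {R : realType}.
Implicit Types (f g : R -> R) (n k : nat).

Definition smooth f := forall n (x : R), derivable (derive1n n f) x 1.

(** Finite-order version of [smooth], which allows closure under products to be proved by induction
    on [n]. Continuity of the derivative of order [n] is not demanded. *)
Definition Ck n f :=
  forall k, (k < n)%N -> forall x : R, derivable (derive1n k f) x 1.

Lemma CkSE n f :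
  Ck n.+1 f <-> (forall x : R, derivable f x 1) /\ Ck n (derive1 f).
Proof.
split=> [cf|[df cf] [|k] kn x].
- split=> [x|k kn x]; first exact: (cf 0%N).
  by rewrite -derive1Sn; apply: cf.
- by rewrite derive1n0.
- by rewrite derive1Sn; apply: cf.
Qed.

Lemma smoothE f : smooth f <-> forall n, Ck n f.
Proof. by split=> [sf n k _ x|cf n]; [apply: sf|apply: (cf n.+1)]. Qed.

Lemma Ck_leq n k f : (k <= n)%N -> Ck n f -> Ck k f.
Proof. by move=> kn cf j jk; apply: cf; apply: leq_trans kn. Qed.

Lemma Ck_cst n (a : R) : Ck n (cst a).
Proof.
elim: n a => [//|n IH] a; apply/CkSE; split=> [x|]; first exact: derivable_cst.
by rewrite (is_derive_fun (h := cst 0)).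
Qed.

Lemma CkD n f g : Ck n f -> Ck n g -> Ck n (f + g).
Proof.
elim: n f g => [|n IH] f g; first by move=> _ _ [].
move=> /CkSE[df cf] /CkSE[dg cg]; apply/CkSE; split.
  by move=> x; apply: derivableD.
rewrite (_ : derive1 (f + g) = derive1 f + derive1 g); first exact: IH.
apply: is_derive_fun => x.
by apply: is_derive1D; apply: is_derive_derive1.
Qed.

Lemma CkM n f g : Ck n f -> Ck n g -> Ck n (f * g).
Proof.
elim: n f g => [|n IH] f g; first by move=> _ _ [].
move=> /[dup] cf' /CkSE[df cf] /[dup] cg' /CkSE[dg cg].
apply/CkSE; split; first by move=> x; apply: derivableM.
rewrite (_ : derive1 (f * g) = f * derive1 g + g * derive1 f).
  apply: CkD; apply: IH.
  - exact: Ck_leq (leqnSn n) cf'.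
  - exact: cg.
  - exact: Ck_leq (leqnSn n) cg'.
  - exact: cf.
apply: is_derive_fun => x.
by apply: is_derive1M; apply: is_derive_derive1.
Qed.

Lemma Ck_comp_affine n f (p q : R) : Ck n f -> Ck n (fun t : R => f (p + q * t)).
Proof.
elim: n f => [|n IH] f; first by move=> _ [].
move=> /CkSE[df cf].
have dfa x : is_derive x (1 : R) (fun t : R => f (p + q * t))
    (q * derive1 f (p + q * x)).
  rewrite mulrC; apply: is_derive1_compf (is_derive1_affine p q x) _.
  exact: is_derive_derive1.
apply/CkSE; split; first by move=> x; have [] := dfa x.
rewrite (is_derive_fun dfa).
by apply: (CkM (f := cst q)); [apply: Ck_cst|apply: IH].
Qed.

Lemma smoothD f g : smooth f -> smooth g -> smooth (f + g).
Proof. by rewrite !smoothE => cf cg n; apply: CkD. Qed.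

Lemma smoothM f g : smooth f -> smooth g -> smooth (f * g).
Proof. by rewrite !smoothE => cf cg n; apply: CkM. Qed.

Lemma smooth_cst (a : R) : smooth (cst a).
Proof. by rewrite smoothE => n; apply: Ck_cst. Qed.

Lemma smooth_comp_affine f (p q : R) :
  smooth f -> smooth (fun t : R => f (p + q * t)).
Proof. by rewrite !smoothE => cf n; apply: Ck_comp_affine. Qed.

Lemma smooth_primitive f df :
  (forall x : R, is_derive x (1 : R) f (df x)) -> smooth df -> smooth f.
Proof.
move=> fdf; rewrite !smoothE => cdf [//|n]; apply/CkSE.
split; first by move=> x; have [] := fdf x.
by rewrite (is_derive_fun fdf).
Qed.

Lemma derivable_continuous f :
  (forall x : R, derivable f x 1) -> continuous f.
Proof.
by move=> df x; apply/differentiable_continuous; apply/derivable1_diffP.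
Qed.

Lemma smooth_continuous f : smooth f -> continuous f.
Proof. by move=> sf; apply: derivable_continuous; apply: (sf 0%N). Qed.

(* [x ^- k * exp (- 1 / x)] for [x > 0], extended by [0]: these functions are
   closed under differentiation up to linear combinations. *)
Definition flat_exp k (x : R) : R :=
  if 0 < x then x^-1 ^+ k * expR (- x^-1) else 0.

(** For [n > 0], raise [y / n <= expR (y / n)] to the power [n]. *)
Lemma exprn_le_expR n (y : R) : 0 <= y -> y ^+ n <= n%:R ^+ n * expR y.
Proof.
case: n => [|n] y0; first by rewrite !expr0 mul1r -expR0 ler_expR.
have n0 : 0 < n.+1%:R :> R by rewrite ltr0n.
have -> : expR y = expR (y / n.+1%:R) ^+ n.+1.
  by rewrite -expRM_natl mulrC mulfVK ?gt_eqF.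
rewrite -exprMn lerXn2r ?nnegrE ?mulr_ge0 ?expR_ge0//.
rewrite mulrC -ler_pdivrMr//; apply: le_trans (expR_ge1Dx _).
by rewrite lerDr.
Qed.

(** This is the previous bound at [y = 1 / x] with exponent [k + 2]. The two spare powers leave
    [x ^ 2], so that the difference quotient of [flat_exp k] at [0] tends to [0]. *)
Lemma flat_exp_le k (x : R) : 0 <= x -> flat_exp k x <= k.+2%:R ^+ k.+2 * x ^+ 2.
Proof.
rewrite /flat_exp le_eqVlt => /predU1P[<-|x0].
  by rewrite ltxx mulr_ge0.
rewrite x0 expRN -ler_pdivlMr ?invr_gt0 ?expR_gt0// invrK mulrAC -ler_pdivrMr ?exprn_gt0//.
by rewrite -exprVn -exprD addn2 exprn_le_expR ?invr_ge0 ?ltW.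
Qed.

Lemma flat_exp_ge0 k (x : R) : 0 <= flat_exp k x.
Proof.
by rewrite /flat_exp; case: ifPn => // x0; rewrite mulr_ge0 ?expR_ge0// exprn_ge0 ?invr_ge0 ?ltW.
Qed.

Lemma is_derive_flat_exp k (x : R) :
  is_derive x (1 : R) (flat_exp k)
    (- k%:R * flat_exp k.+1 x + flat_exp k.+2 x).
Proof.
have [x0|x0|<-] := ltgtP 0 x.
- pose g t : R := t^-1 ^+ k * expR (- t^-1).
  apply: (@near_eq_is_derive _ _ _ g) => //.
    near=> y; rewrite /flat_exp ifT//; near: y; exact: lt_nbhsr.
  have xN0 : x != 0 by rewrite gt_eqF.
  have dV : is_derive x (1 : R) (fun t : R => t^-1) (- 1 / x ^+ 2).
    exact: is_derive1V (is_derive1_id x) xN0.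
  have dE := is_derive1_compf (is_derive1N dV) (is_derive_expR _).
  apply: is_derive1_ext (is_derive1M (is_derive1X k dV) dE) _.
  rewrite /flat_exp x0; case: (k) => [|j].
    by rewrite !expr0 !mul0r mulr0 addr0 -exprVn; ring.
  by rewrite -exprVn !exprS /= -mulr_natl; ring.
- apply: (@near_eq_is_derive _ _ _ (cst 0)) => //.
    near=> y; rewrite /flat_exp ltNge ltW//.
    near: y; exact: lt_nbhsl.
  by rewrite /flat_exp ltNge ltW//= mulr0 addr0; exact: is_derive_cst.
- rewrite /flat_exp ltxx mulr0 addr0.
  suff h : (fun h : R => h^-1 *: ((flat_exp k \o shift 0) (h *: (1 : R)) - flat_exp k 0))
      @ 0^' --> (0 : R).
    by split; [apply/cvg_ex; exists 0|apply/cvg_lim].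
  set C : R := k.+2%:R ^+ k.+2.
  have C0 : 0 < C by rewrite exprn_gt0.
  apply/cvgr0Pnorm_le => e e0; near=> h.
  rewrite /= /GRing.scale /= mulr1 addr0 {2}/flat_exp ltxx subr0.
  have hN0 : h != 0 by near: h; exact: nbhs_dnbhs_neq.
  have [h0|h0] := ltP 0 h; last first.
    by rewrite /flat_exp ltNge h0 mulr0 normr0 ltW.
  rewrite ger0_norm ?mulr_ge0 ?invr_ge0 ?flat_exp_ge0 ?ltW//.
  rewrite mulrC ltr_pdivrMr//; apply: le_lt_trans (flat_exp_le _ (ltW h0)) _.
  rewrite -/C expr2 mulrA ltr_pM2r// -ltr_pdivlMl// mulrC.
  rewrite (le_lt_trans (ler_norm _))//; near: h.
  by apply: dnbhs0_lt; rewrite divr_gt0.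
Unshelve. all: by end_near. Qed.

Lemma smooth_flat_exp k : smooth (flat_exp k).
Proof.
rewrite smoothE => n; elim: n k => [//|n IH] k.
apply/CkSE; split; first by move=> x; have [] := is_derive_flat_exp k x.
rewrite (is_derive_fun (is_derive_flat_exp k)).
by apply: (CkD (f := cst _ * flat_exp k.+1)) => //; apply: CkM => //; apply: Ck_cst.
Qed.

End Smooth.

(** * Integration on the line *)

Section LineIntegral.
Context {R : realType}.
Local Notation mu := (@lebesgue_measure R).
Local Notation Int f := (mu.-integrable [set: R] (EFin \o f)).
Implicit Types (f g : R -> R) (a b : R).

Lemma ae_mono (P Q : R -> Prop) : {ae mu, forall x, P x} ->
  (forall x, P x -> Q x) -> {ae mu, forall x, Q x}.
Proof.
by move=> aP PQ; apply: filterS aP => //; exact: (ae_filter_ringOfSetsType mu).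
Qed.

Lemma ae_and (P Q : R -> Prop) : {ae mu, forall x, P x} ->
  {ae mu, forall x, Q x} -> {ae mu, forall x, P x /\ Q x}.
Proof.
move=> aP aQ; have F := ae_filter_ringOfSetsType mu.
exact: (@filterI _ _ F _ _ aP aQ).
Qed.

Lemma Int_measurable f : Int f -> measurable_fun [set: R] f.
Proof. by move=> /measurable_int /measurable_EFinP. Qed.

Lemma IntD f g : Int f -> Int g -> Int (fun x => f x + g x).
Proof. by move=> fi gi; apply: eq_integrable (integrableD _ fi gi). Qed.

Lemma IntB f g : Int f -> Int g -> Int (fun x => f x - g x).
Proof. by move=> fi gi; apply: eq_integrable (integrableB _ fi gi). Qed.

Lemma IntZ (k : R) f : Int f -> Int (fun x => k * f x).
Proof. by move=> fi; apply: eq_integrable (integrableZl _ k fi). Qed.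

Lemma Int_norm f : Int f -> Int (fun x => `|f x|).
Proof. by move=> fi; apply: eq_integrable (integrable_abse fi). Qed.

Lemma Int_le f g : measurable_fun [set: R] f -> (forall x, `|f x| <= g x) ->
  Int g -> Int f.
Proof.
move=> mf fg; apply: le_integrable => //; first exact/measurable_EFinP.
by move=> x _ /=; rewrite lee_fin (le_trans (fg x))// ler_norm.
Qed.

Lemma Int_restrict (D : set R) f : measurable D -> (forall x, ~ D x -> f x = 0) ->
  mu.-integrable D (EFin \o f) -> Int f.
Proof.
move=> mD fD; rewrite integrable_mkcond//; apply: eq_integrable => // x _ /=.
by rewrite patchE; case: ifPn => //; rewrite notin_setE => /fD ->.
Qed.

Lemma Rintegral_restrict (D : set R) f :
  (forall x, ~ D x -> f x = 0) -> \int[mu]_x f x = \int[mu]_(x in D) f x.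
Proof.
move=> fD; rewrite [RHS]Rintegral_mkcond; apply: eq_Rintegral => x _.
by rewrite patchE; case: ifPn => //; rewrite notin_setE => /fD ->.
Qed.

Lemma outside_itv a b x : ~ [set` `[a, b]] x -> x < a \/ b < x.
Proof.
rewrite /= in_itv/= => /negP; rewrite negb_and -!ltNge => /orP[]; by [left|right].
Qed.

Lemma Int_continuous_csupp a b f : continuous f ->
  (forall x, x < a \/ b < x -> f x = 0) -> Int f.
Proof.
move=> cf f0; apply: (@Int_restrict [set` `[a, b]]) => //.
  by move=> x /outside_itv/f0.
apply: continuous_compact_integrable; first exact: segment_compact.
exact: continuous_subspaceT.
Qed.

Lemma continuous_bounded_itv a b f : continuous f ->
  exists2 C : R, 0 < C & forall x, a <= x <= b -> `|f x| <= C.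
Proof.
move=> cf; have cK : compact (f @` `[a, b]).
  apply: continuous_compact; last exact: segment_compact.
  exact: continuous_subspaceT.
have [C [_ hC]] := compact_bounded cK.
exists (`|C| + 1); first by rewrite ltr_wpDl.
move=> x xab; apply: hC; first by rewrite (le_lt_trans (ler_norm _))// ltrDl.
by exists x => //=; rewrite in_itv.
Qed.

Lemma continuous_bounded_csupp a b f : continuous f ->
  (forall x, x < a \/ b < x -> f x = 0) ->
  exists2 C : R, 0 < C & forall x, `|f x| <= C.
Proof.
move=> cf f0; have [C C0 fC] := continuous_bounded_itv a b cf.
exists C => // x; have [xa|xa] := ltP x a.
  by rewrite f0 ?normr0 ?ltW//; left.
have [xb|xb] := ltP b x; first by rewrite f0 ?normr0 ?ltW//; right.
by rewrite fC// xa.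
Qed.

Lemma is_derive_continuous f df :
  (forall x : R, is_derive x (1 : R) f (df x)) -> continuous f.
Proof. by move=> fdf; apply: derivable_continuous => x; have [] := fdf x. Qed.

Lemma Rintegral_FTC2 f df a b : a <= b ->
  (forall x : R, is_derive x (1 : R) f (df x)) -> continuous df ->
  \int[mu]_(x in [set` `[a, b]]) df x = f b - f a.
Proof.
rewrite le_eqVlt => /predU1P[<-|ab] fdf cdf.
  by rewrite set_itv1 Rintegral_set1 subrr.
have cf := is_derive_continuous fdf.
rewrite /Rintegral (continuous_FTC2 (F := f))//.
- exact: continuous_subspaceT.
- split=> [x _||]; first by have [] := fdf x.
    exact/cvg_at_right_filter/cf.
  exact/cvg_at_left_filter/cf.
- by move=> x _; rewrite (is_derive_fun fdf).
Qed.

Lemma Rintegral_derivative_csupp f df a b : a <= b ->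
  (forall x : R, is_derive x (1 : R) f (df x)) -> continuous df ->
  (forall x, x <= a \/ b <= x -> f x = 0) ->
  (forall x, x < a \/ b < x -> df x = 0) ->
  \int[mu]_x df x = 0.
Proof.
move=> ab fdf cdf f0 df0.
rewrite (@Rintegral_restrict [set` `[a, b]]) => [|x /outside_itv/df0//].
by rewrite (Rintegral_FTC2 ab fdf cdf) !f0 ?subrr//; [left|right].
Qed.

Lemma locally_integrable_itv f a b : locally_integrable [set: R] f ->
  mu.-integrable [set` `[a, b]] (EFin \o f).
Proof.
move=> [mf _ lf]; apply/integrableP; split.
  by apply/measurable_EFinP; exact: measurable_funS mf.
by apply: lf => //; exact: segment_compact.
Qed.

Lemma Int_locally_integrable f : Int f -> locally_integrable [set: R] f.
Proof. by apply: open_integrable_locally; exact: openT. Qed.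

Lemma Int_locM f g a b (C : R) : locally_integrable [set: R] f ->
  measurable_fun [set: R] g -> (forall x, `|g x| <= C) ->
  (forall x, x < a \/ b < x -> g x = 0) -> Int (fun x => f x * g x).
Proof.
move=> lf mg gC g0; apply: (@Int_restrict [set` `[a, b]]) => //.
  by move=> x /outside_itv/g0 ->; rewrite mulr0.
have fi := locally_integrable_itv a b lf.
apply: le_integrable (integrableZl _ C fi) => //.
  apply/measurable_EFinP; apply: measurable_funM; last exact: measurable_funS mg.
  by case: lf => mf _ _; exact: measurable_funS mf.
move=> x _ /=; rewrite lee_fin !normrM mulrC ler_wpM2r//.
by rewrite (le_trans (gC x))// ler_norm.
Qed.

Lemma locally_integrable_le f g : measurable_fun [set: R] f ->
  (forall x, `|f x| <= g x) -> locally_integrable [set: R] g ->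
  locally_integrable [set: R] f.
Proof.
move=> mf fg [mg oT lg]; split=> // K KT cK; apply: le_lt_trans (lg K KT cK).
have mK := compact_measurable cK.
apply: ge0_le_integral => //.
- by apply/measurable_EFinP/measurableT_comp => //; exact: measurable_funS mf.
- by apply/measurable_EFinP/measurableT_comp => //; exact: measurable_funS mg.
- by move=> x _; rewrite lee_fin (le_trans (fg x))// ler_norm.
Qed.

Lemma continuous_locally_integrable f : continuous f ->
  locally_integrable [set: R] f.
Proof.
move=> cf; split; [exact: continuous_measurable_fun|exact: openT|].
move=> K _ cK.
have /integrableP[] : mu.-integrable K (EFin \o f).
  by apply: continuous_compact_integrable => //; exact: continuous_subspaceT.
by [].
Qed.

Lemma locally_integrableM f g : locally_integrable [set: R] f ->
  continuous g -> locally_integrable [set: R] (fun x => g x * f x).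
Proof.
move=> lf cg; have mf : measurable_fun [set: R] f by case: lf.
have mg := continuous_measurable_fun cg.
split; [exact: measurable_funM|exact: openT|move=> K KT cK].
have : compact (g @` K) by apply: continuous_compact => //; exact: continuous_subspaceT.
move=> /compact_bounded[C0 [_ hC]].
pose C := `|C0| + 1; have gC x : K x -> `|g x| <= C.
  by move=> Kx; apply: hC; [rewrite (le_lt_trans (ler_norm _))// ltrDl|exists x].
have mK := compact_measurable cK.
have /integrableP[_] : mu.-integrable K (EFin \o (fun x => g x * f x)).
  have fi : mu.-integrable K (EFin \o f).
    apply/integrableP; split; last by case: lf => _ _; apply.
    by apply/measurable_EFinP; exact: measurable_funS mf.
  apply: le_integrable (integrableZl _ C fi) => //.
    by apply/measurable_EFinP; apply: measurable_funM;
       [exact: measurable_funS mg|exact: measurable_funS mf].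
  move=> x Kx /=; rewrite lee_fin !normrM ler_wpM2r//.
  by rewrite (le_trans (gC x Kx))// ler_norm.
by [].
Qed.

Lemma Rintegral_ae_eq f g : measurable_fun [set: R] f ->
  measurable_fun [set: R] g -> {ae mu, forall x, f x = g x} ->
  \int[mu]_x f x = \int[mu]_x g x.
Proof.
move=> mf mg fg; rewrite /Rintegral; congr fine; apply: ae_eq_integral => //.
- exact/measurable_EFinP.
- exact/measurable_EFinP.
- by apply: ae_mono fg _ => x fgx _; rewrite fgx.
Qed.

Lemma Int_ae_eq f g : measurable_fun [set: R] g ->
  {ae mu, forall x, f x = g x} -> Int f -> Int g.
Proof.
move=> mg fg fi; have mf := Int_measurable fi.
apply/integrableP; split; first exact/measurable_EFinP.
move/integrableP: fi => [_]; apply: le_lt_trans.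
rewrite le_eqVlt; apply/orP; left; apply/eqP; apply: ae_eq_integral => //.
- by apply/measurable_EFinP/measurableT_comp.
- by apply/measurable_EFinP/measurableT_comp.
- by apply: ae_mono fg _ => x fgx _; rewrite /= fgx.
Qed.

Lemma Rintegral_dominated (f_ : nat -> R -> R) f g :
  (forall n, measurable_fun [set: R] (f_ n)) -> measurable_fun [set: R] f ->
  {ae mu, forall x, f_ n x @[n --> \oo] --> f x} -> Int g ->
  (forall n x, `|f_ n x| <= g x) ->
  \int[mu]_x f_ n x @[n --> \oo] --> \int[mu]_x f x.
Proof.
move=> mf_ mf ff ig fg.
have [fi _ cv] := @dominated_convergence _ _ _ mu [set: R] measurableT
  (fun n => EFin \o f_ n) (EFin \o f) (EFin \o g)
  (fun n => (measurable_EFinP _ _).2 (mf_ n)) ((measurable_EFinP _ _).2 mf)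
  ltac:(by apply: ae_mono ff _ => x fx _; apply/fine_cvgP; split; [apply: nearW|])
  ig ltac:(by apply: aeW => x n _ /=; rewrite lee_fin).
apply: fine_cvg; rewrite fineK//.
exact: integrable_fin_num.
Qed.

End LineIntegral.

(** * Mollifiers and the fundamental lemma *)

Section Bumps.
Context {R : realType}.
Local Notation mu := (@lebesgue_measure R).
Local Notation Int f := (mu.-integrable [set: R] (EFin \o f)).
Implicit Types (f phi : R -> R) (a b h x : R).

(** One factor vanishes from [a + h] on, the other up to [a - h]. The arguments are written as
    affine maps [p + q * x], the form expected by [smooth_comp_affine]. *)
Definition bump a h x : R :=
  flat_exp 0 ((1 + a / h) + (- h^-1) * x) * flat_exp 0 ((1 - a / h) + h^-1 * x).

Lemma bumpE a h x : h != 0 ->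
  bump a h x = flat_exp 0 (1 - (x - a) / h) * flat_exp 0 (1 + (x - a) / h).
Proof. by move=> h0; congr (flat_exp 0 _ * flat_exp 0 _); field. Qed.

Lemma smooth_bump a h : smooth (bump a h).
Proof.
by apply: smoothM; apply: smooth_comp_affine; exact: smooth_flat_exp.
Qed.

Lemma flat_exp0_le1 x : flat_exp 0 x <= 1.
Proof.
rewrite /flat_exp; case: ifPn => // x0.
by rewrite expr0 mul1r -expR0 ler_expR oppr_le0 invr_ge0 ltW.
Qed.

Lemma bump_ge0 a h x : 0 <= bump a h x.
Proof. by rewrite mulr_ge0// flat_exp_ge0. Qed.

Lemma bump_le1 a h x : bump a h x <= 1.
Proof. by rewrite mulr_ile1 ?flat_exp_ge0 ?flat_exp0_le1. Qed.

Lemma bump_out a h x : 0 < h -> h <= `|x - a| -> bump a h x = 0.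
Proof.
move=> h0 hx; rewrite bumpE ?gt_eqF// /flat_exp.
have [xa|xa] := leP 0 (x - a).
  rewrite ifF ?mul0r//; apply/negbTE; rewrite -leNgt subr_le0.
  by rewrite ler_pdivlMr// mul1r -(ger0_norm xa).
rewrite [X in _ * X]ifF ?mulr0//; apply/negbTE; rewrite -leNgt.
rewrite -lerBrDl sub0r ler_pdivrMr// mulN1r lerNr.
by rewrite -(ltr0_norm xa).
Qed.

(** Both arguments of [flat_exp 0] are at least [1 / 2] there, and each factor is then at least
    [expR (- 2)]. *)
Lemma bump_ge a h x : 0 < h -> `|x - a| <= h / 2 ->
  expR (- 4) <= bump a h x.
Proof.
move=> h0 hx; rewrite bumpE ?gt_eqF//.
have : `|(x - a) / h| <= 1 / 2.
  by rewrite normrM normfV (gtr0_norm h0) ler_pdivrMr// mul1r mulrC.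
move: (_ / h) => t; rewrite ler_norml => /andP[t1 t2].
have flat_ge y : 1 / 2 <= y -> expR (- 2) <= flat_exp 0 y.
  move=> hy; have y0 : 0 < y by lra.
  rewrite /flat_exp y0 expr0 mul1r ler_expR lerN2 invf_ple ?posrE//; lra.
rewrite (_ : - 4 = - 2 - 2 :> R); last by lra.
by rewrite expRD ler_pM ?expR_ge0// flat_ge//; lra.
Qed.

Lemma bump_measurable a h : measurable_fun [set: R] (bump a h).
Proof.
by apply: continuous_measurable_fun; apply: smooth_continuous; exact: smooth_bump.
Qed.

Lemma bump_out_itv a h x : 0 < h -> x < a - h \/ a + h < x -> bump a h x = 0.
Proof.
move=> h0 xah; apply: bump_out => //.
by case: xah => hx; [rewrite ler_normr orbC|rewrite ler_normr]; apply/orP; left; lra.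
Qed.

Lemma bump_Int a h : 0 < h -> Int (bump a h).
Proof.
move=> h0; apply: (@Int_continuous_csupp _ (a - h) (a + h)).
  by apply: smooth_continuous; exact: smooth_bump.
by move=> x; exact: bump_out_itv.
Qed.

Lemma bump_mass a h : 0 < h -> expR (- 4) * h <= \int[mu]_x bump a h x.
Proof.
move=> h0; pose D := [set` `[a - h / 2, a + h / 2]] : set R.
have mD : measurable (D : set (measurableTypeR R)) by exact: measurable_itv.
have iD : mu.-integrable D (EFin \o bump a h) by apply: integrableS (bump_Int a h0).
have -> : expR (- 4) * h = \int[mu]_(x in D) expR (- 4).
  rewrite Rintegral_cst; last exact: measurable_itv.
  rewrite /D /= lebesgue_measure_itv/= lte_fin ifT; last by lra.
  by rewrite /=; congr (_ * _); lra.
rewrite [leRHS](_ : _ = \int[mu]_(x in [set: R]) bump a h x)//.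
apply: (@le_trans _ _ (\int[mu]_(x in D) bump a h x)).
  apply: le_Rintegral => //.
  - apply: continuous_compact_integrable; first exact: segment_compact.
    by move=> x; exact: cvg_cst.
  - move=> x; rewrite /D /= in_itv/= => /andP[x1 x2]; apply: bump_ge => //.
    by rewrite ler_norml; apply/andP; split; lra.
rewrite /Rintegral fine_le//.
- by apply: integrable_fin_num.
- by apply: integrable_fin_num => //; exact: bump_Int.
- apply: ge0_subset_integral => //; first by apply/measurable_EFinP; exact: bump_measurable.
  by move=> x _; rewrite lee_fin bump_ge0.
Qed.

Definition mollifier a h x : R := (\int[mu]_y bump a h y)^-1 * bump a h x.

Lemma bump_mass_gt0 a h : 0 < h -> 0 < \int[mu]_x bump a h x.
Proof. by move=> h0; apply: lt_le_trans (bump_mass a h0); rewrite mulr_gt0 ?expR_gt0. Qed.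

Lemma smooth_mollifier a h : smooth (mollifier a h).
Proof. by apply: (smoothM (f := cst _)); [exact: smooth_cst|exact: smooth_bump]. Qed.

Lemma mollifier_ge0 a h x : 0 < h -> 0 <= mollifier a h x.
Proof. by move=> h0; rewrite mulr_ge0 ?bump_ge0// invr_ge0 ltW// bump_mass_gt0. Qed.

(** Height of order [1 / h] on a support of length [2 h]: the mollified error at [a] is then bounded
    by a fixed multiple of the mean oscillation of [f] over the ball. *)
Lemma mollifier_le a h x : 0 < h -> mollifier a h x <= expR 4 / h.
Proof.
move=> h0; rewrite -[leRHS]mulr1 ler_pM ?bump_ge0 ?bump_le1 ?invr_ge0 ?(ltW (bump_mass_gt0 _ h0))//.
rewrite -[expR 4]invrK -expRN -invfM lef_pV2 ?bump_mass// posrE ?bump_mass_gt0//.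
by rewrite mulr_gt0 ?expR_gt0.
Qed.

Lemma mollifier_out a h x : 0 < h -> h <= `|x - a| -> mollifier a h x = 0.
Proof. by move=> h0 hx; rewrite /mollifier bump_out ?mulr0. Qed.

Lemma mollifier_out_itv a h x : 0 < h -> x < a - h \/ a + h < x -> mollifier a h x = 0.
Proof. by move=> h0 hx; rewrite /mollifier bump_out_itv ?mulr0. Qed.

Lemma mollifier_Int a h : 0 < h -> Int (mollifier a h).
Proof. by move=> h0; apply: IntZ; exact: bump_Int. Qed.

Lemma mollifier_mass a h : 0 < h -> \int[mu]_x mollifier a h x = 1.
Proof.
move=> h0; rewrite RintegralZl//; last exact: bump_Int.
by rewrite mulVf// gt_eqF// bump_mass_gt0.
Qed.

Lemma test_functionP phi a b : smooth phi ->
  (forall x, x < a \/ b < x -> phi x = 0) -> test_function phi.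
Proof.
move=> sphi phi0; split => //.
apply: (@subclosed_compact _ _ [set` `[a, b]]); first exact: closed_closure.
  exact: segment_compact.
rewrite closureE; apply: smallest_sub => [|x /=].
  exact: interval_closed.
rewrite in_itv/= => phix; apply/andP; split; rewrite leNgt; apply: contra phix => hx.
  by rewrite phi0//; left.
by rewrite phi0//; right.
Qed.

Lemma test_function_csupp phi : test_function phi ->
  exists2 M : R, 0 < M & forall x, M < `|x| -> phi x = 0.
Proof.
move=> [_ /compact_bounded[M0 [_ hM]]].
exists (`|M0| + 1); first by rewrite ltr_wpDl.
move=> x Mx; apply/eqP; apply: contraTT Mx => phix; rewrite -leNgt.
apply: hM; first by rewrite (le_lt_trans (ler_norm _))// ltrDl.
exact: subset_closure.
Qed.

Lemma test_function_smooth phi : test_function phi -> smooth phi.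
Proof. by case. Qed.

Lemma test_mollifier a h : 0 < h -> test_function (mollifier a h).
Proof.
move=> h0; apply: (@test_functionP _ (a - h) (a + h)); first exact: smooth_mollifier.
by move=> x; exact: mollifier_out_itv.
Qed.

Lemma Int_loc_mollifier f a h : 0 < h -> locally_integrable [set: R] f ->
  Int (fun x => f x * mollifier a h x).
Proof.
move=> h0 lf; apply: (@Int_locM _ f _ (a - h) (a + h) (expR 4 / h)) => //.
- by apply: continuous_measurable_fun; apply: smooth_continuous; exact: smooth_mollifier.
- by move=> x; rewrite ger0_norm ?mollifier_le ?mollifier_ge0.
- by move=> x; exact: mollifier_out_itv.
Qed.

(** As the mollifier has mass one, the error is the integral of [f a - f x] against it, which is at
    most [2 expR 4] times the average of [|f x - f a|] over the ball of radius [h]; that average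
    tends to [0] at a Lebesgue point. *)
Lemma mollify_cvg f a : locally_integrable [set: R] f -> lebesgue_pt f a ->
  \int[mu]_x (f x * mollifier a h x) @[h --> 0^'+] --> f a.
Proof.
move=> lf fa; apply/cvgrPdist_le => e e0.
(* The factor [2 * expR 4] is the height [expR 4 / h] of the mollifier times the length [2 h] of the
   ball. *)
pose e' := e / (2 * expR 4); have e'0 : 0 < e' by rewrite divr_gt0// mulr_gt0 ?expR_gt0.
have /fine_cvgP[fin /cvgr0Pnorm_le/(_ _ e'0) near_e] := fa.
near=> h; have h0 : 0 < h by near: h; exact: nbhs_right_gt.
have cfi : Int (fun x => f a * mollifier a h x) by apply: IntZ; exact: mollifier_Int.
have -> : f a - \int[mu]_x (f x * mollifier a h x) =
    \int[mu]_x (f a * mollifier a h x - f x * mollifier a h x).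
  rewrite RintegralB//; last exact: Int_loc_mollifier.
  by rewrite RintegralZl ?mollifier_mass ?mulr1//; exact: mollifier_Int.
have dfi := IntB cfi (Int_loc_mollifier a h0 lf).
apply: le_trans (le_normr_Rintegral _ dfi) _ => //.
set B := ball a h : set R.
have mB : measurable B by exact: measurable_ball.
have lfc : mu.-integrable B (EFin \o (fun x => `|f x - f a|)).
  have : mu.-integrable [set` `[a - h, a + h]] (EFin \o f) by exact: locally_integrable_itv.
  have BI : B `<=` [set` `[a - h, a + h]].
    rewrite /B ball_itv => x /=; rewrite !in_itv/= => /andP[x1 x2].
    by rewrite !ltW.
  move=> fi; have fiB : mu.-integrable B (EFin \o f) by apply: integrableS fi.
  have ciB : mu.-integrable B (EFin \o cst (f a)).
    suff : mu.-integrable [set` `[a - h, a + h]] (EFin \o cst (f a)).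
      by apply: integrableS.
    apply: continuous_compact_integrable; first exact: segment_compact.
    by move=> x; exact: cvg_cst.
  have : mu.-integrable B ((EFin \o f) \- (EFin \o cst (f a)))%E.
    by apply: integrableB.
  move=> /integrable_abse; exact: eq_integrable.
rewrite (@Rintegral_restrict _ B); last first.
  move=> x /=; rewrite /B /ball/= => /negP; rewrite -leNgt distrC => hx.
  by rewrite mollifier_out// !mulr0 subrr normr0.
apply: (@le_trans _ _ (\int[mu]_(x in B) (expR 4 / h * `|f x - f a|))).
  apply: le_Rintegral => //.
  - by apply: integrableS (Int_norm dfi).
  - have : mu.-integrable B (fun x => (expR 4 / h)%:E * (`|f x - f a|)%:E)%E.
      by apply: integrableZl.
    exact: eq_integrable.
  - move=> x _; rewrite -mulrBl normrM mulrC distrC ler_wpM2r//.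
    by rewrite ger0_norm ?mollifier_le ?mollifier_ge0.
rewrite RintegralZl//.
have : `|fine (davg f a h)| <= e' by near: h.
have fh : davg f a h \is a fin_num by near: h.
have Ifin : (\int[mu]_(x in B) (`|f x - f a|)%:E)%E \is a fin_num.
  exact: integrable_fin_num.
rewrite ger0_norm ?fine_ge0 ?davg_ge0//.
rewrite /davg/= /iavg/= (lebesgue_measure_ball _ (ltW h0))// inver mulrn_eq0/= gt_eqF//.
rewrite -/B fineM//= => le_e'.
apply: (@le_trans _ _ (expR 4 / h * (h *+ 2 * e'))).
  rewrite ler_pM2l ?divr_gt0 ?expR_gt0// -ler_pdivrMl ?mulrn_wgt0//.
rewrite /e' -mulr_natl; rewrite le_eqVlt; apply/orP; left; apply/eqP; field.
by rewrite ?gt_eqF ?expR_gt0.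
Unshelve. all: by end_near. Qed.

(** At a Lebesgue point [a] the mollified values are all [0] and converge to [f a]. *)
Lemma fundamental_lemma f : locally_integrable [set: R] f ->
  (forall phi, test_function phi -> \int[mu]_x (f x * phi x) = 0) ->
  {ae mu, forall x, f x = 0}.
Proof.
move=> lf f0; apply: ae_mono (lebesgue_differentiation lf) _ => a fa.
have cv := mollify_cvg lf fa.
have cv0 : \int[mu]_x (f x * mollifier a h x) @[h --> 0^'+] --> (0 : R).
  apply: cvg_near_cst; near=> h; apply: f0; apply: test_mollifier.
  by near: h; exact: nbhs_right_gt.
exact: norm_cvg_unique cv cv0.
Unshelve. all: by end_near. Qed.

End Bumps.

(** * Primitives of locally integrable functions, and Fubini on a triangle *)

Section Primitive.
Context {R : realType}.
Local Notation mu := (@lebesgue_measure R).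
Local Notation Int f := (mu.-integrable [set: R] (EFin \o f)).
Implicit Types (f g k eta : R -> R) (a b x A B : R).

Definition primitive g a x : R :=
  if a <= x then \int[mu]_(y in [set` `[a, x]]) g y
  else - \int[mu]_(y in [set` `[x, a]]) g y.

Lemma Rintegral_itv_add g a b c : locally_integrable [set: R] g ->
  a <= b -> b <= c ->
  \int[mu]_(y in [set` `[a, c]]) g y =
  \int[mu]_(y in [set` `[a, b]]) g y + \int[mu]_(y in [set` `[b, c]]) g y.
Proof.
move=> lg ab bc.
have gi := locally_integrable_itv a c lg.
have gbc := locally_integrable_itv b c lg.
rewrite -(@Rintegral_itv_obnd_cbnd _ b (BRight c)); last first.
  apply: integrableS gbc => //.
  by move=> z /=; rewrite !in_itv/= => /andP[/ltW -> ->].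
rewrite -(@Rintegral_itvB _ g (BLeft a) (BRight c) b gi) ?bnd_simp//.
by rewrite subrKC.
Qed.

(** A base point to the left of both [a] and [x] replaces the definition by cases by a single
    formula, from which continuity and differentiability can be read off near [x]. *)
Lemma primitive_shift g a x A : locally_integrable [set: R] g ->
  A <= a -> A <= x -> primitive g a x =
  \int[mu]_(y in [set` `[A, x]]) g y - \int[mu]_(y in [set` `[A, a]]) g y.
Proof.
move=> lg Aa Ax; rewrite /primitive; case: ifPn => [ax|].
  by rewrite (Rintegral_itv_add lg Aa ax) [in RHS]addrC addKr.
rewrite -ltNge => /ltW xa.
by rewrite (Rintegral_itv_add lg Ax xa) opprD addrA subrr add0r.
Qed.

Lemma primitive_continuous g a : locally_integrable [set: R] g ->
  continuous (primitive g a).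
Proof.
move=> lg x; pose A := Num.min a x - 1; pose B := x + 1.
have ma : Num.min a x <= a by rewrite ge_min lexx.
have mx : Num.min a x <= x by rewrite ge_min lexx orbT.
have Aa : A <= a by rewrite /A; lra.
have Ax : A < x by rewrite /A; lra.
have AB : A <= B by rewrite /B; lra.
have gi := locally_integrable_itv A B lg.
have := parameterized_integral_continuous AB gi.
rewrite continuous_within_itvP; last by rewrite /B; lra.
move=> [+ _ _] => /(_ x).
rewrite in_itv/= Ax /B ltrDl ltr01 => /(_ isT) cx.
rewrite /continuous_at (primitive_shift lg Aa (ltW Ax)).
pose G y := \int[mu]_(z in [set` `[A, y]]) g z - \int[mu]_(z in [set` `[A, a]]) g z.
have GE : \forall y \near x, G y = primitive g a y.
  near=> y; rewrite (primitive_shift lg Aa)//.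
  by apply: ltW; near: y; exact: lt_nbhsr.
apply: cvg_trans (near_eq_cvg GE) _.
by apply: cvgB => //; exact: cvg_cst.
Unshelve. all: by end_near. Qed.

Lemma is_derive_primitive g a x : continuous g ->
  is_derive x (1 : R) (primitive g a) (g x).
Proof.
move=> cg; have lg := continuous_locally_integrable cg.
pose A := Num.min a x - 1.
have ma : Num.min a x <= a by rewrite ge_min lexx.
have mx : Num.min a x <= x by rewrite ge_min lexx orbT.
have Aa : A <= a by rewrite /A; lra.
have Ax : A < x by rewrite /A; lra.
have xx1 : x < x + 1 by rewrite ltrDl.
have [dx dE] := continuous_FTC1_closed xx1 (locally_integrable_itv A (x + 1) lg) Ax (cg x).
have d1 : is_derive x (1 : R) (fun y => \int[mu]_(z in [set` `[A, y]]) g z) (g x).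
  by rewrite -dE; exact: is_derive_derive1.
apply: near_eq_is_derive (is_derive1_ext (is_derive1B d1
   (is_derive1_cst x (\int[mu]_(z in [set` `[A, a]]) g z))) (subr0 _)).
near=> y; rewrite (primitive_shift lg Aa)//.
by apply: ltW; near: y; exact: lt_nbhsr.
Unshelve. all: by end_near. Qed.

Lemma Rintegral_itv_ae_eq f g a b : locally_integrable [set: R] f ->
  locally_integrable [set: R] g -> {ae mu, forall x, f x = g x} ->
  \int[mu]_(y in [set` `[a, b]]) f y = \int[mu]_(y in [set` `[a, b]]) g y.
Proof.
move=> [mf _ _] [mg _ _] fg; rewrite /Rintegral; congr fine.
apply: ae_eq_integral => //.
- by apply/measurable_EFinP; exact: measurable_funS mf.
- by apply/measurable_EFinP; exact: measurable_funS mg.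
- by apply: ae_mono fg _ => x -> _.
Qed.

Lemma primitive_ae_eq f g a x : locally_integrable [set: R] f ->
  locally_integrable [set: R] g -> {ae mu, forall x, f x = g x} ->
  primitive f a x = primitive g a x.
Proof.
by move=> lf lg fg; rewrite /primitive !(Rintegral_itv_ae_eq _ _ lf lg fg).
Qed.

Lemma patch_itvE (f : R -> \bar R) a b y :
  (f \_ [set` `[a, b]]) y = if a <= y <= b then f y else 0%E.
Proof.
rewrite patchE; congr (if _ then _ else _); apply/idP/idP => [/set_mem|yab].
  by rewrite /= in_itv.
by apply/mem_set; rewrite /= in_itv.
Qed.

(* Exchange the order of integration over [A <= y <= x <= B]. *)
Lemma Rintegral_primitiveM g eta k A B : A <= B ->
  locally_integrable [set: R] g -> (forall x, x < A \/ B < x -> g x = 0) ->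
  (forall x : R, is_derive x (1 : R) eta (k x)) -> continuous k ->
  (forall x, x <= A \/ B <= x -> eta x = 0) ->
  (forall x, x < A \/ B < x -> k x = 0) ->
  \int[mu]_x (\int[mu]_(y in [set` `[A, x]]) g y * k x) =
  - \int[mu]_x (g x * eta x).
Proof.
move=> AB lg g0 deta ck eta0 k0.
have ceta := is_derive_continuous deta.
have mg : measurable_fun [set: R] g by case: lg.
have gi : Int g.
  apply: (@Int_restrict _ [set` `[A, B]]) => //; last exact: locally_integrable_itv.
  by move=> x /outside_itv/g0.
have ki : Int k by exact: Int_continuous_csupp k0.
(* Kernel on the triangle [y <= x]. It is dominated by [|k x| |g y|], whose iterated integral
   factors into two finite ones, so Fubini applies. *)
pose F (z : R * R) : R := if z.2 <= z.1 then k z.1 * g z.2 else 0.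
have mF : measurable_fun [set: R * R] F.
  apply: measurable_fun_ifT => //.
    by apply: measurable_fun_ler; [exact: measurable_snd|exact: measurable_fst].
  apply: measurable_funM.
    by apply: measurableT_comp => //; exact: continuous_measurable_fun.
  exact: measurableT_comp.
have mEF : measurable_fun [set: R * R] (EFin \o F) by exact/measurable_EFinP.
have iF : (mu \x mu)%E.-integrable [set: R * R] (EFin \o F).
  apply/integrable12ltyP => //.
  apply: (@le_lt_trans _ _ (\int[mu]_x (\int[mu]_y `|(g y)%:E| * `|(k x)%:E|))%E).
    apply: ge0_le_integral => //.
    - by move=> x _; apply: integral_ge0.
    - apply: (@measurable_fun_fubini_tonelli_F _ _ _ _ R mu (abse \o (EFin \o F))) => //=.
      exact: measurableT_comp.
    - apply: measurable_funeM; apply: measurableT_comp => //; apply/measurable_EFinP.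
      exact: continuous_measurable_fun.
    - move=> x _; rewrite -ge0_integralZr//; last first.
        by apply: measurableT_comp => //; exact/measurable_EFinP.
      apply: ge0_le_integral => //.
      + by apply: measurableT_comp => //; apply: (measurableT_comp mEF).
      + by apply: emeasurable_funM => //; apply: measurableT_comp => //; exact/measurable_EFinP.
      + move=> y _ /=; rewrite /F; case: ifPn => _; last by rewrite normr0 mule_ge0.
        by rewrite normrM muleC.
  rewrite ge0_integralZl//; last 2 first.
  - by apply: measurableT_comp => //; apply/measurable_EFinP; exact: continuous_measurable_fun.
  - by apply: integral_ge0.
  apply: lte_mul_pinfty; first exact: integral_ge0.
    rewrite ge0_fin_numE ?integral_ge0//.
    by case/integrableP : gi.
  by case/integrableP : ki.
have := Fubini iF.
have -> : (\int[mu]_x \int[mu]_y (EFin \o F) (x, y))%E =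
    (\int[mu]_x (\int[mu]_(y in [set` `[A, x]]) g y * k x)%:E)%E.
  apply: eq_integral => x _.
  have gx : mu.-integrable [set` `[A, x]] (EFin \o g) by exact: locally_integrable_itv.
  rewrite EFinM fineK; last by apply: integrable_fin_num.
  rewrite muleC -integralZl//.
  rewrite [RHS]integral_mkcond; apply: eq_integral => y _.
  rewrite patch_itvE /F /=; have [/andP[_ -> //]|] := boolP (A <= y <= x).
  rewrite negb_and -!ltNge => /orP[yA|xy].
    by rewrite g0 ?mulr0 ?if_same//; left.
  by rewrite leNgt xy.
have -> : (\int[mu]_y \int[mu]_x (EFin \o F) (x, y))%E =
    (\int[mu]_y (- (g y * eta y))%:E)%E.
  apply: eq_integral => y _.
  have [yA|yA] := ltP y A.
    rewrite g0 ?mul0r ?oppr0; last by left.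
    by apply: integral0_eq => x _; rewrite /F/= g0 ?mulr0 ?if_same//; left.
  have [yB|yB] := ltP B y.
    rewrite g0 ?mul0r ?oppr0; last by right.
    by apply: integral0_eq => x _; rewrite /F/= g0 ?mulr0 ?if_same//; right.
  (* The inner integral of [k] over [[y, B]] is [eta B - eta y], and [eta B = 0]; this produces the
     minus sign of the statement. *)
  rewrite -mulrN -[in RHS](add0r (- eta y)) -{1}(eta0 B); last by right.
  rewrite -(Rintegral_FTC2 yB deta ck) EFinM fineK; last first.
    apply: integrable_fin_num => //; apply: continuous_compact_integrable.
      exact: segment_compact.
    exact: continuous_subspaceT.
  rewrite -integralZl//; last first.
    apply: continuous_compact_integrable; first exact: segment_compact.
    exact: continuous_subspaceT.
  rewrite [RHS]integral_mkcond; apply: eq_integral => x _.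
  rewrite patch_itvE /F /=; have [/andP[-> _]|] := boolP (y <= x <= B).
    by rewrite -EFinM mulrC.
  rewrite negb_and -!ltNge => /orP[xy|xB].
    by rewrite leNgt xy.
  by rewrite k0 ?mul0r ?if_same//; right.
move=> h; rewrite /Rintegral h -/(Rintegral mu setT (fun y => - (g y * eta y))).
rewrite -[RHS]mulN1r -RintegralZl//; last first.
  have eta0' x : x < A \/ B < x -> eta x = 0.
    by move=> [xA|Bx]; apply: eta0; [left|right]; apply: ltW.
  have [C C0 etaC] := continuous_bounded_csupp ceta eta0'.
  exact: (Int_locM lg (continuous_measurable_fun ceta) etaC eta0').
by apply: eq_Rintegral => x _; rewrite mulN1r.
Qed.

End Primitive.

(** * Weak derivatives *)

Section WeakDerivatives.
Context {R : realType}.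
Local Notation mu := (@lebesgue_measure R).
Local Notation Int f := (mu.-integrable [set: R] (EFin \o f)).
Implicit Types (f g k eta phi : R -> R) (a b h x M : R).

Definition smooth_step a h x : R :=
  \int[mu]_(y in [set` `]-oo, x]]) mollifier a h y.

Lemma is_derive_smooth_step a h x : 0 < h ->
  is_derive x (1 : R) (smooth_step a h) (mollifier a h x).
Proof.
move=> h0; have xx1 : x < x + 1 by rewrite ltrDl.
have iM : mu.-integrable [set` `]-oo, (x + 1)]] (EFin \o mollifier a h).
  by apply: integrableS (mollifier_Int a h0).
have cM : {for x, continuous (mollifier a h)}.
  by apply: smooth_continuous; exact: smooth_mollifier.
have [dx dE] := continuous_FTC1 xx1 iM (ltNyr x) cM.
by rewrite -dE; exact: is_derive_derive1.
Qed.

Lemma smooth_step_lt a h x : 0 < h -> x < a - h -> smooth_step a h x = 0.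
Proof.
move=> h0 xa; rewrite /smooth_step.
transitivity (\int[mu]_(y in [set` `]-oo, x]]) (cst 0 y : R)).
  apply: eq_Rintegral => y; rewrite inE /= in_itv/= => yx.
  by rewrite mollifier_out_itv//; left; lra.
by rewrite Rintegral_cst ?mul0r//; exact: measurable_itv.
Qed.

Lemma smooth_step_gt a h x : 0 < h -> a + h < x -> smooth_step a h x = 1.
Proof.
move=> h0 ax; rewrite -(mollifier_mass a h0); symmetry.
apply: Rintegral_restrict => y /=; rewrite in_itv/= => /negP; rewrite -ltNge => xy.
by rewrite mollifier_out_itv//; right; lra.
Qed.

Lemma smooth_step_ge0 a h x : 0 < h -> 0 <= smooth_step a h x.
Proof. by move=> h0; apply: Rintegral_ge0 => y _; exact: mollifier_ge0. Qed.

Lemma smooth_step_le1 a h x : 0 < h -> smooth_step a h x <= 1.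
Proof.
move=> h0; rewrite -(mollifier_mass a h0) /smooth_step /Rintegral fine_le//.
- by apply: integrable_fin_num => //; apply: integrableS (mollifier_Int a h0).
- by apply: integrable_fin_num => //; exact: mollifier_Int.
- apply: ge0_subset_integral => //.
    by apply/measurable_EFinP; exact: Int_measurable (mollifier_Int a h0).
  by move=> y _; rewrite lee_fin mollifier_ge0.
Qed.

Definition plateau a b h x : R := smooth_step a h x - smooth_step b h x.

Lemma is_derive_plateau a b h x : 0 < h ->
  is_derive x (1 : R) (plateau a b h) (mollifier a h x - mollifier b h x).
Proof. by move=> h0; apply: is_derive1B; exact: is_derive_smooth_step. Qed.

Lemma plateau_out a b h x : 0 < h -> a <= b -> x < a - h \/ b + h < x ->
  plateau a b h x = 0.
Proof.
move=> h0 ab [xa|bx]; rewrite /plateau.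
  by rewrite !smooth_step_lt ?subrr//; lra.
by rewrite !smooth_step_gt ?subrr//; lra.
Qed.

Lemma plateau_norm_le1 a b h x : 0 < h -> `|plateau a b h x| <= 1.
Proof.
move=> h0; have := smooth_step_ge0 a x h0; have := smooth_step_ge0 b x h0.
have := smooth_step_le1 a x h0; have := smooth_step_le1 b x h0.
rewrite /plateau; move: (smooth_step a h x) (smooth_step b h x) => s t *.
by rewrite ler_norml; apply/andP; split; lra.
Qed.

Lemma test_plateau a b h : 0 < h -> a <= b -> test_function (plateau a b h).
Proof.
move=> h0 ab; apply: (@test_functionP _ _ (a - h) (b + h)).
  apply: smooth_primitive => [x|]; first exact: is_derive_plateau.
  have sB : smooth (mollifier a h + (cst (- 1) * mollifier b h)).
    apply: smoothD; first exact: smooth_mollifier.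
    by apply: smoothM; [exact: smooth_cst|exact: smooth_mollifier].
  apply: eq_ind sB _ _; apply/funext => x.
  by rewrite /GRing.add /GRing.mul /= mulN1r.
by move=> x; exact: plateau_out.
Qed.

(** The limit is reached as soon as [h_ n] is below the distance from [x] to both endpoints. The
    endpoints, where the steps are not yet constant, form a null set. *)
Lemma plateau_cvg a b x (h_ : nat -> R) : a <= b -> x != a -> x != b ->
  (forall n, 0 < h_ n) -> h_ n @[n --> \oo] --> (0 : R) ->
  plateau a b (h_ n) x @[n --> \oo] --> (if a <= x <= b then 1 else 0 : R).
Proof.
move=> ab xa xb h0 hcv; apply: cvg_near_cst; near=> n.
have hn : h_ n < Num.min `|x - a| `|x - b|.
  near: n; apply: (cvgr_lt _ hcv).
  by rewrite lt_min !normr_gt0 !subr_eq0 xa xb.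
have := h0 n; move: hn; move: (h_ n) => h; rewrite lt_min => /andP[ha hb] hp.
have [ax|ax] := leP a x; last first.
  rewrite ltr0_norm ?subr_lt0// in ha.
  by rewrite /= plateau_out//; left; lra.
have [bx|bx] := leP x b; last first.
  rewrite gtr0_norm ?subr_gt0// in hb.
  by rewrite plateau_out//; right; lra.
rewrite /plateau smooth_step_gt ?smooth_step_lt ?subr0//=.
  by rewrite ler0_norm ?subr_le0// in hb; lra.
by rewrite ger0_norm ?subr_ge0// in ha; lra.
Unshelve. all: by end_near. Qed.

Lemma plateau_measurable a b h : 0 < h -> measurable_fun [set: R] (plateau a b h).
Proof.
move=> h0; apply: continuous_measurable_fun; apply: is_derive_continuous => x.
exact: is_derive_plateau.
Qed.

Lemma ae_neq a : {ae mu, forall x, x != a}.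
Proof.
exists [set a]; split; first exact: measurable_set1.
  exact: lebesgue_measure_set1.
by move=> x /= /negP; rewrite negbK => /eqP.
Qed.

(* At Lebesgue points [a < b], testing against [plateau a b h] and letting
   [h] tend to [0] produces the increment [f b - f a]. *)
Lemma weak_deriv_increment f g a b : is_weak_deriv f g ->
  lebesgue_pt f a -> lebesgue_pt f b -> a <= b ->
  f b - f a = \int[mu]_(x in [set` `[a, b]]) g x.
Proof.
move=> [lf lg fg] fa fb ab.
pose h_ n : R := n.+1%:R^-1.
have h0 n : 0 < h_ n by rewrite invr_gt0.
have hcv : h_ n @[n --> \oo] --> (0 : R) by exact: cvg_harmonic.
have hcv' : h_ n @[n --> \oo] --> (0 : R)^'+.
  move=> P wP; have : \forall n \near \oo, 0 < h_ n -> P (h_ n) by exact: hcv wP.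
  by apply: filterS => n; apply.
have c1 : \int[mu]_x (f x * (mollifier a (h_ n) x - mollifier b (h_ n) x))
    @[n --> \oo] --> f a - f b.
  have -> : (fun n => \int[mu]_x (f x * (mollifier a (h_ n) x - mollifier b (h_ n) x))) =
      (fun n => \int[mu]_x (f x * mollifier a (h_ n) x) -
                \int[mu]_x (f x * mollifier b (h_ n) x)).
    apply/funext => n; rewrite -RintegralB//; try exact: Int_loc_mollifier.
    by apply: eq_Rintegral => x _; rewrite mulrBr.
  by apply: cvgB; [exact: cvg_comp hcv' (mollify_cvg lf fa)
                  |exact: cvg_comp hcv' (mollify_cvg lf fb)].
have mg : measurable_fun [set: R] g by case: lg.
have c2 : \int[mu]_x (g x * plateau a b (h_ n) x) @[n --> \oo] -->
    \int[mu]_x (g x * (if a <= x <= b then 1 else 0)).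
  (* Since [h_ n <= 1], all the plateaus are supported in [[a - 1, b + 1]], where [g] is
     integrable. *)
  apply: (@Rintegral_dominated _ _ _ (fun x => `|g x| * (if a - 1 <= x <= b + 1 then 1 else 0))).
  - by move=> n; apply: measurable_funM => //; exact: plateau_measurable.
  - apply: measurable_funM => //; apply: measurable_fun_ifT => //.
    by apply: measurable_and => //; apply: measurable_fun_ler.
  - apply: ae_mono (ae_and (ae_neq a) (ae_neq b)) _ => x [xa xb].
    by apply: cvgM; [exact: cvg_cst|exact: plateau_cvg].
  - apply: (@Int_restrict _ [set` `[a - 1, b + 1]]) => //.
      by move=> x /=; rewrite in_itv/= => /negP/negPf ->; rewrite mulr0.
    have := integrable_abse (locally_integrable_itv (a - 1) (b + 1) lg).
    apply: eq_integrable => // x; rewrite inE /= in_itv/= => ->.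
    by rewrite mulr1.
  - move=> n x; rewrite normrM; have [_|xab] := ifPn.
      by rewrite ler_wpM2l// plateau_norm_le1.
    rewrite plateau_out ?normr0 ?mulr0// /h_.
    have : n.+1%:R^-1 <= 1 :> R by rewrite invf_le1// ler1n.
    move: (n.+1%:R^-1) => t t1; move: xab; rewrite negb_and -!ltNge.
    by move=> /orP[] hx; [left|right]; lra.
have eqn n : \int[mu]_x (f x * (mollifier a (h_ n) x - mollifier b (h_ n) x)) =
    - \int[mu]_x (g x * plateau a b (h_ n) x).
  rewrite -(fg _ (test_plateau (h0 n) ab)); apply: eq_Rintegral => x _.
  by rewrite (is_derive_fun (fun x => is_derive_plateau a b x (h0 n))).
have c1' : (- \int[mu]_x (g x * plateau a b (h_ n) x)) @[n --> \oo] --> f a - f b.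
  by rewrite -(funext eqn).
rewrite -[LHS]opprB (norm_cvg_unique c1' (cvgN c2)) opprK.
rewrite (@Rintegral_restrict _ [set` `[a, b]]).
  by apply: eq_Rintegral => x; rewrite inE /= in_itv/= => ->; rewrite mulr1.
by move=> x /=; rewrite in_itv/= => /negP/negPf ->; rewrite mulr0.
Qed.

Lemma ae_ex (P : R -> Prop) : {ae mu, forall x, P x} -> exists x, P x.
Proof.
move=> [N [mN N0 PN]]; apply: contrapT => /forallNP nP.
have NT : N = [set: R] by apply/seteqP; split => // x _; apply: PN; exact: nP.
have : mu [set: R] = +oo%E by rewrite -set_itvNyy lebesgue_measure_itv.
by rewrite -NT [LHS]N0.
Qed.

(** Any Lebesgue point of [f] can serve as [a]: the increment formula then holds at every other
    Lebesgue point, that is, almost everywhere. *)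
Lemma weak_deriv_repr f g : is_weak_deriv f g ->
  exists a, {ae mu, forall x, f x = f a + primitive g a x}.
Proof.
move=> fg; have [lf lg _] := fg.
have ld := lebesgue_differentiation lf.
have [a fa] := ae_ex ld; exists a; apply: ae_mono ld _ => x fx.
rewrite /primitive; case: ifPn => [ax|].
  by rewrite -(weak_deriv_increment fg fa fx ax) subrKC.
rewrite -ltNge => /ltW xa.
by rewrite -(weak_deriv_increment fg fx fa xa) opprB subrKC.
Qed.

(** By continuity every point is a Lebesgue point of the difference, whose mollifications are all
    zero. *)
Lemma ae_eq_continuous f g : continuous f -> continuous g ->
  {ae mu, forall x, f x = g x} -> f = g.
Proof.
move=> cf cg fg; apply/funext => x.
have cfg : continuous (fun y => f y - g y) by move=> y; apply: cvgB; [exact: cf|exact: cg].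
have lfg := continuous_locally_integrable cfg.
have pt : lebesgue_pt (fun y => f y - g y) x.
  apply: (@continuous_lebesgue_pt _ _ _ [set: R]) => //.
  - by split => //; exact: openT.
  - exact: continuous_measurable_fun.
  - exact: cfg.
have cv := mollify_cvg lfg pt.
have cv0 : \int[mu]_y ((f y - g y) * mollifier x h y) @[h --> 0^'+] --> (0 : R).
  apply: cvg_near_cst; near=> h; have h0 : 0 < h by near: h; exact: nbhs_right_gt.
  transitivity (\int[mu]_y (cst 0 y : R)).
    apply: Rintegral_ae_eq => //.
      exact: Int_measurable (Int_loc_mollifier x h0 lfg).
    by apply: ae_mono fg _ => y ->; rewrite subrr mul0r.
  by rewrite Rintegral_cst ?mul0r.
by apply/eqP; rewrite -subr_eq0; apply/eqP; exact: norm_cvg_unique cv cv0.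
Unshelve. all: by end_near. Qed.

Lemma weak_deriv_continuous f g : is_weak_deriv f g ->
  exists2 F : R -> R, continuous F & {ae mu, forall x, f x = F x}.
Proof.
move=> fg; have [_ lg _] := fg; have [a fa] := weak_deriv_repr fg.
exists (fun x => f a + primitive g a x) => // x.
by apply: cvgD; [exact: cvg_cst|exact: primitive_continuous].
Qed.

(** Regularity bootstrap: a weak derivative with a continuous representative is a classical one,
    because [f] is almost everywhere a constant plus a primitive of it. *)
Lemma weak_deriv_C1 f g k : is_weak_deriv f g -> continuous k ->
  {ae mu, forall x, g x = k x} ->
  exists2 F : R -> R, (forall x, is_derive x (1 : R) F (k x)) &
    {ae mu, forall x, f x = F x}.
Proof.
move=> fg ck gk; have [_ lg _] := fg; have [a fa] := weak_deriv_repr fg.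
have lk := continuous_locally_integrable ck.
exists (fun x => f a + primitive k a x) => [x|].
  apply: is_derive1_ext (is_derive1D (is_derive1_cst x (f a)) (is_derive_primitive a x ck)) _.
  by rewrite add0r.
by apply: ae_mono fa _ => x ->; rewrite (primitive_ae_eq _ _ lg lk gk).
Qed.

(** The test function [eta] is not approximated by smooth ones; instead [f] is replaced by a
    constant plus a primitive of [g], and the order of integration is exchanged. This is what makes
    products of a test function with a C^1 coefficient admissible. *)
Lemma weak_deriv_test_C1 f g eta k M : is_weak_deriv f g ->
  (forall x, is_derive x (1 : R) eta (k x)) -> continuous k ->
  (forall x, M < `|x| -> eta x = 0) ->
  \int[mu]_x (f x * k x) = - \int[mu]_x (g x * eta x).
Proof.
move=> fg deta ck etaM; have [lf lg _] := fg; have [a fa] := weak_deriv_repr fg.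
have ceta := is_derive_continuous deta.
(* The interval [[A, B]] contains the support of [eta] in its interior and reaches to the left of
   [a], so that the primitive can be based at [A]. *)
pose M' := `|M| + 1 + `|a|; pose A := - M'; pose B := M'.
have M'M : M < M' by rewrite /M'; have := ler_norm M; have := normr_ge0 a; lra.
have M'0 : 0 <= M' by rewrite /M'; have := normr_ge0 M; have := normr_ge0 a; lra.
have AB : A <= B by rewrite /A /B; lra.
have eta0 x : x <= A \/ B <= x -> eta x = 0.
  rewrite /A /B => hx; apply: etaM; rewrite ltr_normr.
  by case: hx => hx; apply/orP; [right|left]; lra.
have keta x : M < `|x| -> k x = 0.
  move=> Mx; have [_ <-] := deta x.
  have [_ <-] : is_derive x (1 : R) (cst (0 : R)) 0 by exact: is_derive_cst.
  apply: near_eq_derive; near=> y; rewrite etaM//; near: y.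
  have : {for x, continuous (@Num.norm _ R)} by exact: norm_continuous.
  by move/cvgr_gt; apply.
have k0 x : x < A \/ B < x -> k x = 0.
  rewrite /A /B => hx; apply: keta; rewrite ltr_normr.
  by case: hx => hx; apply/orP; [right|left]; lra.
(* The exchange of integrals needs a density supported in [[A, B]]; cutting [g] off there changes
   nothing where [eta] or [k] is nonzero. *)
pose gA x := if A <= x <= B then g x else 0.
have gAg x : `|gA x| <= `|g x| by rewrite /gA; case: ifPn => // _; rewrite normr0.
have mg : measurable_fun [set: R] g by case: lg.
have mgA : measurable_fun [set: R] gA.
  apply: measurable_fun_ifT => //.
  by apply: measurable_and => //; apply: measurable_fun_ler.
have lgA : locally_integrable [set: R] gA.
  apply: locally_integrable_le (fun x => gAg x) _ => //.
  split; [exact: measurableT_comp|exact: openT|].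
  move=> K KT cK; case: lg => _ _ /(_ K KT cK).
  by under [X in (X < _)%E -> _]eq_integral do rewrite -normr_id.
have gA0 x : x < A \/ B < x -> gA x = 0.
  by rewrite /gA; case=> hx; rewrite ifF//; apply/negbTE; rewrite negb_and -!ltNge hx ?orbT.
have := Rintegral_primitiveM AB lgA gA0 deta ck eta0 k0.
have -> : \int[mu]_x (gA x * eta x) = \int[mu]_x (g x * eta x).
  apply: eq_Rintegral => x _; rewrite /gA; case: ifPn => //.
  rewrite negb_and -!ltNge => /orP[] hx; rewrite eta0 ?mulr0//; [left|right]; exact: ltW.
move=> <-.
have [C C0 kC] := continuous_bounded_csupp ck k0.
have mk := continuous_measurable_fun ck.
have lP : locally_integrable [set: R] (fun x => f a - primitive g A a + primitive gA A x).
  apply: continuous_locally_integrable => x.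
  by apply: cvgD; [exact: cvg_cst|exact: primitive_continuous].
have Aa : A <= a.
  by rewrite /A /M'; have := normr_ge0 M; have := ler_norm (- a); rewrite normrN; lra.
transitivity (\int[mu]_x ((f a - primitive g A a + primitive gA A x) * k x)).
  apply: Rintegral_ae_eq.
  - by apply: measurable_funM => //; case: lf.
  - by apply: measurable_funM => //; case: lP.
  - apply: ae_mono fa _ => x ->.
    have [xA|xA] := ltP x A; first by rewrite k0 ?mulr0//; left.
    have [xB|xB] := ltP B x; first by rewrite k0 ?mulr0//; right.
    rewrite (primitive_shift lg Aa xA) {1 2}/primitive Aa xA.
    have -> : \int[mu]_(y in [set` `[A, x]]) gA y = \int[mu]_(y in [set` `[A, x]]) g y.
      apply: eq_Rintegral => y; rewrite inE /= in_itv/= => /andP[y1 y2].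
      by rewrite /gA y1 (le_trans y2 xB).
    by congr (_ * _); ring.
have iC : Int (fun x => (f a - primitive g A a) * k x) by apply: IntZ; exact: Int_continuous_csupp k0.
have iP : Int (fun x => primitive gA A x * k x).
  apply: (Int_locM _ mk kC k0); apply: continuous_locally_integrable.
  exact: primitive_continuous.
under eq_Rintegral do rewrite mulrDl.
rewrite RintegralD// RintegralZl//; last exact: Int_continuous_csupp k0.
(* The constant part of [f] contributes nothing, [k] being the derivative of a compactly supported
   function. *)
rewrite (Rintegral_derivative_csupp AB deta ck eta0 k0) mulr0 add0r.
apply: eq_Rintegral => x _; rewrite /primitive; case: ifPn => //.
by rewrite -ltNge => xA; rewrite k0 ?mulr0//; left.
Unshelve. all: by end_near. Qed.

Lemma weak_deriv_unique f g1 g2 : is_weak_deriv f g1 -> is_weak_deriv f g2 ->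
  {ae mu, forall x, g1 x = g2 x}.
Proof.
move=> [_ lg1 fg1] [_ lg2 fg2].
have := fundamental_lemma (locally_integrableB lg1 lg2) _.
move=> h; apply: ae_mono (h _) _ => [phi tphi|x /eqP]; last first.
  by rewrite subr_eq0 => /eqP.
have [M M0 phiM] := test_function_csupp tphi.
have sphi := test_function_smooth tphi.
have cphi : continuous phi by exact: smooth_continuous.
have phi0 x : x < - M \/ M < x -> phi x = 0.
  by move=> hx; apply: phiM; rewrite ltr_normr; case: hx => ?; apply/orP; [right|left]; lra.
have [C C0 phiC] := continuous_bounded_csupp cphi phi0.
have mphi := continuous_measurable_fun cphi.
have i1 := Int_locM lg1 mphi phiC phi0; have i2 := Int_locM lg2 mphi phiC phi0.
under eq_Rintegral do rewrite mulrBl.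
rewrite RintegralB//; apply/eqP; rewrite subr_eq0; apply/eqP.
by apply: oppr_inj; rewrite -fg1// -fg2.
Qed.

End WeakDerivatives.

(** * Calculus rules for weak derivatives *)

Section WeakDerivativeRules.
Context {R : realType}.
Local Notation mu := (@lebesgue_measure R).
Local Notation Int f := (mu.-integrable [set: R] (EFin \o f)).
Implicit Types (f g phi m : R -> R) (a h x M : R).

Lemma locally_integrable_measurable f :
  locally_integrable [set: R] f -> measurable_fun [set: R] f.
Proof. by case. Qed.

Lemma locally_integrable_ae_eq f g : measurable_fun [set: R] g ->
  {ae mu, forall x, f x = g x} -> locally_integrable [set: R] f ->
  locally_integrable [set: R] g.
Proof.
move=> mg fg [mf oT lf]; split => // K KT cK; apply: le_lt_trans (lf K KT cK).
have mK := compact_measurable cK.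
rewrite le_eqVlt; apply/orP; left; apply/eqP; apply: ae_eq_integral => //.
- by apply/measurable_EFinP/measurableT_comp => //; exact: measurable_funS mg.
- by apply/measurable_EFinP/measurableT_comp => //; exact: measurable_funS mf.
- by apply: ae_mono fg _ => x ->.
Qed.

Lemma test_function_derive1 phi : test_function phi ->
  test_function (derive1 phi).
Proof.
move=> tphi; have sphi := test_function_smooth tphi.
have [M M0 phiM] := test_function_csupp tphi.
apply: (@test_functionP _ _ (- M) M).
  by move=> n x; rewrite -derive1Sn; exact: sphi.
move=> x hx; have Mx : M < `|x|.
  by rewrite ltr_normr; case: hx => ?; apply/orP; [right|left]; lra.
rewrite derive1E.
have [_ <-] : is_derive x (1 : R) (cst (0 : R)) 0 by exact: is_derive_cst.
apply: near_eq_derive; near=> y; rewrite phiM//; near: y.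
have : {for x, continuous (@Num.norm _ R)} by exact: norm_continuous.
by move/cvgr_gt; apply.
Unshelve. all: by end_near. Qed.

Lemma Int_loc_test f phi : locally_integrable [set: R] f -> test_function phi ->
  Int (fun x => f x * phi x).
Proof.
move=> lf tphi; have [M M0 phiM] := test_function_csupp tphi.
have cphi : continuous phi.
  by apply: smooth_continuous; exact: test_function_smooth.
have phi0 x : x < - M \/ M < x -> phi x = 0.
  by move=> hx; apply: phiM; rewrite ltr_normr; case: hx => ?; apply/orP; [right|left]; lra.
have [C C0 phiC] := continuous_bounded_csupp cphi phi0.
exact: Int_locM lf (continuous_measurable_fun cphi) phiC phi0.
Qed.

Lemma weak_deriv_ae_eq f g f' g' : measurable_fun [set: R] f' ->
  measurable_fun [set: R] g' -> {ae mu, forall x, f x = f' x} ->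
  {ae mu, forall x, g x = g' x} -> is_weak_deriv f g -> is_weak_deriv f' g'.
Proof.
move=> mf' mg' ff' gg' [lf lg fg].
have lf' := locally_integrable_ae_eq mf' ff' lf.
have lg' := locally_integrable_ae_eq mg' gg' lg.
split=> // phi tphi; have tphi' := test_function_derive1 tphi.
have i1 := Int_measurable (Int_loc_test lf tphi').
have i1' := Int_measurable (Int_loc_test lf' tphi').
have i2 := Int_measurable (Int_loc_test lg tphi).
have i2' := Int_measurable (Int_loc_test lg' tphi).
rewrite -(Rintegral_ae_eq i1 i1') -?(Rintegral_ae_eq i2 i2') ?fg//.
- by apply: ae_mono gg' _ => x ->.
- by apply: ae_mono ff' _ => x ->.
Qed.

Lemma locally_integrableDr f g : locally_integrable [set: R] f ->
  locally_integrable [set: R] g -> locally_integrable [set: R] (fun x => f x + g x).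
Proof. exact: locally_integrableD. Qed.

Lemma locally_integrableZr f (a : R) : locally_integrable [set: R] f ->
  locally_integrable [set: R] (fun x => a * f x).
Proof. by move=> lf; apply: (locally_integrableM lf (g := cst a)) => x; exact: cvg_cst. Qed.

Lemma weak_derivD f g f' g' : is_weak_deriv f g -> is_weak_deriv f' g' ->
  is_weak_deriv (fun x => f x + f' x) (fun x => g x + g' x).
Proof.
move=> [lf lg fg] [lf' lg' fg']; split; [exact: locally_integrableDr..|].
move=> phi tphi; have tphi' := test_function_derive1 tphi.
under eq_Rintegral do rewrite mulrDl.
under [in RHS]eq_Rintegral do rewrite mulrDl.
by rewrite !RintegralD ?fg ?fg' ?opprD//; exact: Int_loc_test.
Qed.

Lemma weak_derivZ f g (a : R) : is_weak_deriv f g ->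
  is_weak_deriv (fun x => a * f x) (fun x => a * g x).
Proof.
move=> [lf lg fg]; split; [exact: locally_integrableZr..|].
move=> phi tphi; have tphi' := test_function_derive1 tphi.
under eq_Rintegral do rewrite -mulrA.
under [in RHS]eq_Rintegral do rewrite -mulrA.
by rewrite !RintegralZl ?fg ?mulrN//; exact: Int_loc_test.
Qed.

Lemma weak_derivB f g f' g' : is_weak_deriv f g -> is_weak_deriv f' g' ->
  is_weak_deriv (fun x => f x - f' x) (fun x => g x - g' x).
Proof.
move=> fg /(weak_derivZ (-1)) fg'; have := weak_derivD fg fg'.
congr is_weak_deriv; by apply/funext => x; rewrite mulN1r.
Qed.

(** Test [f] against [m phi], which is only C^1, and move the term with [m1 phi] to the other
    side. *)
Lemma weak_derivM f g m m1 : is_weak_deriv f g ->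
  (forall x, is_derive x (1 : R) m (m1 x)) -> continuous m1 ->
  is_weak_deriv (fun x => m x * f x) (fun x => m1 x * f x + m x * g x).
Proof.
move=> fg dm cm1; have [lf lg _] := fg; have cm := is_derive_continuous dm.
have lm1f := locally_integrableM lf cm1; have lmg := locally_integrableM lg cm.
split; [exact: locally_integrableM|exact: locally_integrableDr|move=> phi tphi].
have [M M0 phiM] := test_function_csupp tphi.
have sphi := test_function_smooth tphi.
have tphi' := test_function_derive1 tphi.
have dphi x : is_derive x (1 : R) phi (derive1 phi x).
  by apply: is_derive_derive1; apply: (sphi 0%N).
have cphi' : continuous (derive1 phi).
  by apply: smooth_continuous; exact: test_function_smooth.
have ck : continuous (fun x => m x * derive1 phi x + phi x * m1 x).
  move=> x; apply: cvgD; apply: cvgM; [exact: cm|exact: cphi'| |exact: cm1].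
  by apply: smooth_continuous.
have iP := Int_loc_test lm1f tphi; have iQ := Int_loc_test lmg tphi.
have iL := Int_loc_test (locally_integrableM lf cm) tphi'.
have etaM x : M < `|x| -> m x * phi x = 0 by move=> /phiM ->; rewrite mulr0.
have := weak_deriv_test_C1 fg (fun x => is_derive1M (dm x) (dphi x)) ck etaM.
rewrite (_ : \int[mu]_x (f x * (m x * derive1 phi x + phi x * m1 x)) =
  \int[mu]_x (m x * f x * derive1 phi x) + \int[mu]_x (m1 x * f x * phi x)); last first.
  by rewrite -RintegralD//; apply: eq_Rintegral => x _; ring.
rewrite (_ : \int[mu]_x (g x * (m x * phi x)) = \int[mu]_x (m x * g x * phi x)); last first.
  by apply: eq_Rintegral => x _; ring.
move=> h; under [in RHS]eq_Rintegral do rewrite mulrDl.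
by rewrite RintegralD// opprD -h addrC addrK.
Qed.

End WeakDerivativeRules.

(** * Riesz representation *)

Section RieszRepresentation.
Context {R : realType}.

Lemma quadratic_discriminant (e d n : R) : 0 <= n ->
  (forall a : R, 0 <= e + 2 * a * d + a ^+ 2 * n) -> d ^+ 2 <= e * n.
Proof.
move=> n0 h; have [n00|nN0] := eqVneq n 0.
  have [->|dN0] := eqVneq d 0; first by rewrite expr0n /= n00 mulr0.
  (* With [n = 0] the form is affine in [a], and takes the value [-1] at this point. *)
  have := h (- (e + 1) / (2 * d)); rewrite n00 mulr0 addr0.
  rewrite (_ : 2 * (- (e + 1) / (2 * d)) * d = - (e + 1)); last by field.
  lra.
have np : 0 < n by rewrite lt_def nN0.
have := h (- d / n); rewrite -(ler_pM2r np) mul0r.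
rewrite (_ : (_ + _) * n = e * n - d ^+ 2) ?subr_ge0//; field.
by [].
Qed.

Lemma le_geometric_eq0 (x K : R) : 0 <= x ->
  (forall n : nat, x <= K * (1 / 2) ^+ n) -> x = 0.
Proof.
move=> x0 h; apply/eqP; rewrite eq_le x0 andbT.
have cv : K * (1 / 2) ^+ n @[n --> \oo] --> K * 0.
  apply: cvgM; first exact: cvg_cst.
  by apply: cvg_expr; rewrite ger0_norm//; lra.
rewrite mulr0 in cv; have := cvg_lim (@Rhausdorff R) cv => <-.
apply: limr_ge; first by apply/cvg_ex; exists 0.
by apply: nearW => n; exact: h.
Qed.

(* [lin a x y] stands for [x + a y]; [L] is a space that is complete for
   geometrically Cauchy sequences, and [G] is the graph of a linear form
   bounded by [C] on a subspace of [L]. *)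
Lemma riesz_representation (H : Type) (L : H -> Prop) (lin : R -> H -> H -> H)
    (ip : H -> H -> R) (G : H -> R -> Prop) (C : R)
  (L_lin : forall a x y, L x -> L y -> L (lin a x y))
  (ip_sym : forall x y, ip x y = ip y x)
  (ip_lin : forall a x y z, L x -> L y -> L z ->
    ip (lin a x y) z = ip x z + a * ip y z)
  (ip_ge0 : forall x, L x -> 0 <= ip x x)
  (L_complete : forall F : nat -> H, (forall n, L (F n)) ->
    (forall n, ip (lin (-1) (F n.+1) (F n)) (lin (-1) (F n.+1) (F n))
       <= (1 / 16) ^+ n) ->
    exists2 V, L V & exists K, forall n,
      ip (lin (-1) V (F n)) (lin (-1) V (F n)) <= K * (1 / 2) ^+ n)
  (GL : forall x r, G x r -> L x)
  (G_lin : forall a x y r s, G x r -> G y s -> G (lin a x y) (r + a * s))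
  (G_nonempty : exists x r, G x r)
  (C0 : 0 <= C)
  (G_bound : forall x r, G x r -> r ^+ 2 <= C * ip x x) :
  exists V, [/\ L V, forall x r, G x r -> ip V x = r & ip V V <= C].
Proof.
have ip_linr a x y z : L x -> L y -> L z -> ip z (lin a x y) = ip z x + a * ip z y.
  by move=> Lx Ly Lz; rewrite !(ip_sym z) ip_lin.
have ip_linlin a x y : L x -> L y ->
    ip (lin a x y) (lin a x y) = ip x x + 2 * a * ip x y + a ^+ 2 * ip y y.
  move=> Lx Ly; have Ll := L_lin a _ _ Lx Ly.
  by rewrite ip_lin// !ip_linr// (ip_sym y x); ring.
have J_lb x r : G x r -> 2 * r - ip x x <= C.
  move=> Gxr; have := G_bound _ _ Gxr.
  have [->|CN0] := eqVneq C 0.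
    rewrite mul0r => r0; have -> : r = 0.
      by apply/eqP; rewrite -sqrf_eq0 eq_le r0 sqr_ge0.
    by rewrite mulr0 sub0r oppr_le0 ip_ge0//; exact: GL Gxr.
  have Cp : 0 < C by rewrite lt_def CN0.
  rewrite -ler_pdivrMl// mulrC => h.
  have := sqr_ge0 (r / C - 1); rewrite -(pmulr_rge0 _ Cp).
  rewrite (_ : C * _ = r ^+ 2 / C - 2 * r + C); last by field.
  lra.
(* The representing vector is obtained as the limit of a sequence minimizing [ip x x - 2 r] over the
   graph; [J_lb] says that this functional is at least [- C]. *)
pose S := [set j | exists x r, G x r /\ j = ip x x - 2 * r] : set R.
have S_lb : has_inf S.
  split; first by have [x [r Gxr]] := G_nonempty; exists (ip x x - 2 * r), x, r.
  by exists (- C) => _ [x [r [/J_lb h ->]]]; lra.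
pose e n : R := (1 / 16) ^+ n / 4.
have e0 n : 0 < e n by rewrite divr_gt0// exprn_gt0//; lra.
have : forall n, exists p : H * R, G p.1 p.2 /\ ip p.1 p.1 - 2 * p.2 < inf S + e n.
  move=> n; have [_ [x [r [Gxr ->]]] h] := inf_adherent (e0 n) S_lb.
  by exists (x, r).
move=> /choice[p pP].
pose X n := (p n).1; pose r n := (p n).2.
have GX n : G (X n) (r n) by case: (pP n).
have LX n : L (X n) by exact: GL (GX n).
have JX n : ip (X n) (X n) - 2 * r n < inf S + e n by case: (pP n).
have S_ge x s : G x s -> inf S <= ip x x - 2 * s.
  by move=> Gxs; apply: ge_inf; [case: S_lb|exists x, s].
have [V LV [K VK]] : exists2 V, L V & exists K, forall n,
      ip (lin (-1) V (X n)) (lin (-1) V (X n)) <= K * (1 / 2) ^+ n.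
  apply: L_complete => // n.
  set y := lin (-1) (X n.+1) (X n).
  have Gy : G y (r n.+1 + (-1) * r n) by exact: G_lin.
  have Ly := GL _ _ Gy.
  (* Compare with the midpoint of [X n] and [X n.+1]: by the parallelogram law
     [ip y y <= 2 (e n + e n.+1)], which is at most [4 e n = (1 / 16) ^ n]. The factor [1 / 4] in
     [e] is chosen for this. *)
  have := S_ge _ _ (G_lin (1 / 2) _ _ _ _ (GX n) Gy).
  rewrite ip_linlin//.
  have EX : ip (X n) (X n.+1) = ip (X n) (X n) + ip (X n) y.
    by rewrite /y ip_linr//; ring.
  have Ey : ip y y = ip (X n.+1) (X n.+1) - 2 * ip (X n) (X n.+1) + ip (X n) (X n).
    by rewrite /y ip_linlin// (ip_sym (X n.+1) (X n)); ring.
  have := JX n; have := JX n.+1.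
  have -> : e n.+1 = e n / 16 by rewrite /e exprS; field.
  have := e0 n; rewrite (_ : (1 / 16) ^+ n = 4 * e n); last by rewrite /e; field.
  lra.
(* Approximate Euler equation: moving from [X n] along [x] lowers the functional by at most [e n],
   whatever the step [a], and the discriminant bounds the linear coefficient. *)
have dist x s : G x s -> forall n, (ip (X n) x - s) ^+ 2 <= e n * ip x x.
  move=> Gxs n; apply: quadratic_discriminant; first exact: ip_ge0 (GL _ _ Gxs).
  move=> a; have := S_ge _ _ (G_lin a _ _ _ _ (GX n) Gxs).
  rewrite ip_linlin//; last exact: GL Gxs.
  by have := JX n; lra.
have cs x y : L x -> L y -> ip x y ^+ 2 <= ip x x * ip y y.
  move=> Lx Ly; apply: quadratic_discriminant; first exact: ip_ge0.
  by move=> a; rewrite -ip_linlin// ip_ge0//; exact: L_lin.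
have K0 : 0 <= K.
  have := VK 0%N; rewrite expr0 mulr1; apply: le_trans.
  by rewrite ip_ge0//; exact: L_lin.
have e_le n : e n <= (1 / 2) ^+ n.
  rewrite /e -[leRHS]divr1 ler_pM ?exprn_ge0 ?invr_ge0//; try lra.
  by rewrite lerXn2r ?nnegrE; lra.
have VG x s : G x s -> ip V x = s.
  move=> Gxs; have Lx := GL _ _ Gxs.
  have n0 := ip_ge0 _ Lx.
  apply/eqP; rewrite -subr_eq0 -sqrf_eq0; apply/eqP.
  apply: (@le_geometric_eq0 _ (2 * (K + 1) * ip x x)); first exact: sqr_ge0.
  move=> n; have h1 := dist _ _ Gxs n.
  have LVX := L_lin (-1) _ _ LV (LX n).
  have := cs _ _ LVX Lx; rewrite ip_lin// mulN1r => h2.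
  have h3 : ip (lin (-1) V (X n)) (lin (-1) V (X n)) * ip x x
      <= K * (1 / 2) ^+ n * ip x x by exact: ler_wpM2r.
  have h4 : e n * ip x x <= (1 / 2) ^+ n * ip x x by exact: ler_wpM2r.
  have := sqr_ge0 (ip V x - ip (X n) x - (ip (X n) x - s)).
  nra.
exists V; split => //.
(* Expanding the squared distance from [V] to [X n] gives [ip V V - (2 r n - ip (X n) (X n))], and
   [J_lb] bounds the parenthesis by [C]. *)
have h n : ip V V - C <= K * (1 / 2) ^+ n.
  have := VK n; rewrite ip_linlin// (VG _ _ (GX n)).
  by have := J_lb _ _ (GX n); lra.
have [//|VC] := leP (ip V V) C.
have := le_geometric_eq0 _ h; rewrite subr_ge0 => /(_ (ltW VC)).
lra.
Qed.

End RieszRepresentation.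

(** * Square integrable functions *)

Section SquareIntegrable.
Context {R : realType}.
Local Notation mu := (@lebesgue_measure R).
Local Notation Int f := (mu.-integrable [set: R] (EFin \o f)).
Implicit Types (f g : R -> R).

Definition sq_integrable f :=
  measurable_fun [set: R] f /\ Int (fun x => f x ^+ 2).

Lemma sq_integrableP f : f \in Lfun mu 2%:E <-> sq_integrable f.
Proof.
split=> [lf|[mf fi]].
  split; last exact: Lfun2_integrable_sqr.
  by move: lf; rewrite inE => /andP[/[!inE]].
rewrite inE; apply/andP; split; rewrite inE//= /finite_norm unlock /=.
rewrite poweR_lty//; move/integrableP: fi => [_]; apply: le_lt_trans.
rewrite le_eqVlt; apply/orP; left; apply/eqP; apply: eq_integral => x _ /=.
by rewrite powR_mulrn// -normrX.
Qed.

Lemma sq_integrable_Int_mul f g : sq_integrable f -> sq_integrable g ->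
  Int (fun x => f x * g x).
Proof.
move=> [mf fi] [mg gi]; apply: Int_le (IntD fi gi) => //.
  exact: measurable_funM.
move=> x; rewrite normrM.
have := sqr_ge0 (`|f x| - `|g x|); rewrite -[f x ^+ 2]real_normK ?num_real//.
rewrite -[g x ^+ 2]real_normK ?num_real//.
have := normr_ge0 (f x); have := normr_ge0 (g x); nra.
Qed.

Lemma sq_integrableD f g : sq_integrable f -> sq_integrable g ->
  sq_integrable (fun x => f x + g x).
Proof.
move=> f2 g2; have [mf fi] := f2; have [mg gi] := g2.
split; first exact: measurable_funD.
have := IntD (IntD fi (IntZ 2 (sq_integrable_Int_mul f2 g2))) gi.
by apply: eq_integrable => // x _ /=; congr (_%:E); ring.
Qed.

Lemma sq_integrableM_bounded f g (C : R) : measurable_fun [set: R] g ->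
  (forall x, `|g x| <= C) -> sq_integrable f -> sq_integrable (fun x => g x * f x).
Proof.
move=> mg gC [mf fi]; split; first exact: measurable_funM.
apply: Int_le (IntZ (C ^+ 2) fi) => [|x].
  by apply: measurable_funX; exact: measurable_funM.
rewrite exprMn normrM ger0_norm ?sqr_ge0// ger0_norm ?sqr_ge0// ler_wpM2r ?sqr_ge0//.
by rewrite -[g x ^+ 2]real_normK ?num_real// lerXn2r ?nnegrE// (le_trans (normr_ge0 _) (gC x)).
Qed.

Lemma sq_integrableZ f (a : R) : sq_integrable f ->
  sq_integrable (fun x => a * f x).
Proof. by apply: (sq_integrableM_bounded (g := cst a) (C := `|a|)). Qed.

Lemma sq_integrableB f g : sq_integrable f -> sq_integrable g ->
  sq_integrable (fun x => f x - g x).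
Proof.
move=> f2 /(sq_integrableZ (-1)) g2; have := sq_integrableD f2 g2.
by congr sq_integrable; apply/funext => x; rewrite mulN1r.
Qed.

Lemma sq_integrable_ae_eq f g : measurable_fun [set: R] g ->
  {ae mu, forall x, f x = g x} -> sq_integrable f -> sq_integrable g.
Proof.
move=> mg fg [mf fi]; split => //; apply: Int_ae_eq fi.
  exact: measurable_funX.
by apply: ae_mono fg _ => x ->.
Qed.

Lemma sq_integrable_csupp a b f : continuous f ->
  (forall x, x < a \/ b < x -> f x = 0) -> sq_integrable f.
Proof.
move=> cf f0; split; first exact: continuous_measurable_fun.
apply: (@Int_continuous_csupp _ a b) => [x|x /f0 ->]; last by rewrite expr0n.
by apply: cvgM; exact: cf.
Qed.

Lemma sq_integrable_locally f : sq_integrable f -> locally_integrable [set: R] f.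
Proof.
move=> [mf fi]; apply: (@locally_integrable_le _ _ (fun x => 1 + f x ^+ 2)) => //.
  move=> x; have := sqr_ge0 (`|f x| - 1); rewrite -[f x ^+ 2]real_normK ?num_real//.
  by have := sqr_ge0 `|f x|; nra.
apply: locally_integrableD; last exact: Int_locally_integrable.
by apply: continuous_locally_integrable => x; exact: cvg_cst.
Qed.

(** Domination is available only for bounds that hold everywhere; setting [f] to [0] where the bound
    fails changes it on a null set. *)
Lemma ae_bounded_truncation f g : measurable_fun [set: R] f -> Int g ->
  {ae mu, forall x, `|f x| <= g x} ->
  Int f /\ \int[mu]_x f x <= \int[mu]_x `|g x|.
Proof.
move=> mf gi fg; have mg := Int_measurable gi.
pose h x := if `|f x| <= g x then f x else 0.
have fh : {ae mu, forall x, h x = f x} by apply: ae_mono fg _ => x; rewrite /h => ->.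
have mh : measurable_fun [set: R] h.
  by apply: measurable_fun_ifT => //; apply: measurable_fun_ler => //; exact: measurableT_comp.
have hg x : `|h x| <= `|g x|.
  rewrite /h; case: ifPn => [fgx|_]; last by rewrite normr0.
  by rewrite (le_trans fgx)// ler_norm.
have hi : Int h by exact: Int_le mh hg (Int_norm gi).
split; first exact: Int_ae_eq mf fh hi.
rewrite -(Rintegral_ae_eq mh mf fh); apply: le_Rintegral => //; first exact: Int_norm.
by move=> x _; exact: le_trans (ler_norm _) (hg x).
Qed.

Lemma geometric_increments_cvg (F : nat -> R) (t : R) : 0 <= t ->
  (forall n, `|F n.+1 - F n| <= t * (1 / 2) ^+ n) ->
  exists2 l : R, F n @[n --> \oo] --> l &
    forall n, `|l - F n| <= 2 * t * (1 / 2) ^+ n.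
Proof.
move=> t0 dF; pose a n := F n.+1 - F n.
have tele n k : F (k + n)%N = F k + \sum_(0 <= i < n) a (k + i)%N.
  elim: n => [|n IH]; first by rewrite addn0 big_nil addr0.
  by rewrite big_nat_recr//= addrA -IH /a addnS subrKC.
(* The remaining geometric tail is subtracted so that the induction on [n] closes; it is dropped at
   the end. *)
have bound n k : `|F (k + n)%N - F k| <= 2 * t * (1 / 2) ^+ k - 2 * t * (1 / 2) ^+ (k + n).
  elim: n => [|n IH]; first by rewrite addn0 !subrr normr0.
  rewrite addnS -(subrKA (F (k + n)%N)) (le_trans (ler_normD _ _))//.
  by have := dF (k + n)%N; rewrite exprS; move: IH; lra.
have cs : cvgn (series a).
  apply: normed_cvg.
  apply: (@series_le_cvg _ _ (geometric t (1 / 2))) => //.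
  - by move=> n /=; exact: normr_ge0.
  - by move=> n /=; rewrite mulr_ge0// exprn_ge0.
  - by apply: is_cvg_geometric_series; rewrite ger0_norm; lra.
have cF : F n @[n --> \oo] --> F 0%N + limn (series a).
  have FE n : F n = F 0%N + series a n by rewrite -{1}(add0n n) tele seriesEnat.
  have h : (fun n => F 0%N + series a n) @ \oo --> F 0%N + limn (series a).
    by apply: cvgD; [exact: cvg_cst|exact: cs].
  by apply: cvg_trans h; apply: near_eq_cvg; apply: nearW => n; exact/esym/FE.
exists (F 0%N + limn (series a)) => // n.
have cn : `|F m - F n| @[m --> \oo] --> `|F 0%N + limn (series a) - F n|.
  by apply: cvg_norm; apply: cvgB => //; exact: cvg_cst.
rewrite -(cvg_lim (@Rhausdorff R) cn); apply: limr_le.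
  by apply/cvg_ex; eexists; exact: cn.
near=> m; have nm : (n <= m)%N by near: m; exact: nbhs_infty_ge.
rewrite -(subnKC nm) (le_trans (bound _ _))// gerBl.
by rewrite !mulr_ge0// exprn_ge0.
Unshelve. all: by end_near. Qed.

Lemma exprn_quarter_le n : (1 / 4) ^+ n <= (1 / 2) ^+ n :> R.
Proof. by apply: lerXn2r; rewrite ?nnegrE; lra. Qed.

(* With [S = sum 4^n (F (n+1) - F n)^2], which is integrable, the increments of
   [F] are bounded pointwise by [sqrt S / 2^n]. *)
Lemma sq_integrable_complete (F : nat -> R -> R) :
  (forall n, sq_integrable (F n)) ->
  (forall n, \int[mu]_x (F n.+1 x - F n x) ^+ 2 <= (1 / 16) ^+ n) ->
  exists2 f, sq_integrable f &
    exists K, forall n, \int[mu]_x (f x - F n x) ^+ 2 <= K * (1 / 2) ^+ n.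
Proof.
move=> F2 dF.
have dF2 n : sq_integrable (fun x => F n.+1 x - F n x) by exact: sq_integrableB.
pose d n x : R := 4 ^+ n * (F n.+1 x - F n x) ^+ 2.
have d0 n x : 0 <= d n x by rewrite /d mulr_ge0 ?sqr_ge0// exprn_ge0.
have di n : Int (d n) by apply: IntZ; case: (dF2 n).
have md n : measurable_fun [set: R] (EFin \o d n) by apply/measurable_EFinP; exact: Int_measurable (di n).
pose S x : \bar R := (\sum_(n <oo) (d n x)%:E)%E.
have S0 x : (0 <= S x)%E by apply: nneseries_ge0 => n _ _; rewrite lee_fin.
have mS : measurable_fun [set: R] S.
  apply: ge0_emeasurable_sum => [k x _ _|k _]; last exact: md.
  by rewrite lee_fin.
have iS : (\int[mu]_x S x < +oo)%E.
  rewrite /S integral_nneseries//; last by move=> n x _; rewrite lee_fin.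
  apply: (@le_lt_trans _ _ (\sum_(n <oo) ((1 / 4) ^+ n)%:E)%E).
    apply: lee_nneseries => [n _ _|n _]; first by apply: integral_ge0 => x _; rewrite lee_fin.
    have := dF n; have ifin := integrable_fin_num measurableT (di n).
    rewrite -[X in (X <= _)%E](fineK ifin).
    rewrite lee_fin -/(Rintegral mu setT (d n)) RintegralZl//; last by case: (dF2 n).
    (* The weight [4 ^ n] still leaves the summable bound [(1 / 4) ^ n]. *)
    move=> h; apply: (@le_trans _ _ (4 ^+ n * (1 / 16) ^+ n)).
      by rewrite ler_wpM2l ?exprn_ge0.
    by rewrite -exprMn lerXn2r ?nnegrE; lra.
  have cg : series (geometric 1 (1 / 4 : R)) n @[n --> \oo] --> 1 * (1 - 1 / 4 : R)^-1.
    by apply: cvg_geometric_series; rewrite ger0_norm; lra.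
  have -> : (\sum_(n <oo) ((1 / 4) ^+ n)%:E)%E = (1 * (1 - 1 / 4 : R)^-1)%:E.
    apply/cvg_lim => //; rewrite (_ : (fun n => _) = EFin \o series (geometric 1 (1 / 4 : R))).
      by apply: cvg_EFin => //; exact: nearW.
    apply/funext => n /=; rewrite sumEFin seriesEnat; congr EFin.
    by rewrite /=; apply: eq_bigr => i _; exact/esym/mul1r.
  exact: ltry.
have SI : mu.-integrable [set: R] S.
  apply/integrableP; split=> //; apply: le_lt_trans iS.
  by under eq_integral do rewrite gee0_abs//.
pose s x := fine (S x).
have si : Int s.
  have := integrable_ae measurableT SI => aS.
  apply/integrableP; split.
    by apply/measurable_EFinP; exact: measurableT_comp.
  move/integrableP: SI => [_]; apply: le_lt_trans.
  apply: ge0_le_integral => //.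
  - by apply: measurableT_comp => //; apply/measurable_EFinP; exact: measurableT_comp.
  - exact: measurableT_comp.
  - move=> x _ /=; rewrite /s gee0_abs//.
    by case: (S x) (S0 x) => [r|//|//] r0; rewrite /= ?normr0 ?leey// ger0_norm.
have s0 x : 0 <= s x by rewrite fine_ge0.
have goodx : {ae mu, forall x, exists2 l : R, F n x @[n --> \oo] --> l &
    forall n, `|l - F n x| <= 2 * Num.sqrt (s x) * (1 / 2) ^+ n}.
  apply: ae_mono (integrable_ae measurableT SI) _ => x /(_ I) fS.
  apply: geometric_increments_cvg; first exact: sqrtr_ge0.
  move=> n; rewrite -ler_sqr ?nnegrE ?mulr_ge0 ?sqrtr_ge0 ?exprn_ge0//.
  rewrite exprMn sqr_sqrtr// real_normK ?num_real// -exprM mulnC exprM.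
  have h4 : (1 / 2 : R) ^+ 2 = 4^-1 by field.
  rewrite h4 exprVn ler_pdivlMr ?exprn_gt0// mulrC.
  rewrite -lee_fin /s fineK//.
  apply: le_trans (nneseries_lim_ge n.+1 _) => [|k _]; last by rewrite lee_fin.
  rewrite big_nat_recr//= leeDr//; apply: sume_ge0 => k _; by rewrite lee_fin.
(* The upper limit is defined and measurable everywhere, and equals the limit wherever the sequence
   converges. *)
pose f x := fine (limn_esup (fun n => (F n x)%:E)).
have mf : measurable_fun [set: R] f.
  apply: measurableT_comp => //; apply: measurable_fun_limn_esup => n.
  by apply/measurable_EFinP; case: (F2 n).
have fE : {ae mu, forall x n, `|f x - F n x| <= 2 * Num.sqrt (s x) * (1 / 2) ^+ n}.
  apply: ae_mono goodx _ => x [l cl bl] n.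
  have cE : (F n x)%:E @[n --> \oo] --> l%:E by apply: cvg_EFin => //; exact: nearW.
  by rewrite /f is_cvg_limn_esupE ?(cvg_lim _ cE)//; apply/cvg_ex; exists l%:E.
have fn n : {ae mu, forall x, `|(f x - F n x) ^+ 2| <= 4 * (1 / 4) ^+ n * s x}.
  apply: ae_mono fE _ => x /(_ n) h.
  rewrite normrX; apply: (@le_trans _ _ ((2 * Num.sqrt (s x) * (1 / 2) ^+ n) ^+ 2)).
    by rewrite lerXn2r ?nnegrE// !mulr_ge0 ?sqrtr_ge0 ?exprn_ge0.
  have h4 : (1 / 4 : R) ^+ n = ((1 / 2) ^+ n) ^+ 2.
    by rewrite -exprM mulnC exprM; congr (_ ^+ n); field.
  by rewrite h4 -[in leRHS](sqr_sqrtr (s0 x)) le_eqVlt; apply/orP; left; apply/eqP; ring.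
have mfF n : measurable_fun [set: R] (fun x => f x - F n x).
  by apply: measurable_funB => //; case: (F2 n).
have trunc n := ae_bounded_truncation (measurable_funX 2 (mfF n)) (IntZ _ si) (fn n).
have f2 : sq_integrable f.
  have h : sq_integrable (fun x => f x - F 0%N x) by split => //; case: (trunc 0%N).
  have := sq_integrableD h (F2 0%N).
  by congr sq_integrable; apply/funext => x; rewrite subrK.
exists f => //; exists (4 * \int[mu]_x s x) => n.
have [_] := trunc n; move/le_trans; apply.
have -> : \int[mu]_x `|4 * (1 / 4) ^+ n * s x| = 4 * (1 / 4) ^+ n * \int[mu]_x s x.
  rewrite -RintegralZl//; apply: eq_Rintegral => x _.
  by rewrite ger0_norm// !mulr_ge0// exprn_ge0.
rewrite mulrAC ler_wpM2l//; first by rewrite mulr_ge0//; exact: Rintegral_ge0.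
exact: exprn_quarter_le.
Qed.

Definition dot f g : R := \int[mu]_x (f x * g x).

Lemma dotC f g : dot f g = dot g f.
Proof. by apply: eq_Rintegral => x _; rewrite mulrC. Qed.

Lemma dotDl f g h : sq_integrable f -> sq_integrable g -> sq_integrable h ->
  dot (fun x => f x + g x) h = dot f h + dot g h.
Proof.
move=> f2 g2 h2; rewrite /dot -RintegralD//; try exact: sq_integrable_Int_mul.
by apply: eq_Rintegral => x _; rewrite mulrDl.
Qed.

Lemma dotZl f g (a : R) : sq_integrable f -> sq_integrable g ->
  dot (fun x => a * f x) g = a * dot f g.
Proof.
move=> f2 g2; rewrite /dot -RintegralZl//; last exact: sq_integrable_Int_mul.
by apply: eq_Rintegral => x _; rewrite mulrA.
Qed.

Lemma dot_ge0 f : 0 <= dot f f.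
Proof. by apply: Rintegral_ge0 => x _; rewrite -expr2 sqr_ge0. Qed.

End SquareIntegrable.

(** * The adjoint estimate *)

Section AdjointEstimate.
Context {R : realType}.

(* [c], [H] play the roles of the profile and of [h (vhat) / vhat ^ (gamma + 1)],
   and [q] is the derivative of [1 / c]. *)
Record shock_coefficients (c q q1 H H1 : R -> R) (K : R) : Prop :=
  ShockCoefficients {
  coef_K_ge1 : 1 <= K;
  coef_c_gt0 : forall x, 0 < c x;
  coef_c_le : forall x, c x <= K;
  coef_cV_le : forall x, (c x)^-1 <= K;
  coef_H_le : forall x, `|H x| <= K;
  coef_q_le : forall x, `|q x| <= K;
  coef_H1_le : forall x, `|H1 x| <= K;
  coef_dc : forall x : R, is_derive x (1 : R) c (- q x * c x ^+ 2);
  coef_dq : forall x : R, is_derive x (1 : R) q (q1 x);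
  coef_dH : forall x : R, is_derive x (1 : R) H (H1 x);
  coef_q1_continuous : continuous q1;
  coef_H1_continuous : continuous H1;
  coef_q_ge0 : forall x, 0 <= q x;
  coef_q1_le_H1 : forall x, q1 x <= H1 x }.

Lemma is_derive_coef_cV c q q1 H H1 K (x : R) : shock_coefficients c q q1 H H1 K ->
  is_derive x (1 : R) (fun t => (c t)^-1) (q x).
Proof.
move=> coef; have c0 : c x != 0 by rewrite gt_eqF// (coef_c_gt0 coef).
apply: is_derive1_ext (is_derive1V (coef_dc coef x) c0) _.
by rewrite -mulNr opprK mulfK// expf_neq0.
Qed.

Lemma young (x y k : R) : 0 < k -> x * y <= k * x ^+ 2 + y ^+ 2 / (4 * k).
Proof.
move=> k0; rewrite -subr_ge0.
have -> : k * x ^+ 2 + y ^+ 2 / (4 * k) - x * y = (2 * k * x - y) ^+ 2 / (4 * k).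
  by field; rewrite gt_eqF.
by rewrite divr_ge0 ?sqr_ge0// mulr_ge0// ltW.
Qed.

Lemma sqrD_le (x y : R) : (x + y) ^+ 2 <= 2 * (x ^+ 2 + y ^+ 2).
Proof. by rewrite -subr_ge0 (_ : _ - _ = (x - y) ^+ 2) ?sqr_ge0//; ring. Qed.

Lemma sqrDB_le (x y z : R) : (x + y - z) ^+ 2 <= 3 * (x ^+ 2 + y ^+ 2 + z ^+ 2).
Proof.
rewrite -subr_ge0 (_ : _ - _ = (x - y) ^+ 2 + (x + z) ^+ 2 + (y + z) ^+ 2); last by ring.
by rewrite !addr_ge0 ?sqr_ge0.
Qed.

(** Pointwise derivative of the adjoint energy, with [D] for [(H - q)']. For [r1 = r2 = r3 = 0] one
    has [P = s' / c], and without the terms in [eps] there remains [s' ^ 2 / c + (2 lambda + (D +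
    lambda q) / 2) s ^ 2], the counterpart of [- E'] with [s] for [S]. *)
Definition adjoint_density (lambda eps c q H D al ka s P r1 r2 r3 : R) : R :=
  c * P ^+ 2 + (2 * lambda + lambda * q / 2 + D / 2) * s ^+ 2
  - c * P * (r2 + r3) - lambda ^+ 2 * al * r1 + lambda * (r1 + r2) * s
  + eps * (lambda * ka ^+ 2 + H * s * ka - ka * r3).

(** Up to squares of the [r]'s, the density controls [P], [s] and [ka]. Then [al] is recovered from
    the formula for [P], and [be] from that for [s], with the bounds on [1 / c], [H] and [q]. *)
Lemma adjoint_density_coercive (lambda K : R) : 0 < lambda -> 1 <= K ->
  let eps := lambda ^+ 2 / K ^+ 2 in
  exists C1 C2 : R, 0 <= C1 /\ 0 <= C2 /\
  forall c q H D al be ka s P r1 r2 r3 : R,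
  0 < c -> c <= K -> c^-1 <= K -> `|H| <= K -> 0 <= q -> q <= K -> 0 <= D ->
  s = c * (be + ka) -> P = lambda * (ka - al) + (H - 1 - q) * s ->
  al ^+ 2 + be ^+ 2 + ka ^+ 2 <=
    C1 * adjoint_density lambda eps c q H D al ka s P r1 r2 r3
    + C2 * (r1 ^+ 2 + r2 ^+ 2 + r3 ^+ 2).
Proof.
move=> l0 K1 eps; have K0 : 0 < K by lra.
have e0 : 0 < eps by rewrite divr_gt0// exprn_gt0.
(* With [G] the controlled part introduced below, [A G] bounds [al ^ 2] and [B G] the whole
   left-hand side; the [3] and the [2] in them come from squaring a sum of three or two terms. [R0]
   gathers the coefficients left on the [r]'s by Young's inequality. *)
pose A := 3 * (2 / (eps * lambda) + 9 * K ^+ 2 / lambda ^+ 3 + K / lambda ^+ 2).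
have t1 : 0 < 2 / (eps * lambda) by rewrite divr_gt0// mulr_gt0.
have t2 : 0 < 9 * K ^+ 2 / lambda ^+ 3 by rewrite divr_gt0 ?exprn_gt0// mulr_gt0// exprn_gt0.
have t3 : 0 < K / lambda ^+ 2 by rewrite divr_gt0// exprn_gt0.
have A0 : 0 < A by rewrite /A; lra.
pose B := A + 2 * K ^+ 2 / lambda + 3 * (2 / (eps * lambda)).
have B0 : 0 < B.
  have : 0 < 2 * K ^+ 2 / lambda by rewrite divr_gt0// mulr_gt0// exprn_gt0.
  by rewrite /B; lra.
pose R0 := 2 * K + A * lambda ^+ 4 + 2 * lambda + 2 * eps / lambda.
have R00 : 0 < R0.
  have : 0 < A * lambda ^+ 4 by rewrite mulr_gt0// exprn_gt0.
  have : 0 < 2 * eps / lambda by rewrite divr_gt0// mulr_gt0.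
  by rewrite /R0; lra.
exists (2 * B), (2 * B * R0); split; first by rewrite mulr_ge0// ltW.
split; first by rewrite !mulr_ge0// ltW.
move=> c q H D al be ka s P r1 r2 r3 c0 cK cVK HK q0 qK D0 sE PE.
(* What remains of the diagonal terms once [eps H s ka] is absorbed, using half of the [ka ^ 2] term
   and one of the two [lambda s ^ 2]. The products with the [r]'s then cost at most another half of
   [G]. *)
pose G := c * P ^+ 2 + lambda * s ^+ 2 + eps * lambda / 2 * ka ^+ 2.
have cP0 : 0 <= c * P ^+ 2 by rewrite mulr_ge0 ?sqr_ge0// ltW.
have ls0 : 0 <= lambda * s ^+ 2 by rewrite mulr_ge0 ?sqr_ge0// ltW.
have ek0 : 0 <= eps * lambda / 2 * ka ^+ 2.
  by rewrite mulr_ge0 ?sqr_ge0// divr_ge0// mulr_ge0// ltW.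
have kaG : ka ^+ 2 <= 2 / (eps * lambda) * G.
  rewrite (_ : ka ^+ 2 = 2 / (eps * lambda) * (eps * lambda / 2 * ka ^+ 2)).
    by rewrite ler_pM2l// /G; clear - cP0 ls0 ek0; lra.
  by field; rewrite ?gt_eqF.
have sG : s ^+ 2 <= G / lambda by rewrite ler_pdivlMr// /G; clear - cP0 ls0 ek0; lra.
have PG : P ^+ 2 <= K * G.
  apply: (@le_trans _ _ (K * (c * P ^+ 2))); last by rewrite ler_pM2l// /G; clear - cP0 ls0 ek0; lra.
  rewrite mulrA ler_peMl ?sqr_ge0//.
  by rewrite -ler_pdivrMr// mul1r.
have H1q : (H - 1 - q) ^+ 2 <= 9 * K ^+ 2.
  have -> : 9 * K ^+ 2 = (3 * K) ^+ 2 by ring.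
  have h : `|H - 1 - q| <= 3 * K.
    move: HK; rewrite ler_norml => /andP[h1 h2]; rewrite ler_norml.
    by clear - h1 h2 q0 qK K1; apply/andP; split; lra.
  by rewrite -[leLHS]real_normK ?num_real// lerXn2r ?nnegrE// (le_trans (normr_ge0 _) h).
have alG : al ^+ 2 <= A * G.
  have -> : al = ka + (H - 1 - q) * s / lambda - P / lambda.
    by rewrite PE; field; rewrite gt_eqF.
  have h1 : ((H - 1 - q) * s / lambda) ^+ 2 <= 9 * K ^+ 2 / lambda ^+ 3 * G.
    rewrite (_ : _ * G = 9 * K ^+ 2 * (G / lambda) / lambda ^+ 2); last by field; rewrite gt_eqF.
    rewrite exprMn exprVn ler_pM2r ?invr_gt0 ?exprn_gt0// exprMn.
    by rewrite ler_pM ?sqr_ge0.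
  have h2 : (P / lambda) ^+ 2 <= K / lambda ^+ 2 * G.
    by rewrite exprMn exprVn [leRHS]mulrAC ler_pM2r ?invr_gt0 ?exprn_gt0.
  apply: le_trans (sqrDB_le _ _ _) _.
  have -> : A * G = 3 * (2 / (eps * lambda) * G + 9 * K ^+ 2 / lambda ^+ 3 * G
      + K / lambda ^+ 2 * G) by rewrite /A; ring.
  by rewrite ler_pM2l// lerD// lerD.
have beG : be ^+ 2 <= 2 * K ^+ 2 * (G / lambda) + 2 * ka ^+ 2.
  have -> : be = c^-1 * s - ka by rewrite sE; field; rewrite gt_eqF.
  have h : (c^-1 * s) ^+ 2 <= K ^+ 2 * (G / lambda).
    rewrite exprMn ler_pM ?sqr_ge0// lerXn2r ?nnegrE ?invr_ge0// ltW//.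
  apply: le_trans (sqrD_le _ _) _; rewrite sqrrN mulrDr lerD2r.
  by rewrite -mulrA ler_pM2l.
have allG : al ^+ 2 + be ^+ 2 + ka ^+ 2 <= B * G.
  rewrite (_ : B * G = A * G + 2 * K ^+ 2 * (G / lambda) + 3 * (2 / (eps * lambda) * G)).
    by clear - alG beG kaG; lra.
  by rewrite /B; field; rewrite ?gt_eqF.
set Q := adjoint_density _ _ _ _ _ _ _ _ _ _ _ _ _.
set rho := r1 ^+ 2 + r2 ^+ 2 + r3 ^+ 2.
suff QG : G <= 2 * Q + 2 * R0 * rho.
  apply: le_trans allG _; rewrite (_ : _ + _ = B * (2 * Q + 2 * R0 * rho)); last by ring.
  by rewrite ler_pM2l.
have y1 : c * P * (r2 + r3) <= c * P ^+ 2 / 4 + 2 * K * (r2 ^+ 2 + r3 ^+ 2).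
  have h := @young P (r2 + r3) (1 / 4) ltac:(by rewrite divr_gt0).
  have h' : c * (P * (r2 + r3)) <= c * (1 / 4 * P ^+ 2 + (r2 + r3) ^+ 2 / (4 * (1 / 4))).
    by rewrite ler_pM2l.
  have h2 : c * (r2 + r3) ^+ 2 <= K * (2 * (r2 ^+ 2 + r3 ^+ 2)).
    by rewrite ler_pM ?sqr_ge0 ?(ltW c0)// sqrD_le.
  move: h'; rewrite (_ : (r2 + r3) ^+ 2 / (4 * (1 / 4)) = (r2 + r3) ^+ 2); last by field.
  by clear - h2; lra.
have y2 : lambda ^+ 2 * al * r1 <= G / 4 + A * lambda ^+ 4 * r1 ^+ 2.
  have A4 : 0 < (4 * A)^-1 by rewrite invr_gt0 mulr_gt0.
  have := @young al (lambda ^+ 2 * r1) _ A4.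
  rewrite (_ : (lambda ^+ 2 * r1) ^+ 2 / _ = A * lambda ^+ 4 * r1 ^+ 2); last by field; rewrite gt_eqF.
  have h : (4 * A)^-1 * al ^+ 2 <= G / 4.
    rewrite (_ : G / 4 = (4 * A)^-1 * (A * G)); last by field; rewrite gt_eqF.
    by rewrite ler_pM2l.
  by clear - h; lra.
have y3 : - (lambda * (r1 + r2) * s) <= lambda * s ^+ 2 / 4 + 2 * lambda * (r1 ^+ 2 + r2 ^+ 2).
  have h := @young s (- (r1 + r2)) (1 / 4) ltac:(by rewrite divr_gt0).
  have h' : lambda * (s * - (r1 + r2)) <= lambda * (1 / 4 * s ^+ 2 + (- (r1 + r2)) ^+ 2 / (4 * (1 / 4))).
    by rewrite ler_pM2l.
  have h2 : lambda * (r1 + r2) ^+ 2 <= lambda * (2 * (r1 ^+ 2 + r2 ^+ 2)).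
    by rewrite ler_pM2l// sqrD_le.
  move: h'; rewrite (_ : (- (r1 + r2)) ^+ 2 / (4 * (1 / 4)) = (r1 + r2) ^+ 2); last by field.
  by clear - h2; lra.
have y4 : eps * (ka * r3) <= eps * lambda / 2 * ka ^+ 2 / 4 + 2 * eps / lambda * r3 ^+ 2.
  have h := @young ka r3 (lambda / 8) ltac:(by rewrite divr_gt0).
  have : eps * (ka * r3) <= eps * (lambda / 8 * ka ^+ 2 + r3 ^+ 2 / (4 * (lambda / 8))).
    by rewrite ler_pM2l.
  rewrite (_ : r3 ^+ 2 / (4 * (lambda / 8)) = 2 / lambda * r3 ^+ 2); last by field; rewrite gt_eqF.
  by clear; lra.
(* The choice [eps = lambda ^ 2 / K ^ 2] serves here: Young's inequality leaves
   [eps K ^ 2 / (2 lambda) s ^ 2], which is [lambda s ^ 2 / 2]. *)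
have y5 : - (eps * (H * s * ka)) <= eps * lambda / 2 * ka ^+ 2 + lambda * s ^+ 2.
  have h := @young ka (- (H * s)) (lambda / 2) ltac:(by rewrite divr_gt0).
  have : eps * (ka * - (H * s)) <= eps * (lambda / 2 * ka ^+ 2 + (- (H * s)) ^+ 2 / (4 * (lambda / 2))).
    by rewrite ler_pM2l.
  rewrite (_ : (- (H * s)) ^+ 2 / (4 * (lambda / 2)) = (H ^+ 2 * s ^+ 2) / (2 * lambda)); last by field; rewrite gt_eqF.
  have h2 : eps * ((H ^+ 2 * s ^+ 2) / (2 * lambda)) <= lambda * s ^+ 2.
    apply: (@le_trans _ _ (eps * ((K ^+ 2 * s ^+ 2) / (2 * lambda)))).
      rewrite ler_pM2l// ler_pM2r ?invr_gt0 ?mulr_gt0//.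
      rewrite ler_wpM2r ?sqr_ge0// -[leLHS]real_normK ?num_real//.
      by rewrite lerXn2r ?nnegrE// ltW.
    rewrite (_ : _ * (_ / _) = lambda * s ^+ 2 / 2); last first.
      by rewrite /eps; field; rewrite !gt_eqF.
    by clear - ls0; lra.
  by clear - h2; lra.
have q2 : 0 <= (lambda * q / 2 + D / 2) * s ^+ 2.
  by rewrite mulr_ge0 ?sqr_ge0// addr_ge0// divr_ge0// mulr_ge0// ltW.
have rr : 2 * K * (r2 ^+ 2 + r3 ^+ 2) + A * lambda ^+ 4 * r1 ^+ 2
   + 2 * lambda * (r1 ^+ 2 + r2 ^+ 2) + 2 * eps / lambda * r3 ^+ 2 <= R0 * rho.
  have p1 : 0 <= A * lambda ^+ 4 by rewrite mulr_ge0 ?exprn_ge0// ltW.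
  have p2 : 0 <= 2 * eps / lambda.
    by apply: divr_ge0; [apply: mulr_ge0 => //; apply: ltW|apply: ltW].
  have := sqr_ge0 r1; have := sqr_ge0 r2; have := sqr_ge0 r3.
  rewrite /R0 /rho; move: (r1 ^+ 2) (r2 ^+ 2) (r3 ^+ 2) => x y z z0 y0 x0.
  move: (A * lambda ^+ 4) (2 * eps / lambda) p1 p2 => a b a0 b0.
  have := mulr_ge0 (ltW K0) x0; have := mulr_ge0 a0 y0; have := mulr_ge0 a0 z0.
  have := mulr_ge0 b0 x0; have := mulr_ge0 b0 y0; have := mulr_ge0 (ltW l0) z0.
  by clear; lra.
rewrite /Q /adjoint_density; move: y1 y2 y3 y4 y5 q2 rr; rewrite /G; clear; lra.
Qed.

End AdjointEstimate.

Section AdjointSystem.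
Context {R : realType}.
Local Notation mu := (@lebesgue_measure R).
Local Notation Int f := (mu.-integrable [set: R] (EFin \o f)).
Implicit Types (c q H f g w u v : R -> R) (K lambda : R).

Definition C1_test (eta eta1 : R -> R) : Prop :=
  [/\ forall x : R, is_derive x (1 : R) eta (eta1 x), continuous eta1 &
   exists M : R, forall x, M < `|x| -> eta x = 0 /\ eta1 x = 0].

Lemma C1_test0 : C1_test (cst 0) (cst 0).
Proof.
split=> [x||]; first exact: is_derive1_cst.
  by move=> x; exact: cvg_cst.
by exists 0.
Qed.

Lemma C1_test_lin a eta eta1 phi phi1 : C1_test eta eta1 -> C1_test phi phi1 ->
  C1_test (fun x => eta x + a * phi x) (fun x => eta1 x + a * phi1 x).
Proof.
move=> [de ce [M eM]] [dp cp [N pN]]; split.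
- by move=> x; apply: is_derive1D => //; exact: is_derive1Z.
- by move=> x; apply: cvgD; [exact: ce|apply: cvgM; [exact: cvg_cst|exact: cp]].
- exists (Num.max M N) => x; rewrite gt_max => /andP[/eM[-> ->] /pN[-> ->]].
  by rewrite mulr0 addr0.
Qed.

Lemma test_function_C1 phi : test_function phi -> C1_test phi (derive1 phi).
Proof.
move=> tphi; have sphi := test_function_smooth tphi.
have tphi' := test_function_derive1 tphi.
have [M M0 phiM] := test_function_csupp tphi.
have [M' M'0 phiM'] := test_function_csupp tphi'.
split.
- by move=> x; apply: is_derive_derive1; apply: (sphi 0%N).
- by apply: smooth_continuous; exact: test_function_smooth.
- by exists (Num.max M M') => x; rewrite gt_max => /andP[/phiM -> /phiM' ->].
Qed.

Lemma continuous_csupp_sq f : continuous f ->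
  (exists M : R, forall x, M < `|x| -> f x = 0) -> sq_integrable f.
Proof.
move=> cf [M fM]; apply: (@sq_integrable_csupp _ (- M) M) => // x hx.
by apply: fM; rewrite ltr_normr; case: hx => ?; apply/orP; [right|left]; lra.
Qed.

Lemma C1_test_sq eta eta1 : C1_test eta eta1 -> sq_integrable eta.
Proof.
move=> [de _ [M eM]]; apply: continuous_csupp_sq; first exact: is_derive_continuous de.
by exists M => x /eM[].
Qed.

(* Formal adjoint of [Z |-> Z' - A Z], where [Z = (w, u, v)] solves
   [w' = lambda u], [u' = c (w + u - H v)], [v' = u' - lambda v]. *)
Definition adj1 c (be ka al1 : R -> R) x : R := - al1 x - c x * (be x + ka x).
Definition adj2 c lambda (al be ka be1 : R -> R) x : R :=
  - be1 x - lambda * al x - c x * (be x + ka x).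
Definition adj3 c H lambda (be ka ka1 : R -> R) x : R :=
  - ka1 x + c x * H x * (be x + ka x) + lambda * ka x.

(** The energy [F] has compact support, so its derivative [Q] integrates to zero; integrating the
    pointwise coercivity leaves only the squares of [r1], [r2], [r3], with constant [C2]. *)
Lemma adjoint_estimate c q q1 H H1 K lambda :
  shock_coefficients c q q1 H H1 K -> 0 < lambda ->
  exists C : R, 0 <= C /\ forall al al1 be be1 ka ka1,
   C1_test al al1 -> C1_test be be1 -> C1_test ka ka1 ->
   let r1 := adj1 c be ka al1 in
   let r2 := adj2 c lambda al be ka be1 in
   let r3 := adj3 c H lambda be ka ka1 in
   [/\ sq_integrable r1, sq_integrable r2, sq_integrable r3 &
    dot al al + dot be be + dot ka ka <= C * (dot r1 r1 + dot r2 r2 + dot r3 r3)].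
Proof.
move=> coef l0; have := adjoint_density_coercive l0 (coef_K_ge1 coef).
set eps := _ / _; move=> [C1 [C2 [C10 [C20 coer]]]].
exists C2; split=> // al al1 be be1 ka ka1 tal tbe tka r1 r2 r3.
have [dal cal1 [Ma alM]] := tal; have [dbe cbe1 [Mb beM]] := tbe.
have [dka cka1 [Mk kaM]] := tka.
pose M := Num.max Ma (Num.max Mb Mk).
have out x : M < `|x| -> [/\ al x = 0 /\ al1 x = 0, be x = 0 /\ be1 x = 0 & ka x = 0 /\ ka1 x = 0].
  by rewrite /M !gt_max => /andP[/alM ? /andP[/beM ? /kaM ?]].
have cc := is_derive_continuous (coef_dc coef).
have cH := is_derive_continuous (coef_dH coef).
have cq := is_derive_continuous (coef_dq coef).
have cal := is_derive_continuous dal; have cbe := is_derive_continuous dbe.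
have cka := is_derive_continuous dka.
have cr1 : continuous r1.
  move=> x; apply: cvgB; first by apply: cvgN; exact: cal1.
  by apply: cvgM; [exact: cc|apply: cvgD; [exact: cbe|exact: cka]].
have cr2 : continuous r2.
  move=> x; apply: cvgB; last by apply: cvgM; [exact: cc|apply: cvgD; [exact: cbe|exact: cka]].
  apply: cvgB; first by apply: cvgN; exact: cbe1.
  by apply: cvgM; [exact: cvg_cst|exact: cal].
have cr3 : continuous r3.
  move=> x; apply: cvgD; last by apply: cvgM; [exact: cvg_cst|exact: cka].
  apply: cvgD; first by apply: cvgN; exact: cka1.
  by apply: cvgM; [apply: cvgM; [exact: cc|exact: cH]|apply: cvgD; [exact: cbe|exact: cka]].
have r1out x : M < `|x| -> r1 x = 0.
  by move=> /out[[_ al1x] [bx _] [kx _]]; rewrite /r1 /adj1 al1x bx kx; ring.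
have r2out x : M < `|x| -> r2 x = 0.
  by move=> /out[[ax _] [bx bx1] [kx _]]; rewrite /r2 /adj2 ax bx bx1 kx; ring.
have r3out x : M < `|x| -> r3 x = 0.
  by move=> /out[_ [bx _] [kx kx1]]; rewrite /r3 /adj3 bx kx kx1; ring.
have sr1 : sq_integrable r1 by apply: continuous_csupp_sq => //; exists M.
have sr2 : sq_integrable r2 by apply: continuous_csupp_sq => //; exists M.
have sr3 : sq_integrable r3 by apply: continuous_csupp_sq => //; exists M.
split=> //.
pose s x := c x * (be x + ka x).
(* Adding the second and third adjoint equations gives [s' = c (P - r2 - r3)]. *)
pose P x := lambda * (ka x - al x) + (H x - 1 - q x) * s x.
(* [Q], the density to be integrated, is the derivative of [F], which has compact
   support; the term in [eps] makes the form control [ka]. *)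
pose F x := (H x - 1 - q x) / 2 * (s x * s x) - lambda / 2 * (s x * (be x + ka x))
  + lambda * ((ka x - al x) * s x) + lambda ^+ 2 / 2 * (al x * al x)
  + eps / 2 * (ka x * ka x).
pose Q x := adjoint_density lambda eps (c x) (q x) (H x) (H1 x - q1 x) (al x) (ka x)
  (s x) (P x) (r1 x) (r2 x) (r3 x).
have dsg x : is_derive x (1 : R) (fun x => be x + ka x) (be1 x + ka1 x) by exact: is_derive1D.
have ds x : is_derive x (1 : R) s (c x * (be1 x + ka1 x) + (be x + ka x) * (- q x * c x ^+ 2)).
  by apply: is_derive1M => //; exact: (coef_dc coef).
have dF x : is_derive x (1 : R) F (Q x).
  have dH1q : is_derive x (1 : R) (fun x => (H x - 1 - q x) / 2) ((H1 x - 0 - q1 x) / 2).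
    have h := is_derive1B (is_derive1B (coef_dH coef x) (is_derive1_cst x 1)) (coef_dq coef x).
    have -> : (fun x : R => (H x - 1 - q x) / 2) = (fun x : R => 2^-1 * (H x - 1 - q x)).
      by apply/funext => y; rewrite mulrC.
    by rewrite mulrC; exact: is_derive1Z.
  have h1 := is_derive1M dH1q (is_derive1M (ds x) (ds x)).
  have h2 := is_derive1Z (lambda / 2) (is_derive1M (ds x) (dsg x)).
  have h3 := is_derive1Z lambda (is_derive1M (is_derive1B (dka x) (dal x)) (ds x)).
  have h4 := is_derive1Z (lambda ^+ 2 / 2) (is_derive1M (dal x) (dal x)).
  have h5 := is_derive1Z (eps / 2) (is_derive1M (dka x) (dka x)).
  apply: is_derive1_ext (is_derive1D (is_derive1D (is_derive1D (is_derive1B h1 h2) h3) h4) h5) _.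
  rewrite /Q /adjoint_density /P /s /r1 /r2 /r3 /adj1 /adj2 /adj3.
  have := coef_c_gt0 coef x; move: (c x) => cx cx0.
  by field.
have cs : continuous s.
  by move=> x; apply: cvgM; [exact: cc|apply: cvgD; [exact: cbe|exact: cka]].
have cH1q : continuous (fun x => H x - 1 - q x).
  by move=> x; apply: cvgB; [apply: cvgB; [exact: cH|exact: cvg_cst]|exact: cq].
have cP : continuous P.
  move=> x; apply: cvgD; last by apply: cvgM; [exact: cH1q|exact: cs].
  by apply: cvgM; [exact: cvg_cst|apply: cvgB; [exact: cka|exact: cal]].
have cr23 : continuous (fun x => r2 x + r3 x).
  by move=> x; apply: cvgD; [exact: cr2|exact: cr3].
have cD : continuous (fun x => H1 x - q1 x).
  by move=> x; apply: cvgB; [exact: coef_H1_continuous coef _|exact: coef_q1_continuous coef _].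
have cQ : continuous Q.
  move=> x; rewrite /Q /adjoint_density.
  have kM (a : R) (f : R -> R) : f y @[y --> x] --> f x -> a * f y @[y --> x] --> a * f x.
    by move=> cf; apply: cvgM => //; exact: cvg_cst.
  have X2 (f : R -> R) : f y @[y --> x] --> f x -> f y ^+ 2 @[y --> x] --> f x ^+ 2.
    by move=> cf; rewrite expr2; under eq_fun do rewrite expr2; exact: cvgM.
  apply: cvgD; last first.
    apply: (kM _ (fun x => lambda * ka x ^+ 2 + H x * s x * ka x - ka x * r3 x)).
    apply: cvgB; last by apply: cvgM; [exact: cka|exact: cr3].
    apply: cvgD; first by apply: (kM _ (fun x => ka x ^+ 2)); apply: (X2); exact: cka.
    by apply: cvgM; [apply: cvgM; [exact: cH|exact: cs]|exact: cka].
  apply: cvgD; last first.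
    apply: cvgM; last exact: cs.
    by apply: (kM _ (fun x => r1 x + r2 x)); apply: cvgD; [exact: cr1|exact: cr2].
  apply: cvgB; last by apply: cvgM; [apply: (kM); exact: cal|exact: cr1].
  apply: cvgB; last by apply: cvgM; [apply: cvgM; [exact: cc|exact: cP]|exact: cr23].
  apply: cvgD; first by apply: cvgM; [exact: cc|apply: (X2); exact: cP].
  apply: cvgM; last by apply: (X2); exact: cs.
  apply: cvgD; last by apply: cvgM; [exact: cD|exact: cvg_cst].
  apply: cvgD; first exact: cvg_cst.
  by apply: cvgM; [apply: (kM); exact: cq|exact: cvg_cst].
have sout x : M < `|x| -> s x = 0.
  by move=> /out[_ [bx _] [kx _]]; rewrite /s bx kx; ring.
have Fout x : M < `|x| -> F x = 0.
  move=> Mx; have [[ax _] _ [kx _]] := out x Mx.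
  by rewrite /F (sout x Mx) ax kx; ring.
have Qout x : M < `|x| -> Q x = 0.
  move=> Mx; have [[ax _] _ [kx _]] := out x Mx.
  rewrite /Q /adjoint_density /P (sout x Mx) ax kx (r1out x Mx) (r2out x Mx) (r3out x Mx).
  by ring.
pose M' := `|M| + 1.
have MM' : M < M' by rewrite /M'; have := ler_norm M; lra.
have M'0 : 0 < M' by rewrite /M'; have := normr_ge0 M; lra.
have normM x : x <= - M' \/ M' <= x -> M < `|x|.
  by move=> hx; rewrite ltr_normr; case: hx => ?; apply/orP; [right|left]; lra.
have Q0 : \int[mu]_x Q x = 0.
  apply: (@Rintegral_derivative_csupp _ F Q (- M') M') => //; first by lra.
    by move=> x /normM/Fout.
  by move=> x hx; apply: Qout; apply: normM; case: hx => hx; [left|right]; exact: ltW.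
have iQ : Int Q.
  apply: (@Int_continuous_csupp _ (- M') M') => // x hx.
  by apply: Qout; apply: normM; case: hx => hx; [left|right]; exact: ltW.
have sq (f : R -> R) : sq_integrable f -> Int (fun x => f x ^+ 2) by case.
have sal := C1_test_sq tal; have sbe := C1_test_sq tbe; have ska := C1_test_sq tka.
have dotE (f g h : R -> R) : sq_integrable f -> sq_integrable g -> sq_integrable h ->
    dot f f + dot g g + dot h h = \int[mu]_x (f x ^+ 2 + g x ^+ 2 + h x ^+ 2).
  move=> sf sg sh; rewrite RintegralD//; try exact: sq; last by apply: IntD; exact: sq.
  by rewrite RintegralD//; exact: sq.
rewrite !dotE//.
have ir : Int (fun x => r1 x ^+ 2 + r2 x ^+ 2 + r3 x ^+ 2).
  by apply: IntD; [apply: IntD|]; exact: sq.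
apply: (@le_trans _ _ (\int[mu]_x (C1 * Q x + C2 * (r1 x ^+ 2 + r2 x ^+ 2 + r3 x ^+ 2)))); last first.
  by rewrite RintegralD ?RintegralZl ?Q0 ?mulr0 ?add0r//; exact: IntZ.
apply: le_Rintegral => //.
- by apply: IntD; [apply: IntD|]; exact: sq.
- by apply: IntD; exact: IntZ.
- move=> x _; apply: coer.
  + exact: coef_c_gt0 coef x.
  + exact: coef_c_le coef x.
  + exact: coef_cV_le coef x.
  + exact: coef_H_le coef x.
  + exact: coef_q_ge0 coef x.
  + exact: le_trans (ler_norm _) (coef_q_le coef x).
  + by rewrite subr_ge0; exact: coef_q1_le_H1 coef x.
  + by [].
  + by [].
Qed.

End AdjointSystem.

(** * Existence for the first-order system *)

Section Solvability.
Context {R : realType}.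
Local Notation mu := (@lebesgue_measure R).
Implicit Types (c q H f g w u v : R -> R) (K lambda : R).

Definition flux_rate c H w u v x : R := c x * (w x + u x - H x * v x).

Lemma sq_integrable_flux_rate c q q1 H H1 K w u v :
  shock_coefficients c q q1 H H1 K ->
  sq_integrable w -> sq_integrable u -> sq_integrable v ->
  sq_integrable (flux_rate c H w u v).
Proof.
move=> coef sw su sv.
have mc : measurable_fun [set: R] c.
  by apply: continuous_measurable_fun; exact: is_derive_continuous (coef_dc coef).
have mH : measurable_fun [set: R] H.
  by apply: continuous_measurable_fun; exact: is_derive_continuous (coef_dH coef).
apply: (sq_integrableM_bounded (C := K)) => //.
  by move=> x; rewrite gtr0_norm ?(coef_c_gt0 coef)//; exact: coef_c_le coef x.
apply: sq_integrableB; first exact: sq_integrableD.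
by apply: (sq_integrableM_bounded (C := K)) => //; exact: coef_H_le coef.
Qed.

Lemma sq_integrable_lin f g a : sq_integrable f -> sq_integrable g ->
  sq_integrable (fun x => f x + a * g x).
Proof. by move=> sf sg; apply: sq_integrableD => //; exact: sq_integrableZ. Qed.

Lemma dot_linl f g h a : sq_integrable f -> sq_integrable g -> sq_integrable h ->
  dot (fun x => f x + a * g x) h = dot f h + a * dot g h.
Proof. by move=> sf sg sh; rewrite dotDl ?dotZl//; exact: sq_integrableZ. Qed.

Lemma dot_linr f g h a : sq_integrable f -> sq_integrable g -> sq_integrable h ->
  dot h (fun x => f x + a * g x) = dot h f + a * dot h g.
Proof. by move=> sf sg sh; rewrite dotC dot_linl// (dotC f h) (dotC g h). Qed.

Lemma dot_sqr_lin f g a : sq_integrable f -> sq_integrable g ->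
  dot (fun x => f x + a * g x) (fun x => f x + a * g x) =
  dot f f + 2 * a * dot f g + a ^+ 2 * dot g g.
Proof.
move=> sf sg; have sl := sq_integrable_lin a sf sg.
by rewrite dot_linl// !dot_linr// (dotC g f); ring.
Qed.

Definition triple : Type := (R -> R) * (R -> R) * (R -> R).
Definition triple_L2 (z : triple) : Prop :=
  [/\ sq_integrable z.1.1, sq_integrable z.1.2 & sq_integrable z.2].
Definition triple_lin (a : R) (y z : triple) : triple :=
  (fun x => y.1.1 x + a * z.1.1 x, fun x => y.1.2 x + a * z.1.2 x,
   fun x => y.2 x + a * z.2 x).
Definition triple_dot (y z : triple) : R :=
  dot y.1.1 z.1.1 + dot y.1.2 z.1.2 + dot y.2 z.2.

Lemma triple_complete (F : nat -> triple) : (forall n, triple_L2 (F n)) ->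
  (forall n, triple_dot (triple_lin (-1) (F n.+1) (F n))
     (triple_lin (-1) (F n.+1) (F n)) <= (1 / 16) ^+ n) ->
  exists2 V, triple_L2 V & exists K, forall n,
    triple_dot (triple_lin (-1) V (F n)) (triple_lin (-1) V (F n)) <= K * (1 / 2) ^+ n.
Proof.
move=> LF dF.
have dotsq (f g : R -> R) : \int[mu]_x (f x - g x) ^+ 2 =
    dot (fun x => f x + -1 * g x) (fun x => f x + -1 * g x).
  by apply: eq_Rintegral => x _; ring.
have comp (pr : triple -> R -> R) : (forall n, sq_integrable (pr (F n))) ->
    (forall n, dot (fun x => pr (F n.+1) x + -1 * pr (F n) x)
      (fun x => pr (F n.+1) x + -1 * pr (F n) x) <=
      triple_dot (triple_lin (-1) (F n.+1) (F n)) (triple_lin (-1) (F n.+1) (F n))) ->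
    exists2 f, sq_integrable f & exists K, forall n,
      dot (fun x => f x + -1 * pr (F n) x) (fun x => f x + -1 * pr (F n) x) <= K * (1 / 2) ^+ n.
  move=> Lp dp.
  have [f sf [K fK]] : exists2 f, sq_integrable f &
      exists K, forall n, \int[mu]_x (f x - pr (F n) x) ^+ 2 <= K * (1 / 2) ^+ n.
    apply: sq_integrable_complete => // n; rewrite dotsq.
    exact: le_trans (dp n) (dF n).
  by exists f => //; exists K => n; rewrite -dotsq.
have [||w sw [Kw wK]] := comp (fun z => z.1.1).
- by move=> n; case: (LF n).
- by move=> n; rewrite /triple_dot -addrA lerDl addr_ge0// dot_ge0.
have [||u su [Ku uK]] := comp (fun z => z.1.2).
- by move=> n; case: (LF n).
- by move=> n; rewrite /triple_dot addrAC lerDr addr_ge0// dot_ge0.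
have [||v sv [Kv vK]] := comp (fun z => z.2).
- by move=> n; case: (LF n).
- by move=> n; rewrite /triple_dot lerDr addr_ge0// dot_ge0.
exists (w, u, v) => //; exists (Kw + Ku + Kv) => n.
rewrite /triple_dot !mulrDl; apply: lerD; last exact: vK.
by apply: lerD; [exact: wK|exact: uK].
Qed.

(** Riesz representation of the form that sends the adjoint image of [(al, be, ka)] to the pairing
    of the triple with the data [(- g, 0, f)]. The adjoint estimate bounds this form, and with it
    makes the value independent of the triple chosen; stating it as a graph [G] avoids a separate
    argument for that. *)
Lemma first_order_solvable c q q1 H H1 K lambda :
  shock_coefficients c q q1 H H1 K -> 0 < lambda ->
  exists C : R, 0 <= C /\ forall f g, sq_integrable f -> sq_integrable g ->
  exists w u v,
  [/\ [/\ sq_integrable w, sq_integrable u & sq_integrable v],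
      is_weak_deriv w (fun x => lambda * u x - g x),
      is_weak_deriv u (flux_rate c H w u v),
      is_weak_deriv v (fun x => flux_rate c H w u v x - lambda * v x + f x) &
      dot w w + dot u u + dot v v <= C * (dot f f + dot g g)].
Proof.
move=> coef l0; have [C [C0 est]] := adjoint_estimate coef l0.
exists C; split => // f g sf sg.
pose G (z : triple) (r : R) : Prop := exists al al1 be be1 ka ka1,
  [/\ C1_test al al1, C1_test be be1, C1_test ka ka1,
   z = (adj1 c be ka al1, adj2 c lambda al be ka be1, adj3 c H lambda be ka ka1) &
   r = dot f ka - dot g al].
have N0 : 0 <= C * (dot f f + dot g g) by rewrite mulr_ge0// addr_ge0// dot_ge0.
have [||||||||V [[sw su sv] VG VC]] := @riesz_representation R triple triple_L2 triple_lin
  triple_dot G (C * (dot f f + dot g g)) _ _ _ _ triple_complete _ _ _ N0 _.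
- by move=> a y z [? ? ?] [? ? ?]; split; exact: sq_integrable_lin.
- by move=> y z; rewrite /triple_dot dotC (dotC y.1.2) (dotC y.2).
- move=> a x y z [? ? ?] [? ? ?] [? ? ?]; rewrite /triple_dot /= !dot_linl//; ring.
- by move=> z _; rewrite /triple_dot !addr_ge0// dot_ge0.
- move=> _ _ [al [al1 [be [be1 [ka [ka1 [tal tbe tka -> _]]]]]]].
  by have [? ? ? _] := est _ _ _ _ _ _ tal tbe tka; split.
- move=> a _ _ _ _ [al [al1 [be [be1 [ka [ka1 [tal tbe tka -> ->]]]]]]]
    [al' [al1' [be' [be1' [ka' [ka1' [tal' tbe' tka' -> ->]]]]]]].
  exists (fun x => al x + a * al' x), (fun x => al1 x + a * al1' x).
  exists (fun x => be x + a * be' x), (fun x => be1 x + a * be1' x).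
  exists (fun x => ka x + a * ka' x), (fun x => ka1 x + a * ka1' x).
  split; try exact: C1_test_lin.
    rewrite /triple_lin /adj1 /adj2 /adj3 /=.
    by congr (_, _, _); apply/funext => x; ring.
  have s1 := C1_test_sq tal; have s2 := C1_test_sq tka.
  have s3 := C1_test_sq tal'; have s4 := C1_test_sq tka'.
  by rewrite !dot_linr//; ring.
- exists (adj1 c (cst 0) (cst 0) (cst 0), adj2 c lambda (cst 0) (cst 0) (cst 0) (cst 0),
    adj3 c H lambda (cst 0) (cst 0) (cst 0)), (dot f (cst 0) - dot g (cst 0)).
  by exists (cst 0), (cst 0), (cst 0), (cst 0), (cst 0), (cst 0); split => //; exact: C1_test0.
- move=> _ _ [al [al1 [be [be1 [ka [ka1 [tal tbe tka -> ->]]]]]]].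
  have [s1 s2 s3 e] := est _ _ _ _ _ _ tal tbe tka.
  have sal := C1_test_sq tal; have ska := C1_test_sq tka.
  (* Cauchy-Schwarz for the pairs [(f, - g)] and [(ka, al)], read off from the discriminant. *)
  apply: (@le_trans _ _ ((dot f f + dot g g) * (dot ka ka + dot al al))).
    apply: quadratic_discriminant; first by rewrite addr_ge0// dot_ge0.
    move=> a; have h1 := dot_sqr_lin a sf ska; have h2 := dot_sqr_lin (- a) sg sal.
    have : 0 <= dot (fun x => f x + a * ka x) (fun x => f x + a * ka x) +
      dot (fun x => g x + - a * al x) (fun x => g x + - a * al x) by rewrite addr_ge0// dot_ge0.
    by rewrite h1 h2 sqrrN; lra.
  rewrite mulrAC mulrC ler_wpM2r ?addr_ge0 ?dot_ge0//.
  apply: le_trans e; rewrite addrC -[leRHS]addrA lerD2l.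
  by rewrite lerDr dot_ge0.
case: V sw su sv VG VC => -[w u] v /= sw su sv VG VC.
have key al al1 be be1 ka ka1 : C1_test al al1 -> C1_test be be1 -> C1_test ka ka1 ->
    \int[mu]_x (w x * adj1 c be ka al1 x + u x * adj2 c lambda al be ka be1 x +
      v x * adj3 c H lambda be ka ka1 x - f x * ka x + g x * al x) = 0.
  move=> tal tbe tka; have [s1 s2 s3 _] := est _ _ _ _ _ _ tal tbe tka.
  have sal := C1_test_sq tal; have ska := C1_test_sq tka.
  have := VG (adj1 c be ka al1, adj2 c lambda al be ka be1, adj3 c H lambda be ka ka1)
    (dot f ka - dot g al) _.
  move=> h; have {h} : triple_dot (w, u, v) _ = _ := h ltac:(by exists al, al1, be, be1, ka, ka1).
  rewrite /triple_dot /= => h.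
  have i1 := sq_integrable_Int_mul sw s1; have i2 := sq_integrable_Int_mul su s2.
  have i3 := sq_integrable_Int_mul sv s3; have i4 := sq_integrable_Int_mul sf ska.
  have i5 := sq_integrable_Int_mul sg sal.
  rewrite RintegralD//; last by apply: IntB => //; apply: IntD => //; exact: IntD.
  rewrite RintegralB//; last by apply: IntD => //; exact: IntD.
  rewrite RintegralD//; last exact: IntD.
  by rewrite RintegralD// -!/(dot _ _) h; ring.
have sfl := sq_integrable_flux_rate coef sw su sv.
have t0 := @C1_test0 R.
(* Each of the three equations is extracted from [key] by a test triple with a single nonzero
   component. *)
have weak (z D : R -> R) : sq_integrable z -> sq_integrable D ->
    (forall phi, test_function phi -> exists al al1 be be1 ka ka1,
      [/\ C1_test al al1, C1_test be be1, C1_test ka ka1 & forall x,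
       w x * adj1 c be ka al1 x + u x * adj2 c lambda al be ka be1 x +
       v x * adj3 c H lambda be ka ka1 x - f x * ka x + g x * al x =
       - (z x * derive1 phi x + D x * phi x)]) -> is_weak_deriv z D.
  move=> sz sD h; split; try exact: sq_integrable_locally.
  move=> phi tphi; have [al [al1 [be [be1 [ka [ka1 [tal tbe tka e]]]]]]] := h _ tphi.
  have iz := Int_loc_test (sq_integrable_locally sz) (test_function_derive1 tphi).
  have iD := Int_loc_test (sq_integrable_locally sD) tphi.
  have := key _ _ _ _ _ _ tal tbe tka.
  under eq_Rintegral do rewrite e -mulN1r.
  rewrite RintegralZl//; last exact: IntD.
  by rewrite RintegralD// => h0; lra.
exists w, u, v; split => //.
- apply: weak => //; first by apply: sq_integrableB => //; exact: sq_integrableZ.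
  move=> phi /test_function_C1 tphi.
  exists phi, (derive1 phi), (cst 0), (cst 0), (cst 0), (cst 0); split=> // x.
  by rewrite /adj1 /adj2 /adj3 /=; ring.
- apply: weak => // phi /test_function_C1 tphi.
  exists (cst 0), (cst 0), phi, (derive1 phi), (cst 0), (cst 0); split=> // x.
  by rewrite /adj1 /adj2 /adj3 /flux_rate /=; ring.
- apply: weak => //.
    by apply: sq_integrableD => //; apply: sq_integrableB => //; exact: sq_integrableZ.
  move=> phi /test_function_C1 tphi.
  exists (cst 0), (cst 0), (cst 0), (cst 0), phi, (derive1 phi); split=> // x.
  by rewrite /adj1 /adj2 /adj3 /flux_rate /=; ring.
Qed.

End Solvability.

(** * Uniqueness for the first-order system *)

Section Uniqueness.
Context {R : realType}.
Local Notation mu := (@lebesgue_measure R).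
Local Notation Int f := (mu.-integrable [set: R] (EFin \o f)).
Implicit Types (c q H f w u v E : R -> R) (K lambda : R).

(** Otherwise the integral of [|E|] would be at least [n d] for every [n]. *)
Lemma Int_not_bounded_below E (d : R) : Int E ->
  (forall n : nat, exists a : R, forall x, a <= x <= a + n%:R -> d <= `|E x|) -> d <= 0.
Proof.
move=> iE h; have [//|d0] := leP d 0.
pose I := \int[mu]_x `|E x|.
have bound n : n%:R * d <= I.
  have [a ha] := h n; have iN := Int_norm iE.
  pose D := [set` `[a, a + n%:R]] : set R.
  have mD : measurable (D : set (measurableTypeR R)) by exact: measurable_itv.
  have iD : mu.-integrable D (EFin \o (fun x => `|E x|)) by apply: integrableS iN.
  apply: (@le_trans _ _ (\int[mu]_(x in D) `|E x|)); last first.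
    rewrite /I /Rintegral fine_le//.
    - by apply: integrable_fin_num.
    - by apply: integrable_fin_num.
    - apply: ge0_subset_integral => //.
      by apply/measurable_EFinP; exact: Int_measurable iN.
  have -> : n%:R * d = \int[mu]_(x in D) cst d x.
    rewrite Rintegral_cst; last exact: measurable_itv.
    rewrite /D /= lebesgue_measure_itv/= lte_fin.
    case: ifPn => [_|]; first by rewrite /= mulrC; congr (_ * _); ring.
    by rewrite -leNgt gerDl lern0 => /eqP ->; rewrite mul0r mulr0.
  apply: le_Rintegral => //.
  apply: continuous_compact_integrable; first exact: segment_compact.
  by move=> x; exact: cvg_cst.
by have := bound (Num.Def.truncn (I / d)).+1; rewrite leNgt -ltr_pdivrMr// truncnS_gt.
Qed.

(** A positive value would persist on the whole half-line to its left, a negative one on that to its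
    right. No limits at infinity have to be known. *)
Lemma nonincreasing_Int_eq0 E dE :
  (forall x : R, is_derive x (1 : R) E (dE x)) -> (forall x, dE x <= 0) ->
  Int E -> forall x, E x = 0.
Proof.
move=> hE dE0 iE.
have mono x y : x <= y -> E y <= E x.
  rewrite le_eqVlt => /predU1P[-> //|xy].
  have cE : {within `[x, y], continuous E}.
    by apply: continuous_subspaceT; exact: is_derive_continuous hE.
  have [z _ e] := MVT xy (fun z _ => hE z) cE.
  by rewrite -subr_le0 e mulr_le0_ge0// subr_ge0 ltW.
move=> x; apply/eqP; rewrite eq_le; apply/andP; split.
  apply: (Int_not_bounded_below iE) => n; exists (x - n%:R) => y /andP[_ yx].
  by apply: le_trans (ler_norm _); apply: mono; lra.
rewrite -oppr_le0; apply: (Int_not_bounded_below iE) => n; exists x => y /andP[xy _].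
by rewrite -normrN; apply: le_trans (ler_norm _); rewrite lerN2; exact: mono.
Qed.

Lemma first_order_unique c q q1 H H1 K lambda w u v :
  shock_coefficients c q q1 H H1 K -> 0 < lambda ->
  sq_integrable w -> sq_integrable u -> sq_integrable v ->
  is_weak_deriv w (fun x => lambda * u x) ->
  is_weak_deriv u (flux_rate c H w u v) ->
  is_weak_deriv v (fun x => flux_rate c H w u v x - lambda * v x) ->
  {ae mu, forall x, u x = 0 /\ v x = 0}.
Proof.
move=> coef l0 sw su sv dw du dv.
have cc := is_derive_continuous (coef_dc coef).
have cH := is_derive_continuous (coef_dH coef).
have cq := is_derive_continuous (coef_dq coef).
(* Bootstrap: continuous representatives make the right-hand sides continuous, whence C^1
   representatives [W], [U], [V]; [same] identifies the two kinds at every point, so the system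
   holds classically. *)
have [w0 cw0 ww0] := weak_deriv_continuous dw.
have [u0 cu0 uu0] := weak_deriv_continuous du.
have [v0 cv0 vv0] := weak_deriv_continuous dv.
have cflux : continuous (flux_rate c H w0 u0 v0).
  move=> x; apply: cvgM; first exact: cc.
  apply: cvgB; first by apply: cvgD; [exact: cw0|exact: cu0].
  by apply: cvgM; [exact: cH|exact: cv0].
have cu : continuous (fun x => lambda * u0 x).
  by move=> x; apply: cvgM; [exact: cvg_cst|exact: cu0].
have cv : continuous (fun x => flux_rate c H w0 u0 v0 x - lambda * v0 x).
  by move=> x; apply: cvgB; [exact: cflux|apply: cvgM; [exact: cvg_cst|exact: cv0]].
have [W dW wW] := weak_deriv_C1 dw cu ltac:(by apply: ae_mono uu0 _ => x ->).
have flux0 : {ae mu, forall x, flux_rate c H w u v x = flux_rate c H w0 u0 v0 x}.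
  by apply: ae_mono (ae_and ww0 (ae_and uu0 vv0)) _ => x [e1 [e2 e3]]; rewrite /flux_rate e1 e2 e3.
have [U dU uU] := weak_deriv_C1 du cflux flux0.
have [V dV vV] := weak_deriv_C1 dv cv
  ltac:(by apply: ae_mono (ae_and flux0 vv0) _ => x [-> ->]).
have same (z z0 Z : R -> R) (dZ : R -> R) : (forall x : R, is_derive x (1 : R) Z (dZ x)) ->
    continuous z0 -> {ae mu, forall x, z x = z0 x} -> {ae mu, forall x, z x = Z x} -> z0 = Z.
  move=> hZ cz zz0 zZ; apply: ae_eq_continuous => //; first exact: is_derive_continuous hZ.
  by apply: ae_mono (ae_and zz0 zZ) _ => x [<- <-].
have eW := same _ _ _ _ dW cw0 ww0 wW; have eU := same _ _ _ _ dU cu0 uu0 uU.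
have eV := same _ _ _ _ dV cv0 vv0 vV; subst w0 u0 v0.
have sW : sq_integrable W by apply: sq_integrable_ae_eq wW sw; exact: continuous_measurable_fun.
have sU : sq_integrable U by apply: sq_integrable_ae_eq uU su; exact: continuous_measurable_fun.
have sV : sq_integrable V by apply: sq_integrable_ae_eq vV sv; exact: continuous_measurable_fun.
pose S x := lambda^-1 * (U x - V x); pose Y x := lambda^-1 * W x.
have sS : sq_integrable S by apply: sq_integrableZ; exact: sq_integrableB.
have sY : sq_integrable Y by apply: sq_integrableZ.
have c0 x := coef_c_gt0 coef x.
have db x := is_derive_coef_cV x coef.
have dS x : is_derive x (1 : R) S (V x).
  apply: is_derive1_ext (is_derive1Z lambda^-1 (is_derive1B (dU x) (dV x))) _.
  by field; rewrite gt_eqF.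
have dY x : is_derive x (1 : R) Y (lambda * S x + V x).
  apply: is_derive1_ext (is_derive1Z lambda^-1 (dW x)) _.
  by rewrite /S; field; rewrite gt_eqF.
(* The weight for which the coefficient [2 m - 2 - q + H + lambda / c] of [S V] in the derivative of
   [E] vanishes. Its own derivative supplies [- (H' - q' + lambda q) / 2]. *)
pose m x := 1 - 2^-1 * H x - lambda / 2 * (c x)^-1 + 2^-1 * q x.
have dm x : is_derive x (1 : R) m (- (2^-1 * H1 x) - lambda / 2 * q x + 2^-1 * q1 x).
  have h1 := is_derive1Z 2^-1 (coef_dH coef x).
  have h2 := is_derive1Z (lambda / 2) (db x).
  have h3 := is_derive1Z 2^-1 (coef_dq coef x).
  apply: is_derive1_ext (is_derive1D (is_derive1B (is_derive1B (is_derive1_cst x 1) h1) h2) h3) _.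
  by rewrite sub0r.
(* The terms in [Y] are arranged to drop out of the derivative: [Y ^ 2 / 2] yields
   [lambda Y S + Y V], cancelled by [- Y V] from [- Y S] and by [- lambda Y S] from the last term
   through [V']. *)
pose E x := 2^-1 * (Y x * Y x) - Y x * S x + m x * S x * S x - (c x)^-1 * S x * V x.
pose dE x := - (2 * lambda * S x ^+ 2 + (H1 x - q1 x + lambda * q x) / 2 * S x ^+ 2
   + (c x)^-1 * V x ^+ 2).
have hE x : is_derive x (1 : R) E (dE x).
  have h1 := is_derive1Z 2^-1 (is_derive1M (dY x) (dY x)).
  have h2 := is_derive1M (dY x) (dS x).
  have h3 := is_derive1M (is_derive1M (dm x) (dS x)) (dS x).
  have h4 := is_derive1M (is_derive1M (db x) (dS x)) (dV x).
  apply: is_derive1_ext (is_derive1B (is_derive1D (is_derive1B h1 h2) h3) h4) _.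
  have -> : flux_rate c H W U V x = c x * (lambda * Y x + (lambda * S x + V x) - H x * V x).
    by rewrite /flux_rate /Y /S; congr (_ * _); field; rewrite gt_eqF.
  rewrite /dE /m; have := c0 x; move: (c x) => cx cx0.
  by field; rewrite gt_eqF.
have q0 x := coef_q_ge0 coef x; have qH x := coef_q1_le_H1 coef x.
have p1 x : 0 <= 2 * lambda * S x ^+ 2 by rewrite mulr_ge0 ?sqr_ge0// mulr_ge0// ltW.
have p2 x : 0 <= (H1 x - q1 x + lambda * q x) / 2 * S x ^+ 2.
  rewrite mulr_ge0 ?sqr_ge0// divr_ge0// addr_ge0 ?subr_ge0//.
  by rewrite mulr_ge0// ltW.
have p3 x : 0 <= (c x)^-1 * V x ^+ 2 by rewrite mulr_ge0 ?sqr_ge0// invr_ge0 ltW.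
have dE0 x : dE x <= 0 by rewrite oppr_le0 !addr_ge0.
have K1 := coef_K_ge1 coef.
have sbS : sq_integrable (fun x => (c x)^-1 * S x).
  apply: (sq_integrableM_bounded (C := K)) => //.
    by apply: continuous_measurable_fun; exact: is_derive_continuous db.
  by move=> x; rewrite gtr0_norm ?invr_gt0//; exact: coef_cV_le coef x.
have smS : sq_integrable (fun x => m x * S x).
  apply: (sq_integrableM_bounded (C := 1 + K + lambda * K + K)) => //.
    by apply: continuous_measurable_fun; exact: is_derive_continuous dm.
  move=> x; have := coef_H_le coef x; have := coef_q_le coef x; have := coef_cV_le coef x.
  have : 0 < (c x)^-1 by rewrite invr_gt0.
  rewrite /m !ler_norml; move: (c x)^-1 => b b0 bK /andP[q1' q2] /andP[h1 h2].
  have lb : lambda * b <= lambda * K by rewrite ler_pM2l.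
  have lb0 : 0 <= lambda * b by rewrite mulr_ge0// ltW.
  by apply/andP; split; lra.
have iE : Int E.
  apply: IntB; last exact: sq_integrable_Int_mul.
  apply: IntD; last exact: sq_integrable_Int_mul.
  apply: IntB; last exact: sq_integrable_Int_mul.
  by apply: IntZ; exact: sq_integrable_Int_mul.
have E0 := nonincreasing_Int_eq0 hE dE0 iE.
have dEz x : dE x = 0.
  have [_ <-] := hE x.
  rewrite (_ : E = cst 0); last exact/funext.
  by have [_ ->] := is_derive1_cst x (0 : R).
have V0 x : V x = 0.
  have := dEz x; have := p1 x; have := p2 x; rewrite /dE => a1 a2 a3.
  have : (c x)^-1 * V x ^+ 2 = 0 by have := p3 x; lra.
  by move/eqP; rewrite mulf_eq0 invr_eq0 gt_eqF//= sqrf_eq0 => /eqP.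
have S0 x : S x = 0.
  have := dEz x; have := p3 x; have := p2 x; rewrite /dE => a1 a2 a3.
  have : 2 * lambda * S x ^+ 2 = 0 by have := p1 x; lra.
  move/eqP; rewrite mulf_eq0 sqrf_eq0 => /orP[|/eqP//].
  by rewrite mulf_eq0 pnatr_eq0/= gt_eqF.
apply: ae_mono (ae_and uU vV) _ => x [-> ->]; split=> //.
have := S0 x; rewrite /S V0 subr0 => /eqP; rewrite mulf_eq0 invr_eq0 gt_eqF//=.
by move/eqP.
Qed.

End Uniqueness.

(** * The shock profile *)

Section Profile.
Context {R : realType}.
Implicit Types gamma a v x : R.

(** If [y] exceeded [b] at [x0], its maximum over [[x0, x1]], where [y x1 < b], would be attained
    before [x1] at a value above [b], and [y] would still increase just after it. *)
Lemma le_of_outward_flow (y dy : R -> R) (b l : R) :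
  (forall x : R, is_derive x (1 : R) y (dy x)) ->
  (forall x, b < y x -> 0 < dy x) -> y x @[x --> +oo] --> l -> l < b ->
  forall x, y x <= b.
Proof.
move=> hy out yl lb x0; rewrite leNgt; apply/negP => yx0.
have cy := is_derive_continuous hy.
have [x1 x01 yx1] : exists2 x1, x0 < x1 & y x1 < b.
  have [M [_ hM]] : \forall x \near +oo, y x < b.
    exact: cvgr_lt yl _ lb.
  exists (Num.max x0 M + 1); first by rewrite ltr_pwDr// le_max lexx.
  by apply: hM; rewrite ltr_pwDr// le_max lexx orbT.
have cyi : {within `[x0, x1], continuous y} by apply: continuous_subspaceT.
have [p px pmax] := EVT_max (ltW x01) cyi.
have yp : b < y p by apply: lt_le_trans yx0 (pmax _ _); rewrite in_itv/= lexx ltW.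
have px1 : p < x1.
  rewrite lt_neqAle; move: px; rewrite in_itv/= => /andP[_ ->]; rewrite andbT.
  by apply/eqP => e; move: yp; rewrite e ltNge ltW.
have /nbhs_ballP[e /= e0 he] : \forall x \near p, b < y x.
  exact: cvgr_gt (cy p) _ yp.
(* Close enough to [p] for [y > b] on [[p, t]], and still inside [[x0, x1]], where [y p] is
   maximal. *)
pose t := Num.min (p + e / 2) x1.
have pt : p < t by rewrite /t lt_min px1 andbT ltrDl divr_gt0.
have te : t <= p + e / 2 by rewrite /t ge_min lexx.
have tx1 : t <= x1 by rewrite /t ge_min lexx orbT.
have cyt : {within `[p, t], continuous y} by apply: continuous_subspaceT.
have [z zpt ezt] := MVT pt (fun z _ => hy z) cyt.
have : 0 < dy z.
  apply/out/he; move: zpt; rewrite in_itv/= /ball/= ltr_distlC => /andP[? ?].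
  by apply/andP; split; lra.
rewrite ltNge => /negP; apply.
have : y t - y p <= 0.
  rewrite subr_le0; apply: pmax; move: px; rewrite !in_itv/= => /andP[? _].
  by apply/andP; split; lra.
by rewrite ezt pmulr_lle0// subr_gt0.
Qed.

(** Logarithmic growth rate of the profile: [vhat' = vhat * shock_rate], so that
    [(1 / vhat)' = - shock_rate / vhat]. *)
Definition shock_rate gamma a v : R := v - 1 + a * (v `^ (- gamma) - 1).

Lemma is_derive1_powR_compf (f : R -> R) x df (e : R) :
  is_derive x (1 : R) f df -> 0 < f x ->
  is_derive x (1 : R) (fun t : R => f t `^ e) (e * (f x `^ e / f x) * df).
Proof.
move=> hf fx; apply: is_derive1_ext (is_derive1_compf hf (is_derive1_powR e fx)) _.
have f0 : f x != 0 by rewrite gt_eqF.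
by rewrite powRB ?f0 ?implybT// powRr1 ?ltW.
Qed.

Definition shock_rate_slope gamma a v : R := 1 - a * gamma * (v `^ (- gamma) / v).

Lemma is_derive_shock_rate (f : R -> R) x df gamma a :
  is_derive x (1 : R) f df -> 0 < f x ->
  is_derive x (1 : R) (fun t : R => shock_rate gamma a (f t))
    (shock_rate_slope gamma a (f x) * df).
Proof.
move=> hf fx; apply: is_derive1_ext (is_derive1D (is_derive1B hf (is_derive1_cst x 1))
  (is_derive1Z a (is_derive1B (is_derive1_powR_compf (- gamma) hf fx) (is_derive1_cst x 1)))) _.
by rewrite /shock_rate_slope; ring.
Qed.

Section ShockRate.
Variables gamma vp : R.
Hypotheses (gamma_ge1 : 1 <= gamma) (vp_gt0 : 0 < vp) (vp_lt1 : vp < 1).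
Local Notation a := (shock_a gamma vp).
Local Notation k := (shock_rate gamma a).
Local Notation slope := (shock_rate_slope gamma a).

Let y01 : 0 < vp `^ gamma < 1.
Proof.
rewrite powR_gt0//=; apply: le_lt_trans vp_lt1.
by apply: ge1r_powR => //; rewrite vp_gt0 ltW.
Qed.

Lemma shock_a_gt0 : 0 < a.
Proof.
have /andP[y0 y1] := y01.
by rewrite /shock_a mulr_gt0// divr_gt0// subr_gt0.
Qed.

(** The constant [a] is the one that makes [vp] an equilibrium besides [1]. *)
Lemma shock_rate_right : k vp = 0.
Proof.
have /andP[y0 y1] := y01.
rewrite /shock_rate /shock_a powRN; move: y0 y1; set y := vp `^ gamma => y0 y1.
by field; rewrite gt_eqF// gt_eqF// subr_gt0.
Qed.

Lemma shock_rate_left : k 1 = 0.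
Proof. by rewrite /shock_rate powR1; ring. Qed.


Let k_mvt (s t : R) : 0 < s -> s < t ->
  exists2 z : R, s < z < t & k t - k s = slope z * (t - s).
Proof.
move=> s0 st.
have dk z : z \in `]s, t[ -> is_derive z (1 : R) k (slope z).
  rewrite in_itv/= => /andP[sz _].
  by apply: is_derive1_ext (is_derive_shock_rate gamma a (is_derive1_id z) (lt_trans s0 sz)) _; rewrite mulr1.
have ck : {within `[s, t], continuous k}.
  apply: derivable_within_continuous => z; rewrite in_itv/= => /andP[sz _].
  by have [] := is_derive_shock_rate gamma a (is_derive1_id z) (lt_le_trans s0 sz).
by have [z zi e] := MVT st dk ck; exists z; rewrite ?e//; move: zi; rewrite in_itv.
Qed.

(** Strict convexity of the rate. Together with its zeros at [vp] and [1] it fixes the sign of the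
    rate: positive outside [[vp, 1]], at most zero inside. *)
Let slope_lt (s t : R) : 0 < s -> s < t -> slope s < slope t.
Proof.
move=> s0 st; have t0 := lt_trans s0 st.
rewrite /shock_rate_slope ltrD2l ltrN2 ltr_pM2l; last first.
  by rewrite mulr_gt0 ?shock_a_gt0// (lt_le_trans ltr01).
have inv z : z `^ (- gamma) / z = (z `^ gamma * z)^-1 by rewrite powRN invfM.
rewrite !inv ltf_pV2 ?posrE ?mulr_gt0 ?powR_gt0//.
apply: ltr_pM => //; rewrite ?powR_ge0// ?(ltW s0)//.
by apply: gt0_ltr_powR; rewrite ?nnegrE ?(ltW s0) ?(ltW t0)// (lt_le_trans ltr01).
Qed.

Let k_crit : exists2 z : R, vp < z < 1 & slope z = 0.
Proof.
have [z zi e] := k_mvt vp_gt0 vp_lt1; exists z => //.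
move/eqP: e; rewrite shock_rate_left shock_rate_right subrr eq_sym mulf_eq0.
by rewrite (gt_eqF (_ : 0 < 1 - vp)) ?subr_gt0// orbF => /eqP.
Qed.

Lemma shock_rate_gt1 v : 1 < v -> 0 < k v.
Proof.
move=> v1; have [z /andP[z0 z1] sz] := k_crit.
have [t /andP[t1 tv]] := k_mvt ltr01 v1.
rewrite shock_rate_left subr0 => ->; rewrite pmulr_lgt0; last by rewrite subr_gt0.
by rewrite -[X in X < _]sz; apply: slope_lt; [exact: lt_trans z0|lra].
Qed.

Lemma shock_rate_lt v : 0 < v -> v < vp -> 0 < k v.
Proof.
move=> v0 v1; have [z /andP[z0 z1] sz] := k_crit.
have [t /andP[t1 tv]] := k_mvt v0 v1.
rewrite shock_rate_right sub0r => /eqP; rewrite eqr_oppLR => /eqP ->.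
rewrite oppr_gt0 pmulr_llt0; last by rewrite subr_gt0.
by rewrite -[X in _ < X]sz; apply: slope_lt; lra.
Qed.

Lemma shock_rate_le0 v : vp <= v <= 1 -> k v <= 0.
Proof.
move=> /andP[]; rewrite le_eqVlt => /predU1P[<- _|pv]; first by rewrite shock_rate_right.
rewrite le_eqVlt => /predU1P[->|v1]; first by rewrite shock_rate_left.
have v0 := lt_trans vp_gt0 pv.
rewrite leNgt; apply/negP => kv.
have [s /andP[s1 s2] es] := k_mvt vp_gt0 pv.
have [t /andP[t1 t2] et] := k_mvt v0 v1.
have sp : 0 < slope s.
  by rewrite -(@pmulr_lgt0 _ (v - vp)) ?subr_gt0// -es shock_rate_right subr0.
have tn : slope t < 0.
  by rewrite -(@pmulr_llt0 _ (1 - v)) ?subr_gt0// -et shock_rate_left sub0r oppr_lt0.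
have st : s < t by lra.
by have := slope_lt (lt_trans vp_gt0 s1) st; lra.
Qed.

Section Coefficients.
Variable vhat : R -> R.
Hypothesis profile : shock_profile gamma vp vhat.

Let v_gt0 x : 0 < vhat x. Proof. by case: profile. Qed.

Let dv (x : R) : is_derive x (1 : R) vhat (vhat x * k (vhat x)).
Proof. by case: profile. Qed.

(** Outside [[vp, 1]] the profile increases. Above [1] this is incompatible with the limit [vp] at
    [+oo]; below [vp], with the limit [1] at [-oo], after the reflection [- vhat (- x)].
    Monotonicity of the profile is not presupposed. *)
Lemma shock_profile_bounds x : vp <= vhat x <= 1.
Proof.
have [_ _ vl vr] := profile; apply/andP; split; last first.
  apply: (le_of_outward_flow dv _ vr) => // t v1.
  by rewrite mulr_gt0// shock_rate_gt1.
have dz (t : R) : is_derive t (1 : R) (fun s : R => - vhat (- s)) (vhat (- t) * k (vhat (- t))).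
  have hN : is_derive t (1 : R) (fun s : R => - s) (- 1) by apply: is_derive1N; exact: is_derive1_id.
  by apply: is_derive1_ext (is_derive1N (is_derive1_compf hN (dv (- t)))) _; ring.
rewrite -lerN2 -[vhat x](congr1 vhat (opprK x)).
apply: (le_of_outward_flow (l := - 1) (b := - vp) dz) => [t||]; last by rewrite ltrN2.
  by rewrite ltrN2 => vt; rewrite mulr_gt0// shock_rate_lt.
by apply: cvgN; apply/cvgNy_compNP.
Qed.

Let bounded (G : R -> R) : (forall v : R, 0 < v -> derivable G v 1) ->
  exists2 M : R, 0 <= M & forall x, `|G (vhat x)| <= M.
Proof.
move=> dG; have cG : {within `[vp, 1], continuous ((fun z : R => `|z|) \o G)}.
  apply: within_continuous_comp => [z _|]; first exact: norm_continuous.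
  apply: derivable_within_continuous => z; rewrite in_itv/= => /andP[vz _].
  by apply: dG; exact: lt_le_trans vz.
have [p _ hp] := EVT_max (ltW vp_lt1) cG.
by exists `|G p| => [//|x]; apply: hp; rewrite in_itv/= shock_profile_bounds.
Qed.

(** All coefficients are functions of [vhat] alone, differentiable on the positive half-line; the
    bounds come from compactness of [[vp, 1]], and both signs from [shock_rate_le0]. *)
Lemma shock_profile_coefficients : exists q q1 H1 K, shock_coefficients vhat q q1
  (fun x => shock_h gamma vp (vhat x) / vhat x `^ (gamma + 1)) H1 K.
Proof.
pose p v := v `^ (- gamma).
pose q v := - (k v / v).
pose q1 v := - ((a + 1) - a * (gamma + 1) * p v) / v ^+ 2 * (v * k v).
pose H v := - 1 + (a * (gamma - 1) * p v + (a + 1)) / v.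
pose H1 v := - (a * (gamma - 1) * (gamma + 1) * p v + (a + 1)) / v ^+ 2 * (v * k v).
have eH v : 0 < v -> shock_h gamma vp v / v `^ (gamma + 1) = H v.
  move=> v0; have vn0 : v != 0 by rewrite gt_eqF.
  rewrite /H /p /shock_h powRN powRD ?vn0 ?implybT// (powRr1 (ltW v0)).
  have := powR_gt0 gamma v0; move: (v `^ gamma) => y y0.
  by field; rewrite !gt_eqF.
have dq (f : R -> R) (x df : R) : is_derive x (1 : R) f df -> 0 < f x ->
    is_derive x (1 : R) (fun t => q (f t)) (- ((a + 1) - a * (gamma + 1) * p (f x)) / f x ^+ 2 * df).
  move=> hf fx; have f0 : f x != 0 by rewrite gt_eqF.
  apply: is_derive1_ext (is_derive1N (is_derive1M (is_derive_shock_rate gamma a hf fx) (is_derive1V hf f0))) _.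
  by rewrite /shock_rate_slope /shock_rate /p; field.
have dH (f : R -> R) (x df : R) : is_derive x (1 : R) f df -> 0 < f x ->
    is_derive x (1 : R) (fun t => H (f t))
      (- (a * (gamma - 1) * (gamma + 1) * p (f x) + (a + 1)) / f x ^+ 2 * df).
  move=> hf fx; have f0 : f x != 0 by rewrite gt_eqF.
  apply: is_derive1_ext (is_derive1D (is_derive1_cst x (- 1)) (is_derive1M
    (is_derive1D (is_derive1Z (a * (gamma - 1)) (is_derive1_powR_compf (- gamma) hf fx))
      (is_derive1_cst x (a + 1))) (is_derive1V hf f0))) _.
  by rewrite /p; field.
(* Common shape of [q1] and [H1], which differ only in [b1]; derivability yields their continuity
   along the profile. *)
have drate (f : R -> R) (x df b1 b2 : R) : is_derive x (1 : R) f df -> 0 < f x ->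
    derivable (fun t => - (b1 * p (f t) + b2) / f t ^+ 2 * (f t * k (f t))) x 1.
  move=> hf fx; have f0 : f x ^+ 2 != 0 by rewrite expf_neq0// gt_eqF.
  have [//] := is_derive1M (is_derive1M (is_derive1N (is_derive1D
    (is_derive1Z b1 (is_derive1_powR_compf (- gamma) hf fx)) (is_derive1_cst x b2)))
    (is_derive1V (is_derive1X 2 hf) f0)) (is_derive1M hf (is_derive_shock_rate gamma a hf fx)).
have eq1 v : q1 v = - ((- (a * (gamma + 1))) * p v + (a + 1)) / v ^+ 2 * (v * k v).
  by rewrite /q1; congr (- _ / _ * _); ring.
have dq1 (f : R -> R) (x df : R) : is_derive x (1 : R) f df -> 0 < f x -> derivable (fun t => q1 (f t)) x 1.
  move=> hf fx; rewrite (_ : (fun t => q1 (f t)) = fun t =>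
    - ((- (a * (gamma + 1))) * p (f t) + (a + 1)) / f t ^+ 2 * (f t * k (f t))); last first.
    by apply/funext => t; rewrite eq1.
  exact: drate hf fx.
have [Mq Mq0 hMq] : exists2 M : R, 0 <= M & forall x, `|q (vhat x)| <= M.
  by apply: bounded => v v0; have [] := dq _ _ _ (is_derive1_id v) v0.
have [MH MH0 hMH] : exists2 M : R, 0 <= M & forall x, `|H (vhat x)| <= M.
  by apply: bounded => v v0; have [] := dH _ _ _ (is_derive1_id v) v0.
have [M1 M10 hM1] : exists2 M : R, 0 <= M & forall x, `|H1 (vhat x)| <= M.
  by apply: bounded => v v0; exact: drate (is_derive1_id v) v0.
have K0 : 0 < vp^-1 by rewrite invr_gt0.
have vv x : vhat x <= 1 by have /andP[] := shock_profile_bounds x.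
have kle x : k (vhat x) <= 0 by apply/shock_rate_le0/shock_profile_bounds.
exists (fun x => q (vhat x)), (fun x => q1 (vhat x)), (fun x => H1 (vhat x)), (1 + vp^-1 + Mq + MH + M1).
constructor.
- by lra.
- exact: v_gt0.
- by move=> x; have := vv x; lra.
- move=> x; have : (vhat x)^-1 <= vp^-1.
    by rewrite lef_pV2 ?posrE//; have /andP[] := shock_profile_bounds x.
  by lra.
- by move=> x; rewrite eH//; apply: le_trans (hMH x) _; lra.
- by move=> x; apply: le_trans (hMq x) _; lra.
- by move=> x; apply: le_trans (hM1 x) _; lra.
- move=> x; apply: is_derive1_ext (dv x) _; rewrite /q.
  by field; rewrite gt_eqF.
- by move=> x; exact: dq.
- move=> x; rewrite (_ : (fun t => _) = fun t => H (vhat t)); first exact: dH.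
  by apply/funext => t; rewrite eH.
- by move=> x; apply/differentiable_continuous/derivable1_diffP; exact: dq1 (dv x) _.
- by move=> x; apply/differentiable_continuous/derivable1_diffP; exact: drate (dv x) _.
- by move=> x; rewrite /q -mulNr; apply: divr_ge0; [rewrite oppr_ge0|exact: ltW].
- move=> x; rewrite -subr_ge0.
  (* Derivative of [H - q = a gamma vhat ^ (- gamma - 1)] along the flow. *)
  have -> : H1 (vhat x) - q1 (vhat x) =
      (- k (vhat x)) * (a * gamma * (gamma + 1) * p (vhat x) / vhat x).
    by rewrite /H1 /q1; field; rewrite gt_eqF.
  rewrite mulr_ge0 ?oppr_ge0// divr_ge0 ?(ltW (v_gt0 _))// mulr_ge0 ?powR_ge0//.
  have g0 : 0 <= gamma by exact: le_trans gamma_ge1.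
  by apply: mulr_ge0; [apply: mulr_ge0 => //; exact: ltW shock_a_gt0|exact: addr_ge0].
Qed.

End Coefficients.
End ShockRate.
End Profile.

(** * The resolvent equation *)

Section ResolventSystem.
Context {R : realType}.
Local Notation mu := (@lebesgue_measure R).
Variables (c q q1 H H1 : R -> R) (K lambda : R).
Hypotheses (coef : shock_coefficients c q q1 H H1 K) (lambda_gt0 : 0 < lambda).
Implicit Types f g w u v : R -> R.

(* Weak form of [(lambda - L) (v, u) = (f, g)]. *)
Definition resolvent_system f g v u : Prop := exists w,
  [/\ [/\ sq_integrable w, sq_integrable u & sq_integrable v],
      is_weak_deriv w (fun x => lambda * u x - g x),
      is_weak_deriv u (flux_rate c H w u v) &
      is_weak_deriv v (fun x => flux_rate c H w u v x - lambda * v x + f x)].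

Let c_neq0 x : c x != 0. Proof. by rewrite gt_eqF// (coef_c_gt0 coef). Qed.

Let measurable_derivable f (df : R -> R) : (forall x : R, is_derive x (1 : R) f (df x)) ->
  measurable_fun [set: R] f.
Proof. by move=> hf; apply: continuous_measurable_fun; exact: is_derive_continuous hf. Qed.

Let ae_refl f : {ae mu, forall x, f x = f x}. Proof. exact: aeW. Qed.

Let weak_deriv_congr f g g' : measurable_fun [set: R] g' ->
  {ae mu, forall x, g x = g' x} -> is_weak_deriv f g -> is_weak_deriv f g'.
Proof.
move=> mg' gg' fg; have [lf _ _] := fg.
exact: weak_deriv_ae_eq (locally_integrable_measurable lf) mg' (ae_refl f) gg' fg.
Qed.

(** As [c] does not vanish, the equation for [u'] determines [w] almost everywhere, and the other
    two then determine the data. This identifies the image of a constructed solution under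
    [lambda - L] with the prescribed data. *)
Lemma resolvent_system_data_unique f g f' g' v u :
  resolvent_system f g v u -> resolvent_system f' g' v u ->
  {ae mu, forall x, f x = f' x} /\ {ae mu, forall x, g x = g' x}.
Proof.
move=> [w [[sw su sv] dw du dv]] [w' [[sw' _ _] dw' du' dv']].
have ew : {ae mu, forall x, w x = w' x}.
  apply: ae_mono (weak_deriv_unique du du') _ => x /(mulfI (c_neq0 x)).
  by rewrite -!addrA => /addIr.
split.
  apply: ae_mono (ae_and (weak_deriv_unique dv dv') ew) _ => x [e1 e2].
  by move: e1; rewrite /flux_rate e2; exact: addrI.
have [_ lg _] := dw; have [mw' _] := sw'.
have dw'' := weak_deriv_ae_eq mw' (locally_integrable_measurable lg) ew (ae_refl _) dw.
by apply: ae_mono (weak_deriv_unique dw'' dw') _ => x /addrI/oppr_inj.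
Qed.

Lemma resolvent_system_unique f g f' g' v u v' u' :
  resolvent_system f g v u -> resolvent_system f' g' v' u' ->
  {ae mu, forall x, f x = f' x} -> {ae mu, forall x, g x = g' x} ->
  {ae mu, forall x, v x = v' x} /\ {ae mu, forall x, u x = u' x}.
Proof.
move=> [w [[sw su sv] dw du dv]] [w' [[sw' su' sv'] dw' du' dv']] ff' gg'.
have sW := sq_integrableB sw sw'; have sU := sq_integrableB su su'.
have sV := sq_integrableB sv sv'.
have sF := sq_integrable_flux_rate coef sW sU sV.
have eF x : flux_rate c H (fun x => w x - w' x) (fun x => u x - u' x) (fun x => v x - v' x) x =
    flux_rate c H w u v x - flux_rate c H w' u' v' x by rewrite /flux_rate; ring.
have dW : is_weak_deriv (fun x => w x - w' x) (fun x => lambda * (u x - u' x)).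
  apply: weak_deriv_congr (weak_derivB dw dw').
    by have [] := sq_integrableZ lambda sU.
  by apply: ae_mono gg' _ => x ->; ring.
have dU := weak_derivB du du'.
rewrite (_ : (fun x => flux_rate c H w u v x - flux_rate c H w' u' v' x) =
  flux_rate c H (fun x => w x - w' x) (fun x => u x - u' x) (fun x => v x - v' x)) in dU;
  last by apply/funext => x; rewrite eF.
have dV : is_weak_deriv (fun x => v x - v' x)
    (fun x => flux_rate c H (fun x => w x - w' x) (fun x => u x - u' x) (fun x => v x - v' x) x
      - lambda * (v x - v' x)).
  apply: weak_deriv_congr (weak_derivB dv dv').
    by have [] := sq_integrableB sF (sq_integrableZ lambda sV).
  by apply: ae_mono ff' _ => x ->; rewrite eF; ring.
have uv0 := first_order_unique coef lambda_gt0 sW sU sV dW dU dV.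
by split; apply: ae_mono uv0 _ => x [/eqP + /eqP]; rewrite !subr_eq0 => /eqP + /eqP.
Qed.

Lemma resolvent_system_solvable f g : sq_integrable f -> sq_integrable g ->
  exists v u, resolvent_system f g v u.
Proof.
move=> sf sg; have [C [_ sol]] := first_order_solvable coef lambda_gt0.
by have [w [u [v [? ? ? ? _]]]] := sol f g sf sg; exists v, u, w.
Qed.

(** The bound is known for the solution built by duality; by uniqueness that is the given one. *)
Lemma resolvent_system_bound : exists2 C : R, 0 <= C & forall f g v u,
  sq_integrable f -> sq_integrable g -> resolvent_system f g v u ->
  dot v v + dot u u <= C * (dot f f + dot g g).
Proof.
have [C [C0 sol]] := first_order_solvable coef lambda_gt0.
exists C => // f g v u sf sg sys.
have [w' [u' [v' [[sw' su' sv'] dw' du' dv' le]]]] := sol f g sf sg.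
have sys' : resolvent_system f g v' u' by exists w'.
have [ev eu] := resolvent_system_unique sys sys' (ae_refl f) (ae_refl g).
have [_ [[_ [mu' _] [mv' _]] _ _ _]] := sys'; have [_ [[_ [mu_ _] [mv _]] _ _ _]] := sys.
have -> : dot v v = dot v' v'.
  apply: Rintegral_ae_eq; try exact: measurable_funM.
  by apply: ae_mono ev _ => x ->.
have -> : dot u u = dot u' u'.
  apply: Rintegral_ae_eq; try exact: measurable_funM.
  by apply: ae_mono eu _ => x ->.
by have := dot_ge0 w'; lra.
Qed.

(** The weak derivative of [u] is the flux, a combination of [w], [u] and [v] with C^1 coefficients,
    and so has a weak derivative in L^2 by the product rule: [u] gains a second derivative, as the
    domain requires. *)
Lemma resolvent_system_sobolev f g v u :
  sq_integrable f -> sq_integrable g -> resolvent_system f g v u ->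
  [/\ sq_integrable v, sq_integrable u,
      exists2 v1, is_weak_deriv v v1 & sq_integrable v1 &
      exists u1 u2, [/\ is_weak_deriv u u1, sq_integrable u1, is_weak_deriv u1 u2 & sq_integrable u2]].
Proof.
move=> sf sg [w [[sw su sv] dw du dv]].
have sF := sq_integrable_flux_rate coef sw su sv.
have sv1 : sq_integrable (fun x => flux_rate c H w u v x - lambda * v x + f x).
  by apply: sq_integrableD => //; apply: sq_integrableB => //; exact: sq_integrableZ.
split=> //; first by eexists; [exact: dv|].
have cc := is_derive_continuous (coef_dc coef); have cq := is_derive_continuous (coef_dq coef).
have cdc : continuous (fun x => - q x * c x ^+ 2).
  by move=> x; apply: cvgM; [apply: cvgN; exact: cq|apply: cvgM; exact: cc].
have dHv := weak_derivM dv (coef_dH coef) (coef_H1_continuous coef).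
have dF := weak_derivM (weak_derivB (weak_derivD dw du) dHv) (coef_dc coef) cdc.
eexists; eexists; split; [exact: du|exact: sF|exact: dF|].
have mcont (m : R -> R) : continuous m -> measurable_fun [set: R] m by exact: continuous_measurable_fun.
have sHM h : sq_integrable h -> sq_integrable (fun x => H x * h x).
  apply: (sq_integrableM_bounded (C := K)); last exact: coef_H_le coef.
  exact: measurable_derivable (coef_dH coef).
have sH1M h : sq_integrable h -> sq_integrable (fun x => H1 x * h x).
  apply: (sq_integrableM_bounded (C := K)); last exact: coef_H1_le coef.
  by apply: mcont; exact: coef_H1_continuous coef.
apply: sq_integrableD.
  apply: (sq_integrableM_bounded (C := K * K ^+ 2)); first exact: mcont.
    move=> x; rewrite normrM normrN normrX ler_pM// ?exprn_ge0 ?(coef_q_le coef)//.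
    rewrite lerXn2r ?nnegrE// ?(le_trans ler01 (coef_K_ge1 coef))//.
    by rewrite gtr0_norm ?(coef_c_gt0 coef)// (coef_c_le coef).
  by apply: sq_integrableB; [exact: sq_integrableD|exact: sHM].
apply: (sq_integrableM_bounded (C := K)); first exact: mcont.
  by move=> x; rewrite gtr0_norm ?(coef_c_gt0 coef)// (coef_c_le coef).
apply: sq_integrableB.
  by apply: sq_integrableD => //; apply: sq_integrableB => //; exact: sq_integrableZ.
by apply: sq_integrableD; [exact: sH1M|exact: sHM].
Qed.

(** Solve the flux equation for [w]; then [w'] collects [z1 + p1 - u1]. The functions [p1] and [z1]
    are arbitrary weak derivatives, square integrable because they agree almost everywhere with
    those given by the product rule. *)
Lemma resolvent_system_of_weak_deriv v v1 u u1 u2 p1 z1 :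
  sq_integrable v -> sq_integrable v1 -> sq_integrable u -> sq_integrable u1 -> sq_integrable u2 ->
  is_weak_deriv v v1 -> is_weak_deriv u u1 -> is_weak_deriv u1 u2 ->
  is_weak_deriv (fun x => H x * v x) p1 -> is_weak_deriv (fun x => (c x)^-1 * u1 x) z1 ->
  let f x := lambda * v x - (u1 x - v1 x) in
  let g x := lambda * u x - (- u1 x + p1 x + z1 x) in
  [/\ resolvent_system f g v u, sq_integrable f & sq_integrable g].
Proof.
move=> sv sv1 su su1 su2 dv du du1 dp dz f g.
have mH := measurable_derivable (coef_dH coef).
have dcV x := is_derive_coef_cV x coef.
have mcV := measurable_derivable dcV.
have mq := measurable_derivable (coef_dq coef).
have sHv : sq_integrable (fun x => H x * v x).
  by apply: (sq_integrableM_bounded (C := K)) => //; exact: coef_H_le coef.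
have cVM h : sq_integrable h -> sq_integrable (fun x => (c x)^-1 * h x).
  apply: (sq_integrableM_bounded (C := K)) => // x.
  by rewrite gtr0_norm ?invr_gt0 ?(coef_c_gt0 coef)// (coef_cV_le coef).
have sp1 : sq_integrable p1.
  have [_ lp1 _] := dp.
  have e := weak_deriv_unique (weak_derivM dv (coef_dH coef) (coef_H1_continuous coef)) dp.
  apply: sq_integrable_ae_eq (locally_integrable_measurable lp1) e _.
  apply: sq_integrableD.
    apply: (sq_integrableM_bounded (C := K)) => //; last exact: coef_H1_le coef.
    by apply: continuous_measurable_fun; exact: coef_H1_continuous coef.
  by apply: (sq_integrableM_bounded (C := K)) => //; exact: coef_H_le coef.
have sz1 : sq_integrable z1.
  have [_ lz1 _] := dz.
  have e := weak_deriv_unique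
    (weak_derivM du1 dcV (is_derive_continuous (coef_dq coef))) dz.
  apply: sq_integrable_ae_eq (locally_integrable_measurable lz1) e _.
  apply: sq_integrableD; last exact: cVM.
  by apply: (sq_integrableM_bounded (C := K)) => //; exact: coef_q_le coef.
have sf : sq_integrable f.
  by apply: sq_integrableB; [exact: sq_integrableZ|exact: sq_integrableB].
have sg : sq_integrable g.
  apply: sq_integrableB; first exact: sq_integrableZ.
  apply: sq_integrableD => //; apply: sq_integrableD => //.
  rewrite (_ : (fun x => - u1 x) = fun x => -1 * u1 x); first exact: sq_integrableZ.
  by apply/funext => x; rewrite mulN1r.
split=> //; pose w x := (c x)^-1 * u1 x + H x * v x - u x.
have eF x : flux_rate c H w u v x = u1 x.
  by rewrite /flux_rate /w; field.
exists w; split.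
- by split=> //; apply: sq_integrableB => //; apply: sq_integrableD => //; exact: cVM.
- have := weak_derivB (weak_derivD dz dp) du; congr is_weak_deriv.
  by apply/funext => x; rewrite /g; ring.
- by rewrite (_ : flux_rate c H w u v = u1)//; apply/funext.
- move: dv; congr is_weak_deriv.
  by apply/funext => x; rewrite eF /f; ring.
Qed.
End ResolventSystem.

(** * Real and imaginary parts *)

Section ComplexParts.
Context {R : realType}.
Local Notation mu := (@lebesgue_measure R).
Local Notation Int f := (mu.-integrable [set: R] (EFin \o f)).
Implicit Types (z : R[i]) (u v : R -> R[i]) (b : bool).

(** Indexing the two parts by a boolean lets one statement treat both. *)
Definition part b z : R := if b then complex.Im z else complex.Re z.

Lemma partD b z z' : part b (z + z') = part b z + part b z'.
Proof. by case: b z z' => [] [? ?] [? ?]. Qed.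

Lemma partN b z : part b (- z) = - part b z.
Proof. by case: b z => [] [? ?]. Qed.

Lemma partZ b (a : R) z : part b (a%:C * z) = a * part b z.
Proof. by case: b z => [] [? ?] /=; ring. Qed.

Lemma part_ext z z' : (forall b, part b z = part b z') -> z = z'.
Proof. by case: z z' => ? ? [? ?] h; congr (_ +i* _); [exact: (h false)|exact: (h true)]. Qed.

Lemma L2C_part u : L2C u <-> forall b, sq_integrable (fun x => part b (u x)).
Proof.
split=> [[/sq_integrableP ur /sq_integrableP ui] []//|h].
by split; apply/sq_integrableP; [exact: (h false)|exact: (h true)].
Qed.

Lemma is_weak_derivC_part u v : is_weak_derivC u v <->
  forall b, is_weak_deriv (fun x => part b (u x)) (fun x => part b (v x)).
Proof. by split=> [[? ?] []//|h]; split; [exact: (h false)|exact: (h true)]. Qed.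

Lemma ae_part b u v : {ae mu, forall x, u x = v x} ->
  {ae mu, forall x, part b (u x) = part b (v x)}.
Proof. by move=> uv; apply: ae_mono uv _ => x ->. Qed.

Lemma ae_part_ext u v :
  (forall b, {ae mu, forall x, part b (u x) = part b (v x)}) ->
  {ae mu, forall x, u x = v x}.
Proof.
move=> h; apply: ae_mono (ae_and (h false) (h true)) _ => x [e0 e1].
by apply: part_ext => -[].
Qed.

Lemma wderivP u v : is_weak_derivC u v -> is_weak_derivC u (wderiv u).
Proof. by move=> uv; rewrite /wderiv; apply: (@xgetPex _ _ [set v | is_weak_derivC u v]); exists v. Qed.

Lemma L2norm_sqr u : L2C u -> L2norm u ^+ 2 =
  dot (fun x => part false (u x)) (fun x => part false (u x)) +
  dot (fun x => part true (u x)) (fun x => part true (u x)).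
Proof.
move=> /L2C_part su; have [mr ir] := su false; have [mi ii] := su true.
rewrite /dot -RintegralD//.
have iri : Int (fun x => part false (u x) ^+ 2 + part true (u x) ^+ 2) by exact: IntD.
rewrite /L2norm unlock.
under eq_integral => x _.
  rewrite /= powR_mulrn ?normr_ge0// real_normK ?num_real//.
  rewrite (_ : Normc.normc (u x) ^+ 2 = part false (u x) ^+ 2 + part true (u x) ^+ 2); last first.
    by case: (u x) => a b /=; rewrite sqr_sqrtr// addr_ge0 ?sqr_ge0.
  over.
rewrite -[X in (X `^ _)%E]fineK; last exact: integrable_fin_num iri.
rewrite poweR_EFin /= powR12_sqrt; last first.
  by apply: Rintegral_ge0 => x _; rewrite addr_ge0 ?sqr_ge0.
by rewrite sqr_sqrtr//; apply: Rintegral_ge0 => x _; rewrite addr_ge0 ?sqr_ge0.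
Qed.

End ComplexParts.

(** * Injectivity, surjectivity and bounded inverse of the shifted operator *)

Section LinearizedOperator.
Context {R : realType}.
Local Notation mu := (@lebesgue_measure R).
Local Notation state := ((R -> R[i]) * (R -> R[i]))%type.
Variables (gamma vp : R) (vhat : R -> R).
Local Notation H := (fun x => shock_h gamma vp (vhat x) / vhat x `^ (gamma + 1)).
Local Notation A := (ns_operator gamma vp vhat).
Variables (q q1 H1 : R -> R) (K lambda : R).
Hypotheses (coef : shock_coefficients vhat q q1 H H1 K) (lambda_gt0 : 0 < lambda).
Local Notation parts b u := (fun x => part b (u x)).
Implicit Types (U W F : state).

Lemma shifted_ns_operator U b : ns_domain U ->
  let F := shifted A lambda%:C U in
  [/\ resolvent_system vhat H lambda (parts b F.1) (parts b F.2) (parts b U.1) (parts b U.2),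
      sq_integrable (parts b F.1) & sq_integrable (parts b F.2)].
Proof.
case: U => v u [/= [/L2C_part sv [v1 dv /= [/L2C_part sv1 _]]]].
move=> [/L2C_part su [u1 du /= [/L2C_part su1 [u2 du1 [/L2C_part su2 _]]]]].
(* The derivative selected by [wderiv] need not be the one provided by [ns_domain]; equality almost
   everywhere carries square integrability over. *)
have repr (z z1 z1' : R -> R) : is_weak_deriv z z1 -> sq_integrable z1 ->
    is_weak_deriv z z1' -> sq_integrable z1'.
  move=> dz sz1 dz'; have [_ lz' _] := dz'.
  exact: sq_integrable_ae_eq (locally_integrable_measurable lz') (weak_deriv_unique dz dz') sz1.
have dwv := wderivP dv; have dwu := wderivP du.
move: (dv) (du) (du1) (dwv) (dwu) => /is_weak_derivC_part dv_ /is_weak_derivC_part du_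
  /is_weak_derivC_part du1_ /is_weak_derivC_part dwv_ /is_weak_derivC_part dwu_.
have dwu1 b' : is_weak_deriv (parts b' (wderiv u)) (parts b' u2).
  have [_ l1 _] := dwu_ b'; have [_ l2 _] := du1_ b'.
  apply: weak_deriv_ae_eq (weak_deriv_unique (du_ b') (dwu_ b')) (aeW _ _) (du1_ b') => //.
  - exact: locally_integrable_measurable l1.
  - exact: locally_integrable_measurable l2.
pose pressure x := (H x)%:C * v x.
pose viscosity x := wderiv u x / (vhat x)%:C.
have ep b' x : part b' (pressure x) = H x * part b' (v x) by exact: partZ.
have ez b' x : part b' (viscosity x) = (vhat x)^-1 * part b' (wderiv u x).
  by rewrite /viscosity mulrC -fmorphV partZ.
(* Unless a weak derivative exists, [wderiv] has the default value [0]; for the pressure and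
   viscosity terms the product rule provides one. *)
have dp : exists p1, is_weak_derivC pressure p1.
  have d b' := weak_derivM (dv_ b') (coef_dH coef) (coef_H1_continuous coef).
  exists (fun x => (H1 x * part false (v x) + H x * part false (v1 x)) +i*
    (H1 x * part true (v x) + H x * part true (v1 x))).
  apply/is_weak_derivC_part => b'.
  by under eq_fun do rewrite ep; case: b' (d b').
have dz : exists z1, is_weak_derivC viscosity z1.
  have d b' := weak_derivM (dwu1 b') (fun x => is_derive_coef_cV x coef) (is_derive_continuous (coef_dq coef)).
  exists (fun x => (q x * part false (wderiv u x) + (vhat x)^-1 * part false (u2 x)) +i*
    (q x * part true (wderiv u x) + (vhat x)^-1 * part true (u2 x))).
  apply/is_weak_derivC_part => b'.
  by under eq_fun do rewrite ez; case: b' (d b').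
have [_ /wderivP/is_weak_derivC_part/(_ b) dp_] := dp.
have [_ /wderivP/is_weak_derivC_part/(_ b) dz_] := dz.
rewrite (_ : (fun x => part b (pressure x)) = fun x => H x * part b (v x)) in dp_;
  last by apply/funext => x; exact: ep.
rewrite (_ : (fun x => part b (viscosity x)) = fun x => (vhat x)^-1 * part b (wderiv u x)) in dz_;
  last by apply/funext => x; exact: ez.
have := resolvent_system_of_weak_deriv lambda coef (sv b) (repr _ _ _ (dv_ b) (sv1 b) (dwv_ b))
  (su b) (repr _ _ _ (du_ b) (su1 b) (dwu_ b)) (su2 b) (dwv_ b) (dwu_ b) (dwu1 b) dp_ dz_.
move=> /=.
rewrite (_ : (fun x => lambda * part b (v x) - (part b (wderiv u x) - part b (wderiv v x))) =
  fun x => part b (lambda%:C * v x - (wderiv u x - wderiv v x))); last first.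
  by apply/funext => x; rewrite !(partD, partN, partZ).
rewrite (_ : (fun x => lambda * part b (u x) - (- part b (wderiv u x) +
    part b (wderiv pressure x) + part b (wderiv viscosity x))) =
  fun x => part b (lambda%:C * u x - (- wderiv u x + wderiv pressure x + wderiv viscosity x))) //.
by apply/funext => x; rewrite !(partD, partN, partZ).
Qed.

Lemma shifted_ns_operator_injective U W : ns_domain U -> ns_domain W ->
  eq_L2pair (shifted A lambda%:C U) (shifted A lambda%:C W) -> eq_L2pair U W.
Proof.
move=> dU dW [e1 e2].
have h b : {ae mu, forall x, part b (U.1 x) = part b (W.1 x)} /\
    {ae mu, forall x, part b (U.2 x) = part b (W.2 x)}.
  have [sU _ _] := shifted_ns_operator b dU; have [sW _ _] := shifted_ns_operator b dW.
  apply: (resolvent_system_unique coef lambda_gt0 sU sW).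
    exact: ae_part e1.
  exact: ae_part e2.
by split; apply: ae_part_ext => b; have [] := h b.
Qed.

(** Two real problems are solved, one for each part, and glued. The glued pair solves the resolvent
    system both for [F] and for its own image under the shifted operator, so the two data coincide
    almost everywhere. *)
Lemma shifted_ns_operator_surjective F : L2pair F ->
  exists2 U, ns_domain U & eq_L2pair (shifted A lambda%:C U) F.
Proof.
move=> [/L2C_part s1 /L2C_part s2].
have [vr [ur sysr]] := resolvent_system_solvable coef lambda_gt0 (s1 false) (s2 false).
have [vi [ui sysi]] := resolvent_system_solvable coef lambda_gt0 (s1 true) (s2 true).
have [svr sur [vr1 dvr svr1] [ur1 [ur2 [dur sur1 dur1 sur2]]]] :=
  resolvent_system_sobolev coef (s1 false) (s2 false) sysr.
have [svi sui [vi1 dvi svi1] [ui1 [ui2 [dui sui1 dui1 sui2]]]] :=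
  resolvent_system_sobolev coef (s1 true) (s2 true) sysi.
pose U : state := (fun x => vr x +i* vi x, fun x => ur x +i* ui x).
have dU : ns_domain U.
  split.
    split; first by apply/L2C_part => -[].
    exists (fun x => vr1 x +i* vi1 x); first by split.
    by split=> //; apply/L2C_part => -[].
  split; first by apply/L2C_part => -[].
  exists (fun x => ur1 x +i* ui1 x); first by split.
  split; first by apply/L2C_part => -[].
  exists (fun x => ur2 x +i* ui2 x); first by split.
  by split=> //; apply/L2C_part => -[].
exists U => //.
have h b : {ae mu, forall x, part b ((shifted A lambda%:C U).1 x) = part b (F.1 x)} /\
    {ae mu, forall x, part b ((shifted A lambda%:C U).2 x) = part b (F.2 x)}.
  have [sU _ _] := shifted_ns_operator b dU.
  have sys : resolvent_system vhat H lambda (parts b F.1) (parts b F.2) (parts b U.1) (parts b U.2).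
    by case: b {sU}.
  exact: (resolvent_system_data_unique coef sU sys).
by split; apply: ae_part_ext => b; have [] := h b.
Qed.

Lemma shifted_ns_operator_bounded_inverse : exists C : R, forall U, ns_domain U ->
  L2pair_norm U <= C * L2pair_norm (shifted A lambda%:C U).
Proof.
have [C C0 hC] := resolvent_system_bound coef lambda_gt0.
exists (Num.sqrt C) => U dU; rewrite -sqrtrM// ler_wsqrtr//.
set F := shifted A lambda%:C U.
have [[sv _] [su _]] := dU.
have sF1 : L2C F.1 by apply/L2C_part => b; have [] := shifted_ns_operator b dU.
have sF2 : L2C F.2 by apply/L2C_part => b; have [] := shifted_ns_operator b dU.
rewrite !L2norm_sqr//.
have h b : dot (parts b U.1) (parts b U.1) + dot (parts b U.2) (parts b U.2) <=
    C * (dot (parts b F.1) (parts b F.1) + dot (parts b F.2) (parts b F.2)).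
  by have [sys ? ?] := shifted_ns_operator b dU; exact: hC.
by have := h false; have := h true; lra.
Qed.

End LinearizedOperator.

Theorem theorem4p1 (R : realType) (gamma vp : R) (vhat : R -> R)
    (gamma_ge1 : 1 <= gamma) (vp_gt0 : 0 < vp) (vp_lt1 : vp < 1)
    (vhat_profile : shock_profile gamma vp vhat)
    (lambda : R) (lambda_gt0 : 0 < lambda) :
  ~ spectrum (ns_operator gamma vp vhat) ns_domain lambda%:C.
Proof.
have [q [q1 [H1 [K coef]]]] := shock_profile_coefficients gamma_ge1 vp_gt0 vp_lt1 vhat_profile.
apply; split.
- exact: shifted_ns_operator_injective coef lambda_gt0.
- exact: shifted_ns_operator_surjective coef lambda_gt0.
- exact: shifted_ns_operator_bounded_inverse coef lambda_gt0.
Qed.
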